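(* Let $K$ be a number field, $E/K$ an elliptic curve given by a Weierstrass equation, and $n\geq 2$ an integer. (1) The Galois group of $K(\widetilde{\psi}_n)$ over $K$ is isomorphic to $\overline{\rho_{E,n}}(G_K)$. (2) If $\rho_{E,n}(G_K)$ contains $-\mathrm{id}$ and $-\mathrm{id}\neq\mathrm{id}$, then the extension $K(E[n])/K(x(E[n]))$ has degree $2$. Otherwise, $K(E[n])=K(x(E[n]))$ and the Galois group of $K(\widetilde{\psi}_n)$ over $K$ is isomorphic to $\rho_{E,n}(G_K)$.
   Context: $\overline{K}$ is an algebraic closure of $K$, $G_K=\mathrm{Gal}(\overline{K}/K)$, and $\rho_{E,n}:G_K\to\mathrm{Aut}(E[n])\simeq\mathrm{GL}_2(\mathbb{Z}/n\mathbb{Z})$ is the Galois representation on the $n$-torsion of $E$. $\overline{\rho_{E,n}}=\pi_n\circ\rho_{E,n}$, where $\pi_n:\mathrm{GL}_2(\mathbb{Z}/n\mathbb{Z})\to\mathrm{GL}_2(\mathbb{Z}/n\mathbb{Z})/\{\pm\mathrm{id}\}$ is the canonical projection. $K(E[n])$ (resp. $K(x(E[n]))$) is the extension of $K$ generated by the coordinates (resp. the $x$-coordinates) of the nonzero $n$-torsion points. $E$ is given by $y^2+a_1xy+a_3y=x^3+a_2x^2+a_4x+a_6$ with $a_i\in K$. Let $(\psi_n)_{n\ge1}$ be the usual division polynomials of $E$ (with $\psi_1=1$, $\psi_2=2y+a_1x+a_3$, $\psi_n^2$ being a polynomial in $x$ with leading coefficient $n^2$ whose roots are the $x$-coordinates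 of the nonzero $n$-torsion points). The primitive division polynomials $\widetilde{\psi}_n$ are defined recursively by $\psi_n=\prod_{m\mid n}\widetilde{\psi}_m$; for $n\geq 3$, $\widetilde{\psi}_n\in K[X]$ is a polynomial in $x$ alone. For $f\in K[X]$, $K(f)$ denotes the splitting field of $f$ over $K$ in $\overline{K}$. For $n=2$ one has $\widetilde\psi_2=\psi_2$, and $K(\widetilde{\psi}_2)$ denotes by definition the splitting field of $\psi_2^2$, viewed as a polynomial in $x$. *)

(* Defs.v *)
From HB Require Import structures.
From mathcomp Require Import all_boot all_order all_algebra all_field.
From mathcomp Require Import boolp classical_sets.
From mathcomp Require Import ring zify.

Set Implicit Arguments.
Unset Strict Implicit.
Unset Printing Implicit Defensive.

Import GRing.Theory.
Local Open Scope ring_scope.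

(* Groups with a possibly infinite carrier are [groupType]s; their equality and
   choice structures come from the classical axioms of [boolp]. *)

Definition isomorphic (G H : groupType) : Prop :=
  exists f : {multiplicative G -> H}, bijective f.

Section GroupImage.
Variables (G H : groupType) (f : {multiplicative G -> H}).
Local Open Scope group_scope.

Definition im_pred : pred H := fun h => `[< exists g, f g = h >].

Lemma im_pred_closed : group_closed im_pred.
Proof.
have f1 : f 1 = 1 by apply: (mulgI (f 1)); rewrite -gmulfM !mulg1.
have fV x : f x^-1 = (f x)^-1.
  by apply: (mulgI (f x)); rewrite -gmulfM !mulgV.
split; first by apply/asboolP; exists 1.
move=> x y /asboolP[g <-] /asboolP[h <-]; apply/asboolP; exists (g / h).
by rewrite gmulfM fV.
Qed.

Record group_image := GroupImage { image_val :> H; _ : im_pred image_val }.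
HB.instance Definition _ := [isSub for image_val].
HB.instance Definition _ := [Choice of group_image by <:].
HB.instance Definition _ :=
  SubChoice_isSubGroup.Build H im_pred group_image im_pred_closed.

End GroupImage.

(* The quotient of [G] by the subgroup {1, z}, where z is central with z^2 = 1;
   [quot_pi] is the canonical projection. *)
Section Quotient.
Variables (G : groupType) (z : G).
Local Open Scope group_scope.
Hypothesis z_central_inv : (forall g, z * g = g * z) /\ z * z = 1.

Let zC : forall g, z * g = g * z := proj1 z_central_inv.
Let zz : z * z = 1 := proj2 z_central_inv.

Definition pm_rel (g h : G) : bool := (h == g) || (h == z * g).

Lemma pm_rel_refl : reflexive pm_rel.
Proof. by move=> g; rewrite /pm_rel eqxx. Qed.

Lemma pm_rel_sym : symmetric pm_rel.
Proof.
move=> g h; rewrite /pm_rel eq_sym; congr (_ || _).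
by apply/eqP/eqP => ->; rewrite mulgA zz mul1g.
Qed.

Lemma pm_rel_trans : transitive pm_rel.
Proof.
rewrite /pm_rel => h g k /orP[] /eqP-> /orP[] /eqP->;
  by rewrite ?mulgA ?zz ?mul1g ?eqxx ?orbT.
Qed.

Canonical pm_equiv := EquivRel pm_rel pm_rel_refl pm_rel_sym pm_rel_trans.

Definition quot_pm : Type := {eq_quot pm_equiv}%qT.
HB.instance Definition _ := Choice.on quot_pm.
Definition quot_pi (g : G) : quot_pm := (\pi_{eq_quot pm_equiv} g)%qT.

Let rp (a : quot_pm) : G := repr (a : {eq_quot pm_equiv}%qT).

Lemma quot_piP g h : (quot_pi g = quot_pi h) <-> (h = g \/ h = z * g).
Proof.
split=> [/eqmodP /orP[] /eqP ->|H]; [by left|by right|].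
by apply/eqmodP; case: H => ->; rewrite /= /pm_rel eqxx ?orbT.
Qed.

Lemma quot_reprK a : quot_pi (rp a) = a.
Proof. exact: reprK. Qed.

Definition quot_mul (a b : quot_pm) := quot_pi (rp a * rp b).
Definition quot_inv (a : quot_pm) := quot_pi (rp a)^-1.

Lemma quot_mulE g h : quot_mul (quot_pi g) (quot_pi h) = quot_pi (g * h).
Proof.
apply/quot_piP.
have := quot_reprK (quot_pi h); have := quot_reprK (quot_pi g).
move: (rp _) (rp _) => a b /quot_piP[->|->] /quot_piP[->|->].
- by left.
- by right; rewrite !mulgA zC.
- by right; rewrite !mulgA.
- by left; rewrite zC mulgA -[_ * z * z]mulgA zz mulg1.
Qed.

Lemma quot_invE g : quot_inv (quot_pi g) = quot_pi g^-1.
Proof.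
have zV : z^-1 = z by apply: (mulgI z); rewrite mulgV zz.
apply/quot_piP; have := quot_reprK (quot_pi g).
move: (rp _) => a /quot_piP[->|->]; first by left.
by right; rewrite invgM zV zC.
Qed.

Lemma quot_mulA : associative quot_mul.
Proof.
move=> a b c; rewrite -[a]quot_reprK -[b]quot_reprK -[c]quot_reprK.
by rewrite !quot_mulE mulgA.
Qed.

Lemma quot_mul1 : left_id (quot_pi 1) quot_mul.
Proof. by move=> a; rewrite -[a]quot_reprK quot_mulE mul1g. Qed.

Lemma quot_mulr1 : right_id (quot_pi 1) quot_mul.
Proof. by move=> a; rewrite -[a]quot_reprK quot_mulE mulg1. Qed.

Lemma quot_mulV : left_inverse (quot_pi 1) quot_inv quot_mul.
Proof. by move=> a; rewrite -[a]quot_reprK quot_invE quot_mulE mulVg. Qed.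

Lemma quot_mulrV : right_inverse (quot_pi 1) quot_inv quot_mul.
Proof. by move=> a; rewrite -[a]quot_reprK quot_invE quot_mulE mulgV. Qed.

HB.instance Definition _ := isGroup.Build quot_pm
  quot_mulA quot_mul1 quot_mulr1 quot_mulV quot_mulrV.

Lemma quot_piM : {morph quot_pi : g h / g * h}.
Proof. by move=> g h; rewrite -quot_mulE. Qed.

HB.instance Definition _ := isMultiplicative.Build G quot_pm quot_pi quot_piM.

End Quotient.

(* The automorphisms of the field F that fix the subset k pointwise. *)
Record gal (F : fieldType) (k : set F) := Gal {
  gal_fun :> F -> F;
  gal_inv : F -> F;
  gal_zmod : zmod_morphism gal_fun;
  gal_monoid : monoid_morphism gal_fun;
  gal_funK : cancel gal_fun gal_inv;
  gal_invK : cancel gal_inv gal_fun;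
  gal_fix : forall a, k a -> gal_fun a = a
}.

Section GalGroup.
Variables (F : fieldType) (k : set F).
Implicit Types s t u : gal k.

HB.instance Definition _ s := GRing.isZmodMorphism.Build F F s (gal_zmod s).
HB.instance Definition _ s := GRing.isMonoidMorphism.Build F F s (gal_monoid s).

HB.instance Definition _ := gen_eqMixin (gal k).
HB.instance Definition _ := gen_choiceMixin (gal k).

Lemma gal_ext s t : s =1 t -> s = t.
Proof.
case: s t => [f f' fa fm fK f'K ff] [g g' ga gm gK g'K gf] /= /funext fg.
rewrite {}fg in fa fm fK f'K ff *.
have fg' : f' = g' by apply/funext => x; rewrite -[RHS]fK g'K.
by rewrite {}fg' in fK f'K *; f_equal; exact: Prop_irrelevance.
Qed.

Fact gal_oneP : [/\ zmod_morphism (@id F), monoid_morphism (@id F) &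
  forall a, k a -> id a = a].
Proof. by []. Qed.

Fact gal_mulP s t : [/\ zmod_morphism (s \o t), monoid_morphism (s \o t),
  cancel (s \o t) (gal_inv t \o gal_inv s),
  cancel (gal_inv t \o gal_inv s) (s \o t) &
  forall a, k a -> (s \o t) a = a].
Proof.
split=> [x y| |x|x|a ka] /=.
- by rewrite !rmorphB.
- by split=> [|x y]; rewrite /= ?rmorph1 ?rmorphM.
- by rewrite !gal_funK.
- by rewrite !gal_invK.
- by rewrite !gal_fix.
Qed.

Fact gal_invP s : [/\ zmod_morphism (gal_inv s), monoid_morphism (gal_inv s) &
  forall a, k a -> gal_inv s a = a].
Proof.
have I := can_inj (gal_funK s).
split=> [x y| |a ka].
- by apply: I; rewrite rmorphB /= !gal_invK.
- by split=> [|x y]; apply: I; rewrite ?rmorph1 ?rmorphM /= !gal_invK.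
- by apply: I; rewrite gal_invK gal_fix.
Qed.

Definition gal_one : gal k :=
  let: And3 fa fm ff := gal_oneP in
  Gal fa fm (fun=> erefl) (fun=> erefl) ff.

Definition gal_mul s t : gal k :=
  let: And5 fa fm fK f'K ff := gal_mulP s t in Gal fa fm fK f'K ff.

Definition gal_invg s : gal k :=
  let: And3 fa fm ff := gal_invP s in
  Gal fa fm (gal_invK s) (gal_funK s) ff.

Lemma gal_oneE x : gal_one x = x.
Proof. by rewrite /gal_one; case: gal_oneP. Qed.
Lemma gal_mulE s t x : gal_mul s t x = s (t x).
Proof. by rewrite /gal_mul; case: gal_mulP. Qed.
Lemma gal_invgE s x : gal_invg s x = gal_inv s x.
Proof. by rewrite /gal_invg; case: gal_invP. Qed.
Let galE := (gal_oneE, gal_mulE, gal_invgE, gal_funK, gal_invK).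

Lemma gal_mulA : associative gal_mul.
Proof. by move=> s t u; apply: gal_ext => x; rewrite !galE. Qed.
Lemma gal_mul1 : left_id gal_one gal_mul.
Proof. by move=> s; apply: gal_ext => x; rewrite !galE. Qed.
Lemma gal_mulr1 : right_id gal_one gal_mul.
Proof. by move=> s; apply: gal_ext => x; rewrite !galE. Qed.
Lemma gal_mulV : left_inverse gal_one gal_invg gal_mul.
Proof. by move=> s; apply: gal_ext => x; rewrite !galE. Qed.
Lemma gal_mulrV : right_inverse gal_one gal_invg gal_mul.
Proof. by move=> s; apply: gal_ext => x; rewrite !galE. Qed.

HB.instance Definition _ := isGroup.Build (gal k)
  gal_mulA gal_mul1 gal_mulr1 gal_mulV gal_mulrV.

End GalGroup.

Section Subfields.
Variable L : fieldType.

Definition subfield_set : set (set L) :=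
  [set M : set L | GRing.divring_closed (fun x => x \in M)].

Definition gen_field (A : set L) : pred L :=
  fun x => `[< smallest subfield_set A x >].

Lemma gen_field_closed A : GRing.divring_closed (gen_field A).
Proof.
split.
- by apply/asboolP => M [[M1 _ _] _]; rewrite -in_setE.
- move=> x y /asboolP Ax /asboolP Ay; apply/asboolP => M MA.
  have [[_ MB _] _] := MA.
  by rewrite -in_setE; apply: MB; rewrite unfold_in in_setE; [exact: Ax|exact: Ay].
- move=> x y /asboolP Ax /asboolP Ay; apply/asboolP => M MA.
  have [[_ _ MV] _] := MA.
  by rewrite -in_setE; apply: MV; rewrite unfold_in in_setE; [exact: Ax|exact: Ay].
Qed.

HB.instance Definition _ A :=
  GRing.isDivringClosed.Build L (gen_field A) (gen_field_closed A).

Record subfield (S : divringClosed L) :=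
  Subfield { subfield_val :> L; _ : subfield_val \in S }.

HB.instance Definition _ S := [isSub for @subfield_val S].
HB.instance Definition _ S := [Choice of subfield S by <:].
HB.instance Definition _ S :=
  GRing.SubChoice_isSubIntegralDomain.Build L _ (subfield S) (divringClosedP S).
HB.instance Definition _ S :=
  [SubIntegralDomain_isSubField of subfield S by <:].

(* k is contained in F, and F has a basis with d elements over k. *)
Definition extension_degree (k F : divringClosed L) (d : nat) : Prop :=
  {subset k <= F} /\
  exists b : 'I_d -> subfield F, forall x : subfield F,
    exists! c : {ffun 'I_d -> subfield k},
      val x = \sum_(i < d) val (c i) * val (b i).

End Subfields.

(* The curve y^2 + a1 x y + a3 y = x^3 + a2 x^2 + a4 x + a6. *)
Record weierstrass (R : Type) := Weierstrass { a1 : R; a2 : R; a3 : R; a4 : R; a6 : R }.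

Definition map_weierstrass (R S : Type) (f : R -> S) (W : weierstrass R) :=
  Weierstrass (f (a1 W)) (f (a2 W)) (f (a3 W)) (f (a4 W)) (f (a6 W)).

Section Invariants.
Variables (R : comNzRingType) (W : weierstrass R).

Definition b2 : R := a1 W ^+ 2 + 4 * a2 W.
Definition b4 : R := 2 * a4 W + a1 W * a3 W.
Definition b6 : R := a3 W ^+ 2 + 4 * a6 W.
Definition b8 : R := a1 W ^+ 2 * a6 W + 4 * a2 W * a6 W - a1 W * a3 W * a4 W
                     + a2 W * a3 W ^+ 2 - a4 W ^+ 2.
Definition disc : R :=
  - b2 ^+ 2 * b8 - 8 * b4 ^+ 3 - 27 * b6 ^+ 2 + 9 * b2 * b4 * b6.

End Invariants.

Definition is_elliptic (R : comNzRingType) (W : weierstrass R) : bool :=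
  disc W != 0.

Section Points.
Variables (F : fieldType) (W : weierstrass F).

(* [None] is the point at infinity. *)
Definition on_curve (P : option (F * F)) : bool :=
  if P is Some (x, y) then
    y ^+ 2 + a1 W * x * y + a3 W * y == x ^+ 3 + a2 W * x ^+ 2 + a4 W * x + a6 W
  else true.

Definition raw_opp (P : option (F * F)) : option (F * F) :=
  if P is Some (x, y) then Some (x, - y - a1 W * x - a3 W) else None.

Definition raw_line (x1 y1 x2 l : F) : F * F :=
  let x3 := l ^+ 2 + a1 W * l - a2 W - x1 - x2 in
  (x3, l * (x1 - x3) - y1 - a1 W * x3 - a3 W).

Definition raw_add (P Q : option (F * F)) : option (F * F) :=
  match P, Q with
  | None, _ => Q
  | _, None => P
  | Some (x1, y1), Some (x2, y2) =>
    if x1 != x2 then Some (raw_line x1 y1 x2 ((y2 - y1) / (x2 - x1)))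
    else if y1 + y2 + a1 W * x2 + a3 W == 0 then None
    else Some (raw_line x1 y1 x2
      ((3 * x1 ^+ 2 + 2 * a2 W * x1 + a4 W - a1 W * y1)
       / (2 * y1 + a1 W * x1 + a3 W)))
  end.

Lemma on_curve_opp P : on_curve P -> on_curve (raw_opp P).
Proof. by case: P => [[x y]|] //= /eqP h; apply/eqP; rewrite -h; ring. Qed.

Lemma on_curve_same_x x y1 y2 : on_curve (Some (x, y1)) ->
  on_curve (Some (x, y2)) -> y1 + y2 + a1 W * x + a3 W != 0 -> y1 = y2.
Proof.
move=> /= /eqP h1 /eqP h2 ne; apply/eqP; rewrite -subr_eq0.
have : (y1 - y2) * (y1 + y2 + a1 W * x + a3 W) == 0.
  by apply/eqP; rewrite -[RHS](subrr (x ^+ 3 + a2 W * x ^+ 2 + a4 W * x + a6 W))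
     -{1}h1 -h2; ring.
by rewrite mulf_eq0 (negbTE ne) orbF.
Qed.

Lemma on_curve_add P Q :
  on_curve P -> on_curve Q -> on_curve (raw_add P Q).
Proof.
case: P => [[x1 y1]|] //; case: Q => [[x2 y2]|] //.
rewrite /raw_add; case: (eqVneq x1 x2) => /= [<-{x2}|ne] hP hQ.
  case: ifPn => //= ne; have e := on_curve_same_x hP hQ ne; rewrite -{y2}e in hQ ne.
  have d0 : 2 * y1 + a1 W * x1 + a3 W != 0 by rewrite -[X in X != 0](_ : y1 + y1 + a1 W * x1 + a3 W = _) //; ring.
  set l := _ / _.
  have hl : l * (2 * y1 + a1 W * x1 + a3 W)
            = 3 * x1 ^+ 2 + 2 * a2 W * x1 + a4 W - a1 W * y1.
    by rewrite /l divfK.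
  move: l hl => l hl.
  rewrite -subr_eq0 in hP; rewrite -subr_eq0; move/eqP: hP => hP.
  apply/eqP.
  transitivity ((y1 ^+ 2 + a1 W * x1 * y1 + a3 W * y1
     - (x1 ^+ 3 + a2 W * x1 ^+ 2 + a4 W * x1 + a6 W)) +
     ((l ^+ 2 + a1 W * l - a2 W - x1 - x1) - x1) *
     (l * (2 * y1 + a1 W * x1 + a3 W)
      - (3 * x1 ^+ 2 + 2 * a2 W * x1 + a4 W - a1 W * y1))).
    by ring.
  by rewrite hP hl subrr mulr0 addr0.
have d0 : x2 - x1 != 0 by rewrite subr_eq0 eq_sym.
set l := _ / _.
have hl : y2 = y1 + l * (x2 - x1) by rewrite /l divfK //; ring.
move: l hl => l hl; rewrite {y2}hl in hQ.
rewrite -subr_eq0 in hP; rewrite -subr_eq0 in hQ; rewrite -subr_eq0.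
move/eqP: hP => hP; move/eqP: hQ => hQ.
apply/eqP; apply: (mulfI d0); rewrite mulr0.
set x3 := l ^+ 2 + a1 W * l - a2 W - x1 - x2.
transitivity ((x2 - x3) *
  (y1 ^+ 2 + a1 W * x1 * y1 + a3 W * y1
   - (x1 ^+ 3 + a2 W * x1 ^+ 2 + a4 W * x1 + a6 W)) + (x3 - x1) *
  ((y1 + l * (x2 - x1)) ^+ 2 + a1 W * x2 * (y1 + l * (x2 - x1))
   + a3 W * (y1 + l * (x2 - x1))
   - (x2 ^+ 3 + a2 W * x2 ^+ 2 + a4 W * x2 + a6 W))).
  by rewrite /x3; ring.
by rewrite hP hQ !mulr0 addr0.
Qed.

Lemma raw_oppK : involutive raw_opp.
Proof. by case=> [[x y]|] //=; congr (Some (_, _)); ring. Qed.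

Lemma raw_oppD P Q : on_curve P -> on_curve Q ->
  raw_opp (raw_add P Q) = raw_add (raw_opp P) (raw_opp Q).
Proof.
case: P => [[x1 y1]|] //; case: Q => [[x2 y2]|] //.
rewrite /raw_add; case: (eqVneq x1 x2) => /= [<-{x2}|ne] hP hQ.
  rewrite eqxx /= -oppr_eq0.
  have <- : - (y1 + y2 + a1 W * x1 + a3 W) = - y1 - a1 W * x1 - a3 W +
     (- y2 - a1 W * x1 - a3 W) + a1 W * x1 + a3 W by ring.
  rewrite oppr_eq0; case: ifPn => //= ne.
  have e := on_curve_same_x hP hQ ne; rewrite -{y2}e in hQ ne.
  have d0 : 2 * y1 + a1 W * x1 + a3 W != 0 by rewrite -[X in X != 0](_ : y1 + y1 + a1 W * x1 + a3 W = _) //; ring.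
  have -> : (3 * x1 ^+ 2 + 2 * a2 W * x1 + a4 W
      - a1 W * (- y1 - a1 W * x1 - a3 W)) /
      (2 * (- y1 - a1 W * x1 - a3 W) + a1 W * x1 + a3 W)
    = - ((3 * x1 ^+ 2 + 2 * a2 W * x1 + a4 W - a1 W * y1) /
         (2 * y1 + a1 W * x1 + a3 W)) - a1 W.
    have -> : 2 * (- y1 - a1 W * x1 - a3 W) + a1 W * x1 + a3 W
      = - (2 * y1 + a1 W * x1 + a3 W) by ring.
    by rewrite invrN; field.
  set l := _ / _; rewrite /raw_line; congr (Some (_, _)); ring.
have d0 : x2 - x1 != 0 by rewrite subr_eq0 eq_sym.
rewrite ne /=.
have -> : (- y2 - a1 W * x2 - a3 W - (- y1 - a1 W * x1 - a3 W)) / (x2 - x1)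
  = - ((y2 - y1) / (x2 - x1)) - a1 W by field.
set l := _ / _; rewrite /raw_line; congr (Some (_, _)); ring.
Qed.

Record ec := Ec { ec_val :> option (F * F); _ : on_curve ec_val }.
HB.instance Definition _ := [isSub for ec_val].
HB.instance Definition _ := [Choice of ec by <:].

Definition ec_zero : ec := @Ec None isT.
Definition ec_opp (P : ec) : ec := Ec (on_curve_opp (valP P)).
Definition ec_add (P Q : ec) : ec := Ec (on_curve_add (valP P) (valP Q)).
Definition ec_mul (n : nat) (P : ec) : ec := iter n (ec_add P) ec_zero.

Lemma ec_oppK : involutive ec_opp.
Proof. by move=> P; apply: val_inj; rewrite /= raw_oppK. Qed.

Lemma ec_oppD P Q : ec_opp (ec_add P Q) = ec_add (ec_opp P) (ec_opp Q).
Proof. by apply: val_inj; rewrite /= raw_oppD ?(valP P) ?(valP Q). Qed.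

Lemma ec_opp_mul n P : ec_opp (ec_mul n P) = ec_mul n (ec_opp P).
Proof.
elim: n => [|n IH]; first exact: val_inj.
by rewrite /ec_mul !iterS ec_oppD -/(ec_mul n P) IH.
Qed.

Record torsion (n : nat) :=
  Torsion { torsion_val :> ec; _ : ec_mul n torsion_val == ec_zero }.
HB.instance Definition _ n := [isSub for @torsion_val n].
HB.instance Definition _ n := [Choice of torsion n by <:].

Fact torsion_opp_subproof n (P : torsion n) :
  ec_mul n (ec_opp P) == ec_zero.
Proof. by rewrite -ec_opp_mul (eqP (valP P)); apply/eqP/val_inj. Qed.

Definition torsion_opp n (P : torsion n) : torsion n :=
  Torsion (torsion_opp_subproof P).

End Points.

(* The automorphisms of the abelian group E[n]: the permutations of E[n] that
   preserve the graph {(S, T, U) | S + T = U} of its addition.  Since E[n] is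
   closed under addition, the left-to-right implication already says that f is
   additive, and the converse then follows from injectivity. *)
Record torsion_aut (F : fieldType) (W : weierstrass F) (n : nat) := TorsionAut {
  taut_fun :> torsion W n -> torsion W n;
  taut_inv : torsion W n -> torsion W n;
  taut_funK : cancel taut_fun taut_inv;
  taut_invK : cancel taut_inv taut_fun;
  taut_add : forall S T U : torsion W n,
    ec_add S T = U <-> ec_add (taut_fun S) (taut_fun T) = taut_fun U
}.

Section TorsionAut.
Variables (F : fieldType) (W : weierstrass F) (n : nat).
Implicit Types f g h : torsion_aut W n.

HB.instance Definition _ := gen_eqMixin (torsion_aut W n).
HB.instance Definition _ := gen_choiceMixin (torsion_aut W n).

Lemma taut_ext f g : f =1 g -> f = g.
Proof.
case: f g => [f f' fK f'K fD] [g g' gK g'K gD] /= /funext fg.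
rewrite {}fg in fK f'K fD *.
have fg' : f' = g' by apply/funext => x; rewrite -[RHS]fK g'K.
by rewrite {}fg' in fK f'K *; f_equal; exact: Prop_irrelevance.
Qed.

Fact taut_mul_add f g (S T U : torsion W n) :
  ec_add S T = U <-> ec_add ((f \o g) S) ((f \o g) T) = (f \o g) U.
Proof. exact: iff_trans (taut_add g S T U) (taut_add f _ _ _). Qed.

Fact taut_inv_add f (S T U : torsion W n) :
  ec_add S T = U <-> ec_add (taut_inv f S) (taut_inv f T) = taut_inv f U.
Proof.
apply: iff_sym; apply: (iff_trans (taut_add f _ _ _)).
by rewrite !taut_invK.
Qed.

Fact torsion_oppK : involutive (@torsion_opp F W n).
Proof. by move=> P; do 2 apply: val_inj; rewrite /= raw_oppK. Qed.

Fact torsion_opp_add (S T U : torsion W n) :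
  ec_add S T = U <->
  ec_add (torsion_opp S) (torsion_opp T) = torsion_opp U.
Proof.
rewrite /= -ec_oppD; split=> [->//|].
exact: (inv_inj (@ec_oppK _ W)).
Qed.

Definition taut_one : torsion_aut W n :=
  @TorsionAut F W n id id (fun=> erefl) (fun=> erefl)
    (fun S T U => iff_refl _).

Definition taut_mul f g : torsion_aut W n :=
  TorsionAut (can_comp (taut_funK f) (taut_funK g))
    (can_comp (taut_invK g) (taut_invK f)) (taut_mul_add f g).

Definition taut_invg f : torsion_aut W n :=
  TorsionAut (taut_invK f) (taut_funK f) (taut_inv_add f).

Definition taut_opp : torsion_aut W n :=
  TorsionAut torsion_oppK torsion_oppK torsion_opp_add.

Lemma taut_mulA : associative taut_mul.
Proof. by move=> f g h; apply: taut_ext. Qed.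
Lemma taut_mul1 : left_id taut_one taut_mul.
Proof. by move=> f; apply: taut_ext. Qed.
Lemma taut_mulr1 : right_id taut_one taut_mul.
Proof. by move=> f; apply: taut_ext. Qed.
Lemma taut_mulV : left_inverse taut_one taut_invg taut_mul.
Proof. by move=> f; apply: taut_ext => x /=; rewrite taut_funK. Qed.
Lemma taut_mulrV : right_inverse taut_one taut_invg taut_mul.
Proof. by move=> f; apply: taut_ext => x /=; rewrite taut_invK. Qed.

HB.instance Definition _ := isGroup.Build (torsion_aut W n)
  taut_mulA taut_mul1 taut_mulr1 taut_mulV taut_mulrV.

Lemma taut_oppM : (taut_opp * taut_opp = 1)%g.
Proof. by apply: taut_ext => P; exact: torsion_oppK. Qed.

Lemma taut_oppC f : (taut_opp * f = f * taut_opp)%g.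
Proof.
have z0 : ec_mul n (ec_zero W) == ec_zero W.
  by apply/eqP; rewrite /ec_mul; elim: n => //= m ->; apply: val_inj.
pose O : torsion W n := Torsion z0.
have fO : f O = O.
  have : ec_add O (taut_inv f O) = taut_inv f O by apply: val_inj.
  move/(taut_add f); rewrite taut_invK => h.
  apply: val_inj; apply: etrans h; apply: val_inj => /=.
  by case: (ec_val (f O)) => [[]|].
apply: taut_ext => P /=.
have : ec_add P (torsion_opp P) = O.
  apply: val_inj => /=; case: (ec_val P) => [[x y]|] //=; rewrite eqxx /=.
  by case: eqP => // -[]; ring.
move/(taut_add f); rewrite fO => /(congr1 val) /= h.
do 2 apply: val_inj; rewrite /=.
move: (ec_val (f P)) (ec_val (f (torsion_opp P))) h => [[x1 y1]|] [[x2 y2]|] //=.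
case: (eqVneq x1 x2) => [<-|_] //=; case: eqP => //= h _; congr (Some (_, _)).
by apply/eqP; rewrite -subr_eq0 -oppr_eq0; apply/eqP; rewrite -h; ring.
Qed.

Lemma taut_opp_central_inv :
  (forall f, taut_opp * f = f * taut_opp)%g /\ (taut_opp * taut_opp = 1)%g.
Proof. by split; [exact: taut_oppC | exact: taut_oppM]. Qed.

End TorsionAut.

(* K is embedded in a field L by iota; E/K is a Weierstrass curve, and E(L) is
   [ec (map_weierstrass iota E)]. *)
Section Representation.
Variables (K L : fieldType) (iota : {rmorphism K -> L}).
Variables (E : weierstrass K) (n : nat).

Let EL : weierstrass L := map_weierstrass iota E.
Let G := gal (range iota).
Implicit Types s t : G.

Definition gal_raw s (P : option (L * L)) : option (L * L) :=
  if P is Some (x, y) then Some (s x, s y) else None.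

Fact gal_iota s a : s (iota a) = iota a.
Proof. by apply: gal_fix; exists a. Qed.

Fact gal_on_curve s P : on_curve EL P -> on_curve EL (gal_raw s P).
Proof.
case: P => [[x y]|] //= /eqP /(congr1 s).
by rewrite !(rmorphD, rmorphXn, rmorphM) /= !gal_iota => ->.
Qed.

Definition gal_ec s (P : ec EL) : ec EL := Ec (gal_on_curve s (valP P)).

Fact gal_add s P Q : gal_ec s (ec_add P Q) = ec_add (gal_ec s P) (gal_ec s Q).
Proof.
apply: val_inj => /=.
move: (ec_val P) (ec_val Q) => [[x1 y1]|] [[x2 y2]|] //.
have lineE u v w l :
    gal_raw s (Some (raw_line EL u v w l)) =
    Some (raw_line EL (s u) (s v) (s w) (s l)).
  rewrite /gal_raw /raw_line; congr (Some (_, _));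
    by rewrite !(rmorphB, rmorphD, rmorphXn, rmorphM) /= !gal_iota.
rewrite -[RHS]/(raw_add EL (Some (s x1, s y1)) (Some (s x2, s y2))).
rewrite /raw_add (inj_eq (can_inj (gal_funK s))).
case: ifP => _; first by rewrite lineE rmorphM fmorphV !rmorphB.
have -> : s y1 + s y2 + a1 EL * s x2 + a3 EL = s (y1 + y2 + a1 EL * x2 + a3 EL).
  by rewrite !rmorphD !rmorphM /= !gal_iota.
rewrite fmorph_eq0; case: ifP => _ //; rewrite lineE rmorphM fmorphV.
congr (Some (raw_line _ _ _ _ (_ / _))).
  by rewrite rmorphB !(rmorph_nat, rmorphD, rmorphXn, rmorphM) /= !gal_iota.
by rewrite !(rmorph_nat, rmorphD, rmorphM) /= !gal_iota.
Qed.

Fact gal_torsion_subproof s (P : torsion EL n) :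
  ec_mul n (gal_ec s P) == ec_zero EL.
Proof.
have h m : ec_mul m (gal_ec s P) = gal_ec s (ec_mul m P).
  rewrite /ec_mul; elim: m => [|m IH] /=; first exact: val_inj.
  by rewrite IH gal_add.
by rewrite h (eqP (valP P)); apply/eqP/val_inj.
Qed.

Definition gal_torsion s (P : torsion EL n) : torsion EL n :=
  Torsion (gal_torsion_subproof s P).

Fact gal_torsionK s : cancel (gal_torsion s) (gal_torsion s^-1%g).
Proof.
move=> P; do 2 apply: val_inj; rewrite /=.
by case: (ec_val P) => [[x y]|] //=; rewrite !gal_invgE !gal_funK.
Qed.

Fact gal_torsionVK s : cancel (gal_torsion s^-1%g) (gal_torsion s).
Proof. by move=> P; rewrite -{1}[s]invgK gal_torsionK. Qed.

Fact gal_torsion_add s (S T U : torsion EL n) : ec_add S T = U <->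
  ec_add (gal_torsion s S) (gal_torsion s T) = gal_torsion s U.
Proof.
rewrite /= -gal_add; split=> [->//|/(congr1 val) /= h]; apply: val_inj => /=.
have sI := can_inj (gal_funK s).
move: (raw_add _ _ _) (ec_val U) h => [[x y]|] [[x' y']|] //= [].
by move=> /sI -> /sI ->.
Qed.

Definition torsion_rep s : torsion_aut EL n :=
  TorsionAut (gal_torsionK s) (gal_torsionVK s) (gal_torsion_add s).

Fact torsion_repM : {morph torsion_rep : s t / (s * t)%g}.
Proof.
move=> s t; apply: taut_ext => P; do 2 apply: val_inj; rewrite /=.
by case: (ec_val P) => [[x y]|] //=; rewrite !gal_mulE.
Qed.

HB.instance Definition _ :=
  isMultiplicative.Build G (torsion_aut EL n) torsion_rep torsion_repM.

(* Aut(E[n]) / {id, -id} *)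
Definition torsion_paut : groupType :=
  quot_pm (@taut_opp_central_inv L EL n).

Definition torsion_proj : {multiplicative torsion_aut EL n -> torsion_paut} :=
  quot_pi (@taut_opp_central_inv L EL n).

Definition torsion_prep : {multiplicative G -> torsion_paut} :=
  torsion_proj \o torsion_rep.

End Representation.

Arguments torsion_rep {K L} iota E n s.
Arguments torsion_prep {K L} iota E n.

Section DivisionPolynomials.
Variables (K : fieldType) (E : weierstrass K).
Implicit Types n m : nat.

(* psi_2 ^ 2 as a polynomial in x. *)
Definition psi2sq : {poly K} :=
  4 *: 'X^3 + (b2 E) *: 'X^2 + (2 * b4 E) *: 'X + (b6 E)%:P.

Definition psi3 : {poly K} :=
  3 *: 'X^4 + (b2 E) *: 'X^3 + (3 * b4 E) *: 'X^2 + (3 * b6 E) *: 'X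
  + (b8 E)%:P.

(* psi_4 / psi_2 *)
Definition psi4_red : {poly K} :=
  2 *: 'X^6 + (b2 E) *: 'X^5 + (5 * b4 E) *: 'X^4 + (10 * b6 E) *: 'X^3
  + (10 * b8 E) *: 'X^2 + (b2 E * b8 E - b4 E * b6 E) *: 'X
  + (b4 E * b8 E - b6 E ^+ 2)%:P.

(* [psi_red n] is the polynomial in x equal to psi_n for odd n and to
   psi_n / psi_2 for even n; the recursion is the one of psi, see [psi_odd] and
   [psi_even]. *)
Definition psi_red_step (f : nat -> {poly K}) n : {poly K} :=
  let m := n./2 in
  if (n < 5)%N then [:: 0; 1; 1; psi3; psi4_red]`_n
  else if odd n then
    if odd m then f m.+2 * f m ^+ 3 - psi2sq ^+ 2 * f m.-1 * f m.+1 ^+ 3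
    else psi2sq ^+ 2 * f m.+2 * f m ^+ 3 - f m.-1 * f m.+1 ^+ 3
  else f m * (f m.+2 * f m.-1 ^+ 2 - f m.-2 * f m.+1 ^+ 2).

Fixpoint psi_red_rec (fuel n : nat) : {poly K} :=
  if fuel is fuel'.+1 then psi_red_step (psi_red_rec fuel') n else 0.

Definition psi_red n : {poly K} := psi_red_rec n n.

Lemma psi_red_step_eq (f g : nat -> {poly K}) n :
  (forall m, (m < n)%N -> f m = g m) -> psi_red_step f n = psi_red_step g n.
Proof.
move=> fg; rewrite /psi_red_step; case: ltnP => // n5.
by case: ifP => o; rewrite !fg //; lia.
Qed.

Lemma psi_redE n : psi_red n = psi_red_step psi_red n.
Proof.
have stable k : forall j m, (m <= k)%N -> (m <= j)%N ->
    psi_red_rec k m = psi_red_rec j m.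
  elim: k => [|k IH] [|j] [|m] //= mk mj; apply: psi_red_step_eq => i im.
  by apply: IH; lia.
case: n => // n; apply: psi_red_step_eq => m mn.
exact: stable.
Qed.

(* Elements of K[x][y]; the ring of polynomial functions on the affine part of E
   is its quotient by [weierstrass_poly]. *)
Definition weierstrass_poly : {poly {poly K}} :=
  'X^2 + ((a1 E) *: 'X + (a3 E)%:P)%:P * 'X
  - ('X^3 + (a2 E) *: 'X^2 + (a4 E) *: 'X + (a6 E)%:P)%:P.

Definition psi2 : {poly {poly K}} := 2 * 'X + ((a1 E) *: 'X + (a3 E)%:P)%:P.

Definition psi n : {poly {poly K}} :=
  if odd n then (psi_red n)%:P else psi2 * (psi_red n)%:P.

Lemma psi2_sqr : psi2 ^+ 2 = psi2sq%:P + 4 * weierstrass_poly.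
Proof.
have -> : psi2sq = (a1 E *: 'X + (a3 E)%:P) ^+ 2
    + 4 * ('X^3 + a2 E *: 'X^2 + a4 E *: 'X + (a6 E)%:P).
  rewrite /psi2sq /b2 /b4 /b6 -!mul_polyC.
  by rewrite !(rmorph_nat, rmorphD, rmorphXn, rmorphM) /=; ring.
rewrite /psi2 /weierstrass_poly !(rmorph_nat, rmorphD, rmorphXn, rmorphM) /=.
move: (_%:P + _%:P) (_ + _%:P + _%:P + _%:P) => p q; ring.
Qed.

Definition eq_on_curve (p q : {poly {poly K}}) : Prop :=
  exists r, p - q = r * weierstrass_poly.

Lemma psi_odd m : (2 <= m)%N ->
  eq_on_curve (psi m.*2.+1)
    (psi m.+2 * psi m ^+ 3 - psi m.-1 * psi m.+1 ^+ 3).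
Proof.
move=> m2; rewrite /psi psi_redE /psi_red_step ltnNge (_ : (5 <= _)%N) /=; last by lia.
rewrite !uphalf_double !odd_double !negbK /=.
have -> : odd m.-1 = ~~ odd m by lia.
have e4 : psi2 ^+ 4 = (psi2sq%:P + 4 * weierstrass_poly) ^+ 2.
  by rewrite -psi2_sqr -exprM.
set W := weierstrass_poly in e4 *.
case: (odd m); rewrite /= !(rmorphB, rmorphXn, rmorphM) /=.
  exists ((psi_red m.-1)%:P * (psi_red m.+1)%:P ^+ 3
          * (8 * psi2sq%:P + 16 * W)).
  transitivity ((psi_red m.-1)%:P * (psi_red m.+1)%:P ^+ 3
                * (psi2 ^+ 4 - psi2sq%:P ^+ 2)); first by ring.
  by rewrite e4 -/W; move: (psi2sq%:P) (W) => F V; ring.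
exists (- (psi_red m.+2)%:P * (psi_red m)%:P ^+ 3
        * (8 * psi2sq%:P + 16 * W)).
transitivity (- (psi_red m.+2)%:P * (psi_red m)%:P ^+ 3
              * (psi2 ^+ 4 - psi2sq%:P ^+ 2)); first by ring.
by rewrite e4 -/W; move: (psi2sq%:P) (W) => F V; ring.
Qed.

Lemma psi_even m : (3 <= m)%N ->
  eq_on_curve (psi2 * psi m.*2)
    (psi m * (psi m.+2 * psi m.-1 ^+ 2 - psi m.-2 * psi m.+1 ^+ 2)).
Proof.
move=> m3; rewrite /psi psi_redE /psi_red_step ltnNge (_ : (5 <= _)%N) /=; last by lia.
rewrite !odd_double !doubleK !negbK /=.
have -> : odd m.-1 = ~~ odd m by lia.
have -> : odd m.-2 = odd m by lia.
exists 0; rewrite mul0r.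
by case: (odd m); rewrite /= !(rmorphB, rmorphXn, rmorphM) /=; ring.
Qed.

Fixpoint prim_psi_rec (fuel n : nat) : {poly K} :=
  if fuel isn't fuel'.+1 then 1 else
  psi_red n %/ \prod_(m <- divisors n | (m != n) && (m != 2%N))
                  prim_psi_rec fuel' m.

(* The n-th primitive division polynomial, for n <> 2.  The defining relation
   psi_n = \prod_(m %| n) prim_psi_m is divided by the factor
   prim_psi_2 = psi_2 when n is even; see [prim_psiE]. *)
Definition prim_psi n : {poly K} := prim_psi_rec n n.

Lemma prim_psiE n : (0 < n)%N ->
  prim_psi n = psi_red n %/ \prod_(m <- divisors n | (m != n) && (m != 2%N))
                              prim_psi m.
Proof.
have eqF (f g : nat -> {poly K}) m : (0 < m)%N ->
    (forall d, (0 < d < m)%N -> f d = g d) ->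
    \prod_(d <- divisors m | (d != m) && (d != 2%N)) f d =
    \prod_(d <- divisors m | (d != m) && (d != 2%N)) g d.
  move=> m0 fg; rewrite big_seq_cond [RHS]big_seq_cond; apply: eq_bigr => d.
  rewrite -dvdn_divisors // => /and3P[dm ne _]; apply: fg.
  by rewrite (dvdn_gt0 m0 dm) ltn_neqAle ne dvdn_leq.
have stable k : forall j m, (0 < m <= k)%N -> (m <= j)%N ->
    prim_psi_rec k m = prim_psi_rec j m.
  elim: k => [|k IH] [|j] [|m] //= mk mj; congr (_ %/ _).
  by apply: eqF => // d dm; apply: IH; lia.
case: n => // n _; rewrite {1}/prim_psi [LHS]/=; congr (_ %/ _).
by apply: eqF => // d dm; apply: stable; lia.
Qed.

(* The polynomial whose splitting field is K(prim_psi_n), by convention psi_2^2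
   for n = 2. *)
Definition prim_psi_x n : {poly K} := if n == 2%N then psi2sq else prim_psi n.

End DivisionPolynomials.

Section Closure.
Variables (K : fieldType) (Kbar : closedFieldType) (iota : {rmorphism K -> Kbar}).

(* K(A), for a subset A of Kbar *)
Definition adjoin (A : set Kbar) : divringClosed Kbar :=
  GRing.DivringClosed.clone Kbar (gen_field (range iota `|` A)) _.

Definition splitting_field (f : {poly K}) : divringClosed Kbar :=
  adjoin [set x | root (map_poly iota f) x].

(* Aut(F/K), i.e. Gal(F/K) when F/K is Galois *)
Definition Gal_over (F : divringClosed Kbar) : groupType :=
  gal [set x : subfield F | range iota (val x)].

Definition absolute_Gal : groupType := gal (range iota).

Variables (E : weierstrass K) (n : nat).

Definition torsion_field : divringClosed Kbar :=
  adjoin [set z | exists P : torsion (map_weierstrass iota E) n, exists x y,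
    ec_val P = Some (x, y) /\ (z = x \/ z = y)].

Definition torsion_x_field : divringClosed Kbar :=
  adjoin [set x | exists P : torsion (map_weierstrass iota E) n, exists y,
    ec_val P = Some (x, y)].

End Closure.

(* Main.v *)
(* The roots of the n-th primitive division polynomial are the x-coordinates of
   the points of exact order n, and every point of E[n] is a multiple of such a
   point, because multiplication by k is surjective on points over an algebraically
   closed field and E[p] is not trivial.  Hence two automorphisms s, t that agree
   on K(prim_psi_n) satisfy s P = t P or s P = - t P for each P in E[n], and the
   sign does not depend on P because a group is not the union of two proper
   subgroups: s and t have the same image in Aut(E[n]) / {id, -id}.  All the claims
   follow by Galois theory in the algebraic closure.

   For multiplication by n, one uses the symmetric biquadratic form [kummer] whose
   roots are x(P + Q) and x(P - Q).  For a point P of large order, its symmetry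
   shows that the sequence h defined by x(kP) = x(P) - h_(k+1) h_(k-1) / h_k^2
   satisfies the recursion of the division polynomials; this yields identities
   between polynomials in x, which give x(nP) = phi_n(x) / psi_n(x)^2 for all P by
   induction.  A generic fibre of phi_n / psi_n^2 has n^2 points, so E[n] has n^2
   elements, and comparison with the degree of psi_n shows that the division
   polynomials have no multiple roots; this makes the quotients in the definition
   of the primitive division polynomials exact. *)

Require Import Defs.
From HB Require Import structures.
From mathcomp Require Import all_boot all_order all_algebra all_field.
From mathcomp Require Import boolp classical_sets.
From mathcomp Require Import ring zify.

Set Implicit Arguments.
Unset Strict Implicit.
Unset Printing Implicit Defensive.

Import GRing.Theory.
Local Open Scope ring_scope.

(** Addition of points is given by raw formulas, so associativity must be proved before multiples
    can be manipulated. Since 2 is invertible, the computations use eta = 2y + a1 x + a3: the curve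
    becomes eta^2 = cubic in x, negation is a change of sign, and chords and tangents obey one and
    the same system of coefficient equations. The recursive definition of h divides by earlier
    terms, hence the detour through points none of whose first multiples vanish; being polynomial,
    the resulting identities then hold everywhere, also at points of small order. Characteristic 0
    enters through the leading coefficients of the division polynomials, through the Wronskian of
    phi_n and psi_n^2, which makes a fibre generic, and through fixed fields, where z is recovered
    from a multiple of z. Galois theory is carried out with automorphisms of the whole closure.
    Partial embeddings are graphs in L x L, so that Zorn's lemma applies to plain sets. For the
    degree 2, the basis is 1 and the eta-coordinate of a torsion point that is not its own
    opposite. *)

Section LinearCombination.
Variable R : pzRingType.
Implicit Types a b c d x y z t u v : R.

(** An equation is deduced from known equations by supplying the cofactors, so that only a
    polynomial identity is left to [ring]. *)
Lemma lincomb1 c x y a b : x = y -> a - b = c * (x - y) -> a = b.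
Proof. by move=> -> /eqP; rewrite subrr mulr0 subr_eq0 => /eqP. Qed.

Lemma lincomb2 c d x y z t a b : x = y -> z = t ->
  a - b = c * (x - y) + d * (z - t) -> a = b.
Proof. by move=> -> -> /eqP; rewrite !subrr !mulr0 addr0 subr_eq0 => /eqP. Qed.

End LinearCombination.

(** * Lines meeting the curve eta^2 = cubic x *)

Section Cubic.
Variables (F : fieldType) (c2 c4 c6 : F).
Hypothesis two0 : (2 : F) != 0.
Implicit Types x k l : F.

Definition cubic x := 4 * x ^+ 3 + c2 * x ^+ 2 + 2 * c4 * x + c6.
Definition cubic' x := 12 * x ^+ 2 + 2 * c2 * x + 2 * c4.

(* The line [eta = k + l x] meets [eta ^ 2 = cubic x] above x1, x2, x3. *)
Definition collinear x1 x2 x3 k l :=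
  [/\ c2 = l ^+ 2 - 4 * (x1 + x2 + x3),
      c4 = l * k + 2 * (x1 * x2 + x1 * x3 + x2 * x3)
    & c6 = k ^+ 2 - 4 * (x1 * x2 * x3)].

(** The hypothesis on [c2] defines [x3]. Subtracting the two curve equations and cancelling
    [x1 - x2] gives the relation for [c4]; either equation then gives the one for [c6]. *)
Lemma collinear_chord x1 x2 x3 k l : x1 != x2 ->
  c2 = l ^+ 2 - 4 * (x1 + x2 + x3) ->
  (k + l * x1) ^+ 2 = cubic x1 -> (k + l * x2) ^+ 2 = cubic x2 ->
  collinear x1 x2 x3 k l.
Proof.
rewrite -subr_eq0 /cubic => ne e2 h1 h2.
have e4 : c4 = l * k + 2 * (x1 * x2 + x1 * x3 + x2 * x3).
  apply: (mulfI ne); apply: (mulfI two0).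
  by apply: (lincomb2 (c := 1) (d := -1) h2 h1); rewrite e2; ring.
by split=> //; apply: (lincomb1 (c := -1) h1); rewrite e4 e2; ring.
Qed.

Lemma collinear_tangent x1 x3 k l :
  c2 = l ^+ 2 - 4 * (x1 + x1 + x3) ->
  (k + l * x1) ^+ 2 = cubic x1 -> 2 * (k + l * x1) * l = cubic' x1 ->
  collinear x1 x1 x3 k l.
Proof.
rewrite /cubic /cubic' => e2 h1 h2.
have e4 : c4 = l * k + 2 * (x1 * x1 + x1 * x3 + x1 * x3).
  by apply: (mulfI two0); apply: (lincomb1 (c := -1) h2); rewrite e2; ring.
by split=> //; apply: (lincomb1 (c := -1) h1); rewrite e4 e2; ring.
Qed.

(** The three equations of [collinear] are the comparison of coefficients in this identity. *)
Lemma collinear_cubic x1 x2 x3 k l x : collinear x1 x2 x3 k l ->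
  cubic x = (k + l * x) ^+ 2 + 4 * ((x - x1) * (x - x2) * (x - x3)).
Proof. by rewrite /cubic => -[-> -> ->]; ring. Qed.

Lemma collinear_cubic' x1 x2 x3 k l : collinear x1 x2 x3 k l ->
  cubic' x1 = 2 * (k + l * x1) * l + 4 * ((x1 - x2) * (x1 - x3)).
Proof. by rewrite /cubic' => -[-> -> _]; ring. Qed.

Lemma collinearC x1 x2 x3 k l : collinear x1 x2 x3 k l -> collinear x2 x1 x3 k l.
Proof. by rewrite /collinear => -[-> -> ->]; split; ring. Qed.

Lemma collinearCA x1 x2 x3 k l : collinear x1 x2 x3 k l -> collinear x1 x3 x2 k l.
Proof. by rewrite /collinear => -[-> -> ->]; split; ring. Qed.

Lemma collinearN x1 x2 x3 k l :
  collinear x1 x2 x3 k l -> collinear x1 x2 x3 (- k) (- l).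
Proof. by rewrite /collinear => -[-> -> ->]; split; ring. Qed.

(** For [x1 = x2] both lines are tangent and the derivative of the cubic determines the slope, after
    division by the ordinate; hence the last hypothesis. *)
Lemma collinear_slope x1 x2 x3 y3 k l k' l' :
  collinear x1 x2 x3 k l -> collinear x1 x2 y3 k' l' ->
  k + l * x1 = k' + l' * x1 -> k + l * x2 = k' + l' * x2 ->
  (x1 = x2 -> k + l * x1 != 0) -> k = k' /\ l = l'.
Proof.
move=> C C' e1 e2 nz; suff el : l = l'.
  by split=> //; move: e1; rewrite el => /addIr.
case: (eqVneq x1 x2) => [e|ne]; last first.
  rewrite -subr_eq0 in ne; apply: (mulfI ne).
  by apply: (lincomb2 (c := 1) (d := -1) e1 e2); ring.
subst x2; have nz2 : 2 * (k + l * x1) != 0 by rewrite mulf_neq0 // nz.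
apply: (mulfI nz2); have := collinear_cubic' C'.
rewrite -e1 (collinear_cubic' C) !subrr !mul0r !mulr0 !addr0.
by [].
Qed.

(* The key to associativity: for A + B = S with slope l, B + C of slope l' and
   S + C of slope m, the quantity m + l is 4 (xA - xC) / (l - l'), the inverse
   of the quadratic coefficient of the parabola through A, B and C; it is thus
   symmetric in A and C. *)
Lemma slope_sum xA xB xC xS xD xT k l k' l' m k1 :
  collinear xA xB xS k l -> collinear xB xC xT k' l' ->
  collinear xS xC xD k1 m ->
  k + l * xB = k' + l' * xB -> - (k + l * xS) = k1 + m * xS ->
  k' + l' * xC = k1 + m * xC ->
  (xB = xC -> xB != xS) -> (xS = xC -> k1 + m * xC != 0) ->
  (l - l') * (m + l) = 4 * (xA - xC).
Proof.
move=> CS CT CD eB eS eC neBS nzC.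
have fC : cubic xC = (k' + l' * xC) ^+ 2.
  by rewrite (collinear_cubic xC CT) subrr mulr0 mul0r mulr0 addr0.
have sum_m : k + l * xC + (k1 + m * xC) = (m + l) * (xC - xS).
  by apply: (lincomb1 (c := -1) eS); ring.
(* Above the same abscissa, B = C: the derivative of the cubic at [xB] is computed on the line AB
   and on the tangent at B, and [xB - xS] is cancelled. *)
case: (eqVneq xB xC) => [e|neBC].
  subst xC; have nBS := neBS erefl; rewrite -subr_eq0 in nBS.
  apply: (mulfI nBS).
  have := collinear_cubic' (collinearC CS); rewrite (collinear_cubic' CT).
  rewrite -eB subrr mul0r mulr0 addr0 => h.
  move: sum_m; rewrite -eC -eB => sum_m.
  apply: (lincomb2 (c := -1) (d := l - l') h (esym sum_m)); ring.
rewrite -subr_eq0 in neBC.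
have d : k + l * xC - (k' + l' * xC) = (l - l') * (xC - xB).
  by apply: (lincomb1 (c := 1) eB); ring.
(* Here S = C: the derivative at [xS] is compared on the line AB and on the tangent of slope [m],
   and the nonzero ordinate is cancelled. *)
case: (eqVneq xS xC) => [e|neSC].
  subst xC; have nz := nzC erefl; apply: (mulfI nz); apply: (mulfI two0).
  have := collinear_cubic' CD.
  rewrite (collinear_cubic' (collinearC (collinearCA (collinearC CS)))).
  rewrite subrr mul0r mulr0 addr0 => h.
  apply: (mulfI neBC).
  rewrite -eS in h nz *; rewrite eC -eS in d.
  have e2 : 2 * - (k + l * xS) = (l - l') * (xB - xS).
    by apply: (lincomb1 (c := -1) d); ring.
  apply: (lincomb2 (c := 2 * (k + l * xS) * (m + l)) (d := 2 * (k + l * xS)) e2 h).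
  by ring.
rewrite -subr_eq0 in neSC.
(* General case: the value of the cubic at [xC] is read on the lines AB and BC. The difference of
   the two squares factors as (l - l') (xC - xB) times (m + l) (xC - xS). *)
have h : (k + l * xC) ^+ 2 + 4 * ((xC - xA) * (xC - xB) * (xC - xS))
         = (k' + l' * xC) ^+ 2 by rewrite -(collinear_cubic xC CS) fC.
apply: (mulfI neSC); apply: (mulfI neBC).
have : (k + l * xC - (k' + l' * xC)) * (k + l * xC + (k' + l' * xC))
  = (l - l') * (xC - xB) * ((m + l) * (xC - xS)).
  by rewrite d eC sum_m.
move=> h2; apply: (lincomb2 (c := -1) (d := 1) h2 h); ring.
Qed.

End Cubic.

(** * The group law on the points *)

Section GroupLaw.
Variables (F : fieldType) (W : weierstrass F).
Hypothesis two0 : (2 : F) != 0.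
Hypothesis ell : is_elliptic W.
Implicit Types x y : F.
Implicit Types P Q : option (F * F).

Let f := cubic (b2 W) (b4 W) (b6 W).
Let f' := cubic' (b2 W) (b4 W).
Let col := collinear (b2 W) (b4 W) (b6 W).

(* In the coordinates (x, eta), the curve is [eta ^ 2 = cubic x] and the opposite
   of (x, eta) is (x, - eta). *)
Definition eta x y := 2 * y + a1 W * x + a3 W.

Lemma on_curveE x y : on_curve W (Some (x, y)) = (eta x y ^+ 2 == f x).
Proof.
have four0 : (4 : F) != 0 by rewrite (_ : 4 = 2 * 2) ?mulf_neq0 //; ring.
rewrite /= -subr_eq0 -(mulrI_eq0 _ (mulfI four0)) -[RHS]subr_eq0.
by congr (_ == 0); rewrite /eta /f /cubic /b2 /b4 /b6; ring.
Qed.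

Lemma eta_inj x y y' : eta x y = eta x y' -> y = y'.
Proof. by rewrite /eta => /addIr /addIr /(mulfI two0). Qed.

Lemma eta_surj x e : exists y, eta x y = e.
Proof. by exists ((e - a3 W - a1 W * x) / 2); rewrite /eta; field. Qed.

(** At a double root [r], the invariants [b4], [b6] and [b8] become polynomials in [r] and [b2], and
    the discriminant vanishes identically. *)
Lemma cubic_nonsingular r : f r = 0 -> f' r = 0 -> False.
Proof.
rewrite /f /f' /cubic /cubic' => h h'.
have e4 : b4 W = - 6 * r ^+ 2 - b2 W * r.
  by apply: (mulfI two0); apply: (lincomb1 (c := 1) h'); ring.
have e6 : b6 W = 8 * r ^+ 3 + b2 W * r ^+ 2.
  by apply: (lincomb1 (c := 1) h); rewrite e4; ring.
have four0 : (4 : F) != 0 by rewrite (_ : 4 = 2 * 2) ?mulf_neq0 //; ring.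
have e8 : b8 W = - b2 W * r ^+ 3 - 9 * r ^+ 4.
  apply: (mulfI four0); transitivity (b2 W * b6 W - b4 W ^+ 2).
    by rewrite /b2 /b4 /b6 /b8; ring.
  by rewrite e4 e6; ring.
move: ell; rewrite /is_elliptic /disc e8 e4 e6; move: (b2 W) => b.
by case/eqP; ring.
Qed.

Lemma raw_add_none x y1 y2 : eta x y1 + eta x y2 = 0 ->
  raw_add W (Some (x, y1)) (Some (x, y2)) = None.
Proof.
move=> h; rewrite /raw_add eqxx /= ifT //.
by rewrite -(mulrI_eq0 _ (mulfI two0)) -h /eta; apply/eqP; ring.
Qed.

Lemma raw_add_some x1 y1 x2 y2 :
  on_curve W (Some (x1, y1)) -> on_curve W (Some (x2, y2)) ->
  (x1 = x2 -> eta x1 y1 + eta x2 y2 != 0) ->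
  exists x3 y3 k l,
    [/\ raw_add W (Some (x1, y1)) (Some (x2, y2)) = Some (x3, y3),
        col x1 x2 x3 k l,
        eta x1 y1 = k + l * x1, eta x2 y2 = k + l * x2
      & eta x3 y3 = - (k + l * x3)].
Proof.
rewrite !on_curveE => /eqP h1 /eqP h2 nopp.
rewrite /raw_add; case: (eqVneq x1 x2) => /= [e|ne]; last first.
  set la := _ / _.
  have hla : la * (x2 - x1) = y2 - y1 by rewrite /la divfK // subr_eq0 eq_sym.
  (* A slope [la] in the coordinates (x, y) becomes [2 * la + a1 W] in (x, eta). *)
  move: la hla => la hla; pose l := 2 * la + a1 W; pose k := eta x1 y1 - l * x1.
  have e1 : eta x1 y1 = k + l * x1 by rewrite /k subrK.
  have e2 : eta x2 y2 = k + l * x2.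
    by apply: (lincomb1 (c := -2) hla); rewrite /k /l /eta; ring.
  do 2 eexists; exists k, l; split=> //; last by rewrite /k /l /eta; ring.
  apply: collinear_chord ne _ _ _; rewrite -?e1 -?e2 //.
  by rewrite /l /b2; ring.
subst x2; have nopp' := nopp erefl.
have e0 : eta x1 y1 + eta x1 y2 = 2 * (y1 + y2 + a1 W * x1 + a3 W).
  by rewrite /eta; ring.
move: nopp'; rewrite e0 mulrI_eq0; last exact: mulfI.
move=> ne; rewrite (negbTE ne).
have e12 : y1 = y2 by apply: on_curve_same_x ne; rewrite on_curveE; apply/eqP.
subst y2; have nz : eta x1 y1 != 0.
  by move: ne; rewrite (_ : _ + _ = eta x1 y1) // /eta; ring.
set la := _ / _.
have hla : la * eta x1 y1 = 3 * x1 ^+ 2 + 2 * a2 W * x1 + a4 W - a1 W * y1.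
  by rewrite /la divfK.
move: la hla => la hla; pose l := 2 * la + a1 W; pose k := eta x1 y1 - l * x1.
have e1 : eta x1 y1 = k + l * x1 by rewrite /k subrK.
do 2 eexists; exists k, l; split=> //; last by rewrite /k /l /eta; ring.
apply: collinear_tangent; rewrite -?e1 //.
  by rewrite /l /b2; ring.
apply: (lincomb1 (c := 4) hla); rewrite /l /f' /cubic' /eta /b2 /b4; ring.
Qed.

(* A copy of [ec W], indexed by the hypotheses that make it a group. *)
Definition ecG of (2 : F) != 0 & is_elliptic W : Type := ec W.
Local Notation EG := (ecG two0 ell).
HB.instance Definition _ := Choice.on EG.

Definition ecG_add (P Q : EG) : EG := ec_add P Q.
Definition ecG_opp (P : EG) : EG := ec_opp P.
Definition ecG_zero : EG := ec_zero W.

Local Infix "+E" := ecG_add (at level 50, left associativity).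
Local Notation "[-] P" := (ecG_opp P) (at level 35).
Local Notation "0E" := ecG_zero.

Definition aff (P : EG) x e : Prop :=
  exists y, ec_val P = Some (x, y) /\ e = eta x y.

Lemma aff_inj (P Q : EG) x e : aff P x e -> aff Q x e -> P = Q.
Proof.
move=> [y [hP ->]] [y' [hQ /eta_inj yy']]; apply: val_inj => /=.
by rewrite hP hQ yy'.
Qed.

Lemma aff_fun (P : EG) x e x' e' : aff P x e -> aff P x' e' -> x = x' /\ e = e'.
Proof. by rewrite /aff => -[y [-> ->]] [y' [[-> ->] ->]]. Qed.

Lemma affP (P : EG) : P = 0E \/ exists x e, aff P x e.
Proof.
case E : (ec_val P) => [[x y]|]; last by left; apply: val_inj.
by right; exists x, (eta x y), y.
Qed.

Lemma aff_not0 (P : EG) x e : aff P x e -> P <> 0E.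
Proof. by move=> [y [h _]] h'; rewrite h' in h. Qed.

Lemma aff_curve (P : EG) x e : aff P x e -> e ^+ 2 = f x.
Proof.
by move=> [y [h ->]]; apply/eqP; rewrite -on_curveE -h; exact: (valP P).
Qed.

Lemma aff_ex x e : e ^+ 2 = f x -> exists P : EG, aff P x e.
Proof.
have [y <-] := eta_surj x e; move/eqP; rewrite -on_curveE => h.
by exists (Ec h), y.
Qed.

Lemma aff_opp (P : EG) x e : aff P x e -> aff ([-] P) x (- e).
Proof.
move=> [y [h ->]]; exists (- y - a1 W * x - a3 W); split; rewrite /= ?h //.
by rewrite /eta; ring.
Qed.

Lemma aff_opp0 (P : EG) x : aff P x 0 -> [-] P = P.
Proof.
by move=> h; have := aff_opp h; rewrite oppr0 => h'; exact: aff_inj h' h.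
Qed.

Lemma aff_same_x (P Q : EG) x e e' : aff P x e -> aff Q x e' ->
  P = Q \/ P = [-] Q.
Proof.
move=> hP hQ; have := aff_curve hP; rewrite -(aff_curve hQ).
move/eqP; rewrite eqf_sqr => /orP[] /eqP h; rewrite h in hP; [left|right].
  exact: aff_inj hP hQ.
exact: aff_inj hP (aff_opp hQ).
Qed.

Lemma ecG_add0 (P : EG) : P +E 0E = P.
Proof. by apply: val_inj => /=; case: (ec_val P) => [[]|]. Qed.

Lemma ecG_0add (P : EG) : 0E +E P = P.
Proof. exact: val_inj. Qed.

Lemma ecG_oppK (P : EG) : [-] ([-] P) = P.
Proof. exact: ec_oppK. Qed.

Lemma ecG_oppD (P Q : EG) : [-] (P +E Q) = [-] P +E [-] Q.
Proof. exact: ec_oppD. Qed.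

Lemma ecG_addC (P Q : EG) : P +E Q = Q +E P.
Proof.
apply: val_inj => /=.
have := valP P : on_curve W (ec_val P); have := valP Q : on_curve W (ec_val Q).
case: (ec_val P) => [[x1 y1]|]; case: (ec_val Q) => [[x2 y2]|] //= hQ hP.
case: (eqVneq x1 x2) => [e|ne] /=; first subst x2.
  by rewrite (addrC y2); case: ifPn => // /(on_curve_same_x hP hQ) ->.
have d0 : x2 - x1 != 0 by rewrite subr_eq0 eq_sym.
have d0' : x1 - x2 != 0 by rewrite subr_eq0.
rewrite /raw_line; congr (Some (_, _)); field; by rewrite d0 d0'.
Qed.

Lemma ecG_addN (P : EG) : P +E [-] P = 0E.
Proof.
case: (affP P) => [->|[x [e hP]]]; first exact: val_inj.
have [y [h _]] := hP; apply: val_inj; rewrite [LHS]/= h.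
by apply: raw_add_none; rewrite /eta; ring.
Qed.

Lemma aff_add (P Q : EG) x1 e1 x2 e2 : aff P x1 e1 -> aff Q x2 e2 ->
  P <> [-] Q -> exists x3 k l, [/\ col x1 x2 x3 k l, e1 = k + l * x1,
    e2 = k + l * x2 & aff (P +E Q) x3 (- (k + l * x3))].
Proof.
move=> hP hQ nopp.
have neE : x1 = x2 -> e1 + e2 != 0.
  move=> e; rewrite -e in hQ; rewrite addr_eq0; apply/eqP => h.
  by apply: nopp; apply: aff_inj hP _; rewrite h; exact: aff_opp.
have [y1 [h1 E1]] := hP; have [y2 [h2 E2]] := hQ; subst e1 e2.
have cP : on_curve W (Some (x1, y1)) by rewrite -h1; exact: (valP P).
have cQ : on_curve W (Some (x2, y2)) by rewrite -h2; exact: (valP Q).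
have [x3 [y3 [k [l [h C -> -> e3]]]]] := raw_add_some cP cQ neE.
exists x3, k, l; split=> //; exists y3; split=> //=.
by rewrite h1 h2 h.
Qed.

(** While [aff_add] produces some line, here any line with the prescribed contacts computes the sum:
    by [collinear_slope] the line is unique, the excluded case of ordinate 0 at a double contact
    being P = - P. *)
Lemma aff_add_line (P Q : EG) x1 x2 x3 k l : col x1 x2 x3 k l ->
  aff P x1 (k + l * x1) -> aff Q x2 (k + l * x2) -> P <> [-] Q ->
  aff (P +E Q) x3 (- (k + l * x3)).
Proof.
move=> C hP hQ nopp.
have [x3' [k' [l' [C' e1 e2 h]]]] := aff_add hP hQ nopp.
have [] := collinear_slope two0 C C' e1 e2.
  move=> e; subst x2; apply/eqP => z; apply: nopp.
  by rewrite -(aff_inj hP hQ); rewrite z in hP; rewrite (aff_opp0 hP).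
move=> ek el; subst k' l'.
have [E _ _] := C; have [E' _ _] := C'.
have four0 : (4 : F) != 0 by rewrite (_ : 4 = 2 * 2) ?mulf_neq0 //; ring.
suff -> : x3 = x3' by [].
by apply: (mulfI four0); apply: (lincomb2 (c := 1) (d := -1) E E'); ring.
Qed.

(** The reflection of the line through P, Q and - (P + Q) passes through P + Q, - Q and - P, so it
    computes the sum of the first two. *)
Lemma ecG_addK (P Q : EG) : (P +E Q) +E [-] Q = P.
Proof.
case: (affP P) => [->|[x1 [e1 hP]]]; first by rewrite ecG_0add ecG_addN.
case: (affP Q) => [->|[x2 [e2 hQ]]].
  by rewrite ecG_add0 (_ : [-] 0E = 0E) ?ecG_add0 //; exact: val_inj.
case: (pselect (P = [-] Q)) => [->|nopp].
  by rewrite [X in X +E _]ecG_addC ecG_addN ecG_0add.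
have [x3 [k [l [C E1 E2 hS]]]] := aff_add hP hQ nopp; subst e1 e2.
have C' := collinearCA (collinearC (collinearCA (collinearN C))).
apply: aff_inj hP.
rewrite -[k + _]opprK.
have -> : - (k + l * x1) = - k + - l * x1 by ring.
apply: (aff_add_line C').
- by rewrite mulNr -opprD.
- by rewrite mulNr -opprD; exact: aff_opp.
(* If P + Q = Q, then [x3 = x2] and the ordinate there is 0, which makes [x2] a double root of the
   cubic. *)
rewrite ecG_oppK => eS; rewrite eS in hS.
have [e3 h] := aff_fun hQ hS; subst x3.
have z : k + l * x2 = 0.
  apply: (mulfI two0); rewrite mulr0; apply: (lincomb1 (c := 1) h); ring.
apply: (@cubic_nonsingular x2).
  by rewrite -(aff_curve hQ) z expr0n.
rewrite /f' (collinear_cubic' (collinearC C)) z; ring.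
Qed.

Lemma ecG_addI (P Q R : EG) : P +E R = Q +E R -> P = Q.
Proof. by move=> h; rewrite -(ecG_addK P R) h ecG_addK. Qed.

(** Coincidences among the points, the partial sums and their opposites are settled by commutativity
    and the cancellation law [ecG_addK]; the remaining case is a computation with four lines. *)
Lemma ecG_addA (P Q R : EG) : P +E (Q +E R) = (P +E Q) +E R.
Proof.
case: (affP P) => [->|[x1 [e1 hP]]]; first by rewrite !ecG_0add.
case: (affP Q) => [->|[x2 [e2 hQ]]]; first by rewrite ecG_0add ecG_add0.
case: (affP R) => [->|[x3 [e3 hR]]]; first by rewrite !ecG_add0.
case: (pselect (P = [-] Q)) => [->|nPQ].
  rewrite [X in _ = X +E _]ecG_addC ecG_addN ecG_0add ecG_addC (ecG_addC Q).
  exact: ecG_addK.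
case: (pselect (Q = [-] R)) => [->|nQR].
  rewrite [X in _ +E X]ecG_addC ecG_addN ecG_add0.
  by rewrite -{2}[R]ecG_oppK ecG_addK.
case: (pselect (P = [-] R)) => [->|nPR].
  rewrite ecG_addC ecG_addK (ecG_addC _ Q) -{2}[R]ecG_oppK.
  by rewrite -{1}[Q](ecG_addK Q ([-] R)) !ecG_oppK.
case: (pselect (P = R)) => [->|nePR].
  by rewrite ecG_addC (ecG_addC Q).
have neX : x1 != x3.
  by apply/eqP => e; subst x3; case: (aff_same_x hP hR).
case: (pselect (R = [-] (P +E Q))) => [eR|nS].
  rewrite eR ecG_addN ecG_oppD (ecG_addC ([-] P)) ecG_addC.
  have -> : Q +E ([-] Q +E [-] P) = [-] P.
    by rewrite ecG_addC (ecG_addC ([-] Q)) -{2}[Q]ecG_oppK ecG_addK.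
  by rewrite ecG_addC ecG_addN.
case: (pselect (P = [-] (Q +E R))) => [eP|nT].
  rewrite {1}eP ecG_addC ecG_addN; rewrite eP.
  rewrite ecG_oppD (ecG_addC ([-] Q)) -{2}[Q]ecG_oppK ecG_addK.
  by rewrite ecG_addC ecG_addN.
have [xS [k [l [CS E1 E2 hS]]]] := aff_add hP hQ nPQ.
have [xT [k' [l' [CT E2' E3 hT]]]] := aff_add hQ hR nQR.
have nS' : P +E Q <> [-] R by move=> h; apply: nS; rewrite h ecG_oppK.
have [xD [k1 [m [CD ES E3' hD]]]] := aff_add hS hR nS'.
have nT' : Q +E R <> [-] P by move=> h; apply: nT; rewrite h ecG_oppK.
have [xD' [k1' [m' [CD' ET E1' hD']]]] := aff_add hT hP nT'.
(* [slope_sum] is applied from both ends, to P, Q, R and to R, Q, P. As [x1 != x3], the factor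
   [l - l'] is nonzero and m + l = m' + l'; this gives both coordinates. *)
have key : (l - l') * (m + l) = 4 * (x1 - x3).
  apply: (slope_sum two0 CS CT CD); rewrite -?E2 -?E2' -?E3 -?E3' //.
    move=> e23; subst x3; case: (aff_same_x hQ hR) => // eQR.
    apply/eqP => eS; subst xS.
    case: (aff_same_x hQ hS) => h.
      apply: (aff_not0 hP); apply: (@ecG_addI _ _ Q).
      by rewrite ecG_0add -h.
    by apply: nS; rewrite -eQR.
  move=> e; subst xS; case: (aff_same_x hS hR) => // eSR.
  apply/eqP => z; apply: nS'; rewrite eSR.
  by rewrite z in hR; rewrite (aff_opp0 hR).
have key' : (l' - l) * (m' + l') = 4 * (x3 - x1).
  apply: (slope_sum two0 (collinearC CT) (collinearC CS) CD');
    rewrite -?E2 -?E2' -?E1 -?E1' //.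
    move=> e21; subst x1; case: (aff_same_x hQ hP) => [eQP|h]; last first.
      by case: nPQ; rewrite h ecG_oppK.
    apply/eqP => eT; subst xT.
    case: (aff_same_x hQ hT) => h.
      apply: (aff_not0 hR); apply: (@ecG_addI _ _ Q).
      by rewrite ecG_0add {2}h ecG_addC.
    by apply: nT; rewrite -eQP.
  move=> e; subst xT; case: (aff_same_x hT hP) => // eTP.
  apply/eqP => z; apply: nT'; rewrite eTP.
  by rewrite z in hP; rewrite (aff_opp0 hP).
have four0 : (4 : F) != 0 by rewrite (_ : 4 = 2 * 2) ?mulf_neq0 //; ring.
rewrite ecG_addC; apply: aff_inj hD' _.
have ne : l - l' != 0.
  apply: contra_neq neX => z; apply/eqP; rewrite -subr_eq0.
  by rewrite -(mulrI_eq0 _ (mulfI four0)) -key z mul0r.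
have em : m' + l' = m + l.
  by apply: (mulfI ne); rewrite key; apply: (lincomb1 (c := -1) key'); ring.
have {}em : m' = m + l - l' by rewrite -em addrK.
have [S2 _ _] := CS; have [T2 _ _] := CT; have [D2 _ _] := CD.
have [D2' _ _] := CD'.
have exD : xD = xD'.
  apply: (mulfI four0).
  have e1D : 4 * xD = m ^+ 2 - l ^+ 2 + 4 * (x1 + x2 - x3).
    by apply: (lincomb2 (c := 1) (d := -1) D2 S2); ring.
  have -> : 4 * xD' = m' ^+ 2 - l' ^+ 2 + 4 * (x3 + x2 - x1).
    by apply: (lincomb2 (c := 1) (d := -1) D2' T2); ring.
  rewrite e1D em; apply: (lincomb1 (c := 2) (esym key)); ring.
subst xD'; suff -> : k1' + m' * xD = k1 + m * xD by [].
have ek1 : k1 = e3 - m * x3 by rewrite E3' addrK.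
have ek1' : k1' = e1 - m' * x1 by rewrite E1' addrK.
have e13 : e1 - e3 = l * (x1 - x2) + l' * (x2 - x3).
  have -> : e1 - e3 = e1 - e2 + (e2 - e3) by ring.
  by rewrite {1}E1 {1}E2 {1}E2' {1}E3; ring.
apply: (mulfI four0); rewrite ek1 ek1'.
transitivity (4 * (e3 + m * (xD - x3)) + 4 * (e1 - e3) + 4 * (m' - m) * xD
              - 4 * (m' * x1 - m * x3)); first by ring.
rewrite e13 em.
have e1D : 4 * xD = m ^+ 2 - l ^+ 2 + 4 * (x1 + x2 - x3).
  by apply: (lincomb2 (c := 1) (d := -1) D2 S2); ring.
apply: (lincomb2 (c := l - l') (d := m - l) e1D key); ring.
Qed.


HB.instance Definition _ := GRing.isZmodule.Build EG ecG_addA ecG_addC ecG_0add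
  (fun P : EG => etrans (ecG_addC _ P) (ecG_addN P)).

Lemma ec_mulE n (P : EG) : ec_mul n P = P *+ n.
Proof. by elim: n => [|n IH] //; rewrite mulrS -IH. Qed.

(** * The x-coordinate as a map to the projective line, and its biquadratic form *)

Lemma four_neq0 : (4 : F) != 0.
Proof. by rewrite (_ : 4 = 2 * 2) ?mulf_neq0 //; ring. Qed.

(* Homogeneous coordinates of x(P) on the projective line. *)
Definition kx (P : EG) : F := if ec_val P is Some (x, _) then x else 1.
Definition kz (P : EG) : F := if ec_val P is Some _ then 1 else 0.
(** A form in [u] with zero x(P), which is the constant -1 at infinity; products of such forms
    express pairs of x-coordinates without excluding the point at infinity. *)
Definition kl (P : EG) u : F := u * kz P - kx P.

Definition xrep (P : EG) X Z := exists2 c, c != 0 & X = c * kx P /\ Z = c * kz P.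

(* The symmetric biquadratic form which vanishes at the x-coordinates of three
   points P, Q, R if and only if P + Q + R = 0 for a suitable choice of signs,
   homogenized in the second argument. *)
Definition kummer u X Z w : F :=
  u ^+ 2 * X ^+ 2 + u ^+ 2 * w ^+ 2 * Z ^+ 2 + X ^+ 2 * w ^+ 2
  - 2 * u * X * w * (u * Z + X + w * Z) - b2 W * u * X * w * Z
  - b4 W * (u * X * Z + u * w * Z ^+ 2 + X * w * Z)
  - b6 W * (u * Z ^+ 2 + X * Z + w * Z ^+ 2) - b8 W * Z ^+ 2.

(* The x-coordinate of 2P is [dupl x / cubic x]. *)
Definition dupl x := x ^+ 4 - b4 W * x ^+ 2 - 2 * b6 W * x - b8 W.

Lemma b8E : 4 * b8 W = b2 W * b6 W - b4 W ^+ 2.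
Proof. by rewrite /b2 /b4 /b6 /b8; ring. Qed.

(** Modulo the cubic, 16 [dupl] is the square of the derivative: this yields both the doubling
    formula and the absence of common roots. *)
Lemma duplE x : 16 * dupl x = f' x ^+ 2 - 4 * (8 * x + b2 W) * f x.
Proof.
by apply: (lincomb1 (c := -4) b8E); rewrite /dupl /f /f' /cubic /cubic'; ring.
Qed.

Lemma kummer_tangent u x : kummer u x 1 x = dupl x - f x * u.
Proof. by rewrite /kummer /dupl /f /cubic; ring. Qed.

Lemma aff_k (P : EG) x e : aff P x e -> kx P = x /\ kz P = 1.
Proof. by rewrite /kx /kz => -[y [-> _]]. Qed.

Lemma aff_kl (P : EG) x e u : aff P x e -> kl P u = u - x.
Proof. by rewrite /kl => /aff_k[-> ->]; rewrite mulr1. Qed.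

Lemma kl0 u : kl (0 : EG) u = -1.
Proof. by rewrite /kl /kx /kz /= mulr0 add0r. Qed.

Lemma klN (P : EG) u : kl (- P) u = kl P u.
Proof. by rewrite /kl /kx /kz /= /ecG_opp /=; case: (ec_val P) => [[]|]. Qed.

Lemma cubic_dupl_coprime x : f x = 0 -> dupl x != 0.
Proof.
move=> h; apply/eqP => h'; apply: (cubic_nonsingular h).
have := duplE x; rewrite h h' !mulr0 subr0 => /esym/eqP.
by rewrite expf_eq0 => /eqP.
Qed.

Lemma aff_double (P : EG) x e : aff P x e -> e != 0 ->
  exists x3 e3, aff (P + P) x3 e3 /\ dupl x = f x * x3.
Proof.
move=> hP e0; have nopp : P <> ecG_opp P.
  move=> h; have hP' := aff_opp hP; rewrite -h in hP'.
  have [_] := aff_fun hP hP'; move/eqP; rewrite -subr_eq0 opprK.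
  by rewrite -mulr2n -mulr_natl mulf_eq0 (negbTE two0) (negbTE e0).
have [x3 [k [l [C e1 _ hPP]]]] := aff_add hP hP nopp.
exists x3, (- (k + l * x3)); split=> //.
have h := collinear_cubic' C.
have hf := aff_curve hP; have [c2E _ _] := C.
have s0 : (16 : F) != 0 by rewrite (_ : 16 = 4 * 4) ?mulf_neq0 ?four_neq0 //; ring.
apply: (mulfI s0); rewrite duplE /f' h -/f -hf -e1.
by apply: (lincomb1 (c := -4 * e ^+ 2) c2E); ring.
Qed.

Lemma kummer_add (A B : EG) X Z x e : xrep A X Z -> aff B x e ->
  exists2 c, c != 0 & forall u, kummer u X Z x = c * (kl (A + B) u * kl (A - B) u).
Proof.
move=> [c c0 [-> ->]] hB.
case: (affP A) => [->|[v [e1 hA]]].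
  exists (c ^+ 2); first by rewrite expf_eq0 (negbTE c0).
  move=> u; rewrite -[0E]/(0 : EG) !add0r klN (aff_kl _ hB) /kummer /kx /kz /=.
  by ring.
have [-> ->] := aff_k hA.
suff [d d0 h] : exists2 d, d != 0 &
    forall u, kummer u v 1 x = d * (kl (A + B) u * kl (A - B) u).
  exists (c ^+ 2 * d); first by rewrite mulf_neq0 // expf_eq0 (negbTE c0).
  by move=> u; rewrite -mulrA -h /kummer; ring.
case: (eqVneq v x) => [e2|ne]; last first.
  have d0 := ne; rewrite -subr_eq0 in d0.
  have nopp : A <> ecG_opp B.
    move=> h; have hB' := aff_opp hB; rewrite -h in hB'.
    by have [h'] := aff_fun hA hB'; rewrite h' eqxx in ne.
  have nopp' : A <> ecG_opp (ecG_opp B).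
    rewrite ecG_oppK => h; rewrite -h in hB.
    by have [h'] := aff_fun hA hB; rewrite h' eqxx in ne.
  have [xp [k [l [[C2 _ _] E1 E2 hp]]]] := aff_add hA hB nopp.
  have [xm [k' [l' [[C2' _ _] E1' E2' hm]]]] := aff_add hA (aff_opp hB) nopp'.
  exists ((v - x) ^+ 2); first by rewrite expf_eq0 (negbTE d0).
  move=> u; rewrite (aff_kl _ hp) (aff_kl _ hm).
  have hA' := aff_curve hA; have hB' := aff_curve hB.
  have lE : l = (e1 - e) / (v - x) by rewrite {1}E1 E2; field.
  have lE' : l' = (e1 + e) / (v - x).
    by rewrite {1}E1' -[X in _ + X]opprK E2'; field.
  have xpE : xp = (l ^+ 2 - b2 W) / 4 - v - x.
    by apply: (mulfI four_neq0); apply: (lincomb1 (c := 1) C2); field; exact: four_neq0.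
  have xmE : xm = (l' ^+ 2 - b2 W) / 4 - v - x.
    by apply: (mulfI four_neq0); apply: (lincomb1 (c := 1) C2'); field; exact: four_neq0.
  have s0 : 16 * (v - x) ^+ 2 != 0.
    rewrite mulf_neq0 ?expf_eq0 ?(negbTE d0) //.
    by rewrite (_ : 16 = 4 * 4) ?mulf_neq0 ?four_neq0 //; ring.
  apply: (mulfI s0).
  (* [al + 2 * e1 * e] and [al - 2 * e1 * e] are 4 (v - x)^2 times the forms of A + B and A - B.
     Their product contains only squares of ordinates, which the curve equation eliminates. *)
  pose al := 4 * (v - x) ^+ 2 * u - (e1 ^+ 2 + e ^+ 2) + b2 W * (v - x) ^+ 2
             + 4 * (v + x) * (v - x) ^+ 2.
  transitivity (al ^+ 2 - 4 * e1 ^+ 2 * e ^+ 2).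
    rewrite /al hA' hB' /f /cubic /kummer.
    by apply: (lincomb1 (c := - 4 * (v - x) ^+ 2) b8E); ring.
  rewrite /al xpE xmE lE lE'; field.
  by rewrite d0 four_neq0.
subst v.
(* For A = B or A = - B, one of A + B and A - B is 0 and contributes a constant. If moreover the
   ordinate is 0, the other is 0 too, and the whole form is the constant [dupl x], nonzero by
   [cubic_dupl_coprime]. *)
have even_case (Q : EG) y : aff Q x y -> exists2 d, d != 0 &
    forall u, kummer u x 1 x = d * (kl (Q + Q) u * kl 0 u).
  move=> hQ; case: (eqVneq y 0) => [z|y0].
    rewrite z in hQ; have hf := aff_curve hQ; rewrite expr0n /= in hf.
    have nQ : - Q = Q := aff_opp0 hQ.
    exists (dupl x); first exact: cubic_dupl_coprime.
    by move=> u; rewrite -{2}nQ subrr !kl0 kummer_tangent -hf; ring.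
  have [x3 [e3 [h3 hd]]] := aff_double hQ y0.
  exists (f x); first by rewrite -(aff_curve hQ) expf_eq0.
  by move=> u; rewrite (aff_kl _ h3) kl0 kummer_tangent hd; ring.
case: (aff_same_x hA hB) => [eAB|eAB].
  have [d d0 h] := even_case _ _ hA.
  by exists d => // u; rewrite h -eAB subrr.
have [d d0 h] := even_case _ _ hA.
exists d => // u; have -> : B = - A by rewrite eAB -[RHS]/(ecG_opp _) ecG_oppK.
by rewrite opprK subrr mulrC h; ring.
Qed.

(* One step of the Montgomery ladder. *)
Lemma xrep_ladder (A B : EG) x e X Z Xm Zm Xp Zp :
  aff B x e -> xrep A X Z -> xrep (A - B) Xm Zm ->
  (forall u, kummer u X Z x = (u * Zp - Xp) * (u * Zm - Xm)) ->
  xrep (A + B) Xp Zp.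
Proof.
move=> hB hA [c c0 [-> ->]] h.
have [d d0 hd] := kummer_add hA hB.
have {h} h u : kl (A - B) u != 0 ->
    u * Zp - Xp = d / c * (u * kz (A + B) - kx (A + B)).
  move=> nz; apply: (mulIf nz); apply: (mulIf c0).
  transitivity (kummer u X Z x); first by rewrite h /kl; ring.
  by rewrite hd /kl; field.
(* The form of A - B has at most one zero [a]; the two values a + 1 and a + 2 suffice to identify
   the form of A + B. *)
have [a ha] : exists a, forall u, u != a -> kl (A - B) u != 0.
  case: (affP (A - B)) => [->|[a [y ha]]].
    by exists 0 => u _; rewrite kl0 oppr_eq0 oner_eq0.
  by exists a => u ne; rewrite (aff_kl _ ha) subr_eq0.
have n1 : a + 1 != a by rewrite -subr_eq0 addrAC subrr add0r oner_eq0.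
have n2 : a + 2 != a by rewrite -subr_eq0 addrAC subrr add0r.
have h1 := h _ (ha _ n1); have h2 := h _ (ha _ n2).
exists (d / c); first by rewrite mulf_neq0 // invr_eq0.
have hz : Zp = d / c * kz (A + B).
  by apply: (lincomb2 (c := 1) (d := -1) h2 h1); ring.
split=> //; apply: (lincomb1 (c := -1) h1); rewrite hz; ring.
Qed.

Lemma xrep0 (P : EG) X Z : xrep P X Z -> (P = 0 <-> Z = 0).
Proof.
move=> [c c0 [_ ->]]; split=> [->|]; first by rewrite /kz /= mulr0.
move/eqP; rewrite mulf_eq0 (negbTE c0) /= => /eqP.
case: (affP P) => // -[x [e h]]; have [_ ->] := aff_k h.
by move/eqP; rewrite oner_eq0.
Qed.

Lemma xrep_aff (P : EG) X Z x e : xrep P X Z -> aff P x e -> X = x * Z.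
Proof. by move=> [c _ [-> ->]] /aff_k[-> ->]; ring. Qed.

Lemma xrep_nz (P : EG) X Z : xrep P X Z -> Z = 0 -> X != 0.
Proof.
move=> h Z0; have P0 : P = 0 by apply/(xrep0 h).
by case: h => c c0 [-> _]; rewrite P0 /kx /= mulr1.
Qed.

End GroupLaw.

(** * Division polynomials *)

(* [hornerE] would unfold the division polynomials. *)
Definition horner_simp := (hornerD, hornerN, hornerM, horner_exp, hornerZ,
  hornerXn, hornerX, hornerC).

(** * The values of the division polynomials at a point of large order *)

Section EllipticSequence.
Variables (F : fieldType) (W : weierstrass F).
Hypotheses (two0 : (2 : F) != 0) (ell : is_elliptic W).
Local Notation EG := (ecG two0 ell).
Local Notation f := (cubic (b2 W) (b4 W) (b6 W)).

(** The constant of [kummer_add] is the coefficient of u^2, isolated by a second difference at u =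
    0, 1, 2. *)
Lemma kummer_affine (A B : EG) v a x b xp ep xm em u :
  aff A v a -> aff B x b -> aff (A + B) xp ep -> aff (A - B) xm em ->
  kummer W u v 1 x = (v - x) ^+ 2 * ((u - xp) * (u - xm)).
Proof.
move=> hA hB hp hm.
have rA : xrep A v 1.
  by exists 1; rewrite ?oner_eq0 //; have [-> ->] := aff_k hA; rewrite !mul1r.
have [c _ h] := kummer_add rA hB.
have {}h t : kummer W t v 1 x = c * ((t - xp) * (t - xm)).
  by rewrite h (aff_kl _ hp) (aff_kl _ hm).
rewrite h; congr (_ * _); apply: (mulfI two0).
transitivity (kummer W 2 v 1 x - 2 * kummer W 1 v 1 x + kummer W 0 v 1 x).
  by rewrite !h; ring.
by rewrite /kummer; ring.
Qed.

Lemma kummerC u v w : kummer W u v 1 w = kummer W v u 1 w.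
Proof. by rewrite /kummer; ring. Qed.

Lemma kummerCA u v w : kummer W u v 1 w = kummer W u w 1 v.
Proof. by rewrite /kummer; ring. Qed.

Variables (P : EG) (x e : F).
Hypothesis hP : aff P x e.

Local Notation xk k := (kx (P *+ k)).

(* The values psi_k(P), obtained here from
   x(kP) = x - psi_(k+1) psi_(k-1) / psi_k^2. *)
Fixpoint ellseq n : F :=
  match n with
  | 0 => 0
  | 1 => 1
  | (n''.+1 as n').+1 =>
    if n'' is 0 then e else (x - xk n') * ellseq n' ^+ 2 / ellseq n''
  end.

(** No positive multiple of P below [N] vanishes; this keeps the divisors in [ellseq] nonzero up to
    index [N]. *)
Variable N : nat.
Hypothesis hN : forall j, (0 < j < N)%N -> P *+ j <> 0.

Lemma aff_mul k : (0 < k < N)%N -> exists y, aff (P *+ k) (xk k) y.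
Proof.
move=> /hN nz; case: (affP (P *+ k)) => // -[x' [y h]].
by exists y; have [-> _] := aff_k h.
Qed.

Lemma kx1 : xk 1 = x.
Proof. by have [-> _] := aff_k hP. Qed.

Lemma xk_neq m n : (0 < n < m)%N -> (m + n < N)%N -> xk m != xk n.
Proof.
move=> nm mN; apply/eqP => h.
have [|y hm] := @aff_mul m; first lia.
have [|y' hn] := @aff_mul n; first lia.
rewrite h in hm; case: (aff_same_x hm hn) => E.
  have := @hN (m - n)%N; rewrite mulrnBr; last by lia.
  by rewrite E subrr; apply=> //; lia.
have := @hN (m + n)%N; rewrite mulrnDr E; apply; first by lia.
exact: (@addNr EG).
Qed.

Lemma ellseq_neq0 k : (0 < k < N)%N -> ellseq k != 0.
Proof.
suff h j : ((j.+1 < N)%N -> ellseq j.+1 != 0) /\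
           ((j.+2 < N)%N -> ellseq j.+2 != 0).
  by case: k => // k; case: (h k).
elim: j => [|j [IH1 IH2]].
  split=> h; first exact: oner_neq0.
  rewrite /=; apply/eqP => z; apply: (@hN 2) => //.
  have nP : ecG_opp P = P by apply: (@aff_opp0 _ _ _ _ P x); rewrite -z.
  by rewrite mulr2n -{2}nP; exact: (@addrN EG).
split=> // h; have -> : ellseq j.+3 =
  (x - xk j.+2) * ellseq j.+2 ^+ 2 / ellseq j.+1 by [].
rewrite !mulf_neq0 ?invr_eq0 ?expf_eq0 /= ?negb_and ?IH1 ?IH2 //; try by lia.
by rewrite subr_eq0 eq_sym -kx1 xk_neq //; lia.
Qed.

Lemma ellseq_rec k : (0 < k < N)%N ->
  ellseq k.+1 * ellseq k.-1 = (x - xk k) * ellseq k ^+ 2.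
Proof.
case: k => // -[|k] h; first by rewrite kx1 subrr mulr0 mul0r.
by rewrite -[ellseq k.+3]/(_ / ellseq k.+1) divfK // ellseq_neq0 //; lia.
Qed.

Lemma kummer_mul m n u : (0 < n < m)%N -> (m + n < N)%N ->
  kummer W u (xk m) 1 (xk n) =
  (xk m - xk n) ^+ 2 * ((u - xk (m + n)%N) * (u - xk (m - n)%N)).
Proof.
move=> nm mN.
have [|y1 h1] := @aff_mul m; first lia.
have [|y2 h2] := @aff_mul n; first lia.
have [|y3 h3] := @aff_mul (m + n)%N; first lia.
have [|y4 h4] := @aff_mul (m - n)%N; first lia.
apply: (kummer_affine u h1 h2); first by rewrite -mulrnDr; exact: h3.
by rewrite -mulrnBr; [exact: h4 | lia].
Qed.

Lemma xk2 : (2 < N)%N -> dupl W x = f x * xk 2.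
Proof.
move=> N2; have e0 : e != 0 by apply: (ellseq_neq0 (k := 2)).
have [x3 [e3 [h ->]]] := aff_double hP e0.
by rewrite mulr2n; have [-> _] := aff_k h.
Qed.

(** Induction on [n], from [n] and [n - 1] to [n + 1]: the recursions at i + n and i - n are
    multiplied together, and the product of the two differences x - x((i + n)P) and x - x((i - n)P)
    is a value of [kummer]. *)
Lemma ellseq_mul n m : (0 < n < m)%N -> (m + n <= N)%N ->
  ellseq (m + n) * ellseq (m - n) =
  (xk n - xk m) * ellseq m ^+ 2 * ellseq n ^+ 2.
Proof.
suff h j : (forall i, (j.+1 < i)%N -> (i + j.+1 <= N)%N ->
       ellseq (i + j.+1) * ellseq (i - j.+1) =
       (xk j.+1 - xk i) * ellseq i ^+ 2 * ellseq j.+1 ^+ 2) /\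
    (forall i, (j.+2 < i)%N -> (i + j.+2 <= N)%N ->
       ellseq (i + j.+2) * ellseq (i - j.+2) =
       (xk j.+2 - xk i) * ellseq i ^+ 2 * ellseq j.+2 ^+ 2).
  by case: n => // n /andP[_ nm]; case: (h n) => + _; apply.
have h1 i : (1 < i)%N -> (i < N)%N ->
    ellseq i.+1 * ellseq i.-1 = (xk 1 - xk i) * ellseq i ^+ 2.
  by move=> i1 iN; rewrite kx1 ellseq_rec //; lia.
elim: j {n m} => [|j [IH1 IH2]].
  split=> i ij iN.
    by rewrite addn1 subn1 h1 ?expr1n ?mulr1 //; lia.
  have nz : ellseq i != 0 by apply: ellseq_neq0; lia.
  have E1 : ellseq i.+2 * ellseq i = (x - xk i.+1) * ellseq i.+1 ^+ 2.
    by apply: (ellseq_rec (k := i.+1)); lia.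
  have E2 : ellseq i * ellseq i.-2 = (x - xk i.-1) * ellseq i.-1 ^+ 2.
    by rewrite -ellseq_rec ?prednK //; lia.
  have E3 := ellseq_rec (k := i) ltac:(lia).
  rewrite addn2 subn2.
  have nz2 : ellseq i ^+ 2 != 0 by rewrite expf_eq0 (negbTE nz).
  apply: (mulfI nz2).
  have K := kummer_mul x (m := i) (n := 1) ltac:(lia) ltac:(lia).
  rewrite kx1 addn1 subn1 kummerC in K.
  (* For n = 2 the form of the pair (P, P) occurs, which [kummer_mul] does not cover; the tangent
     case replaces it. *)
  have Kt : kummer W (xk i) x 1 x = f x * (xk 2 - xk i).
    by rewrite kummer_tangent xk2 //; [ring | lia].
  rewrite Kt in K.
  transitivity ((ellseq i.+2 * ellseq i) * (ellseq i * ellseq i.-2)).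
    by ring.
  rewrite E1 E2.
  transitivity ((x - xk i.+1) * (x - xk i.-1) * (ellseq i.+1 * ellseq i.-1) ^+ 2).
    by ring.
  rewrite E3.
  transitivity ((xk i - x) ^+ 2 * ((x - xk i.+1) * (x - xk i.-1)) * ellseq i ^+ 4).
    by ring.
  by rewrite -K -(aff_curve hP) [ellseq 2]/=; ring.
split=> // i ij iN.
set n := j.+2 in ij iN IH2 *.
have En := ellseq_rec (k := n) ltac:(lia).
have Ep := ellseq_rec (k := (i + n)%N) ltac:(lia).
have Em := ellseq_rec (k := (i - n)%N) ltac:(lia).
have I2 := IH2 i ltac:(lia) ltac:(lia).
have I1 := IH1 i ltac:(lia) ltac:(lia).
have K1 := kummer_mul x (m := i) (n := n) ltac:(lia) ltac:(lia).
have K2 := kummer_mul (xk i) (m := n) (n := 1) ltac:(lia) ltac:(lia).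
rewrite kx1 addn1 subn1 in K2.
rewrite (_ : (i - n).+1 = (i - n.-1)%N) in Em; last by lia.
rewrite (_ : (i - n).-1 = (i - n.+1)%N) in Em; last by lia.
rewrite (_ : (i + n).-1 = (i + n.-1)%N) in Ep; last by lia.
rewrite -(addnS i n) in Ep.
have nz1 : ellseq (i + n.-1) != 0 by apply: ellseq_neq0; lia.
have nz2 : ellseq (i - n.-1) != 0 by apply: ellseq_neq0; lia.
rewrite -/(n.-1) in I1.
apply: (mulfI (mulf_neq0 nz1 nz2)).
transitivity ((ellseq (i + n.+1) * ellseq (i + n.-1)) *
              (ellseq (i - n.-1) * ellseq (i - n.+1))); first by ring.
rewrite Ep Em.
transitivity ((x - xk (i + n)%N) * (x - xk (i - n)%N) *
   (ellseq (i + n) * ellseq (i - n)) ^+ 2); first by ring.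
rewrite I2 [ellseq (i + n.-1) * _]I1.
transitivity (((xk i - xk n) ^+ 2 * ((x - xk (i + n)%N) * (x - xk (i - n)%N))) *
   ellseq i ^+ 4 * ellseq n ^+ 4); first by ring.
(* By symmetry, the value at x of the form of (iP, nP) is the value at x(iP) of the form of (nP, P),
   whose roots are x((n + 1)P) and x((n - 1)P). *)
rewrite -K1 (kummerC x) (kummerCA _ x) K2.
transitivity ((xk n.-1 - xk i) * (xk n.+1 - xk i) * ellseq i ^+ 4 *
  ((x - xk n) * ellseq n ^+ 2) ^+ 2); first by ring.
by rewrite -En; ring.
Qed.

(** The case (m + 1, m) of [ellseq_mul]; [ellseq_even] is the case (m + 1, m - 1). The index
    differences 1 and 2 contribute the factors 1 and [e], and [ellseq_rec] eliminates the
    x-coordinates. *)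
Lemma ellseq_odd m : (1 < m)%N -> (m.*2.+1 <= N)%N ->
  ellseq m.*2.+1 = ellseq m.+2 * ellseq m ^+ 3 - ellseq m.-1 * ellseq m.+1 ^+ 3.
Proof.
move=> m1 mN.
have E := @ellseq_mul m m.+1 ltac:(lia) ltac:(lia).
rewrite (_ : (m.+1 + m)%N = m.*2.+1) in E; last by lia.
rewrite (_ : (m.+1 - m)%N = 1%N) in E; last by lia.
have E1 : ellseq m.+2 * ellseq m = _ := ellseq_rec (k := m.+1) ltac:(lia).
have E2 := ellseq_rec (k := m) ltac:(lia).
rewrite -[LHS]mulr1 E.
apply: (lincomb2 (c := - ellseq m ^+ 2) (d := ellseq m.+1 ^+ 2) E1 E2).
by ring.
Qed.

Lemma ellseq_even m : (1 < m)%N -> (m.*2 <= N)%N ->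
  e * ellseq m.*2 =
  ellseq m * (ellseq m.+2 * ellseq m.-1 ^+ 2 - ellseq m.-2 * ellseq m.+1 ^+ 2).
Proof.
move=> m1 mN.
have E := @ellseq_mul m.-1 m.+1 ltac:(lia) ltac:(lia).
rewrite (_ : (m.+1 + m.-1)%N = m.*2) in E; last by lia.
rewrite (_ : (m.+1 - m.-1)%N = 2%N) in E; last by lia.
have E1 : ellseq m.+2 * ellseq m = _ := ellseq_rec (k := m.+1) ltac:(lia).
have E2 := ellseq_rec (k := m.-1) ltac:(lia).
rewrite prednK in E2; last by lia.
rewrite mulrC -[e]/(ellseq 2) E.
apply: (lincomb2 (c := - ellseq m.-1 ^+ 2) (d := ellseq m.+1 ^+ 2) E1 E2).
by ring.
Qed.

(** The value of psi_n at the point, [e] being that of psi_2. *)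
Definition psi_val n : F := (psi_red W n).[x] * (if odd n then 1 else e).

Lemma psi2sqE : (psi2sq W).[x] = f x.
Proof. rewrite /psi2sq !horner_simp /cubic; ring. Qed.

Lemma psi_redS n : (4 < n)%N -> psi_red W n = let m := n./2 in
  if odd n then
    if odd m then psi_red W m.+2 * psi_red W m ^+ 3 -
                  psi2sq W ^+ 2 * psi_red W m.-1 * psi_red W m.+1 ^+ 3
    else psi2sq W ^+ 2 * psi_red W m.+2 * psi_red W m ^+ 3
         - psi_red W m.-1 * psi_red W m.+1 ^+ 3
  else psi_red W m * (psi_red W m.+2 * psi_red W m.-1 ^+ 2
                      - psi_red W m.-2 * psi_red W m.+1 ^+ 2).
Proof. by move=> n4; rewrite psi_redE /psi_red_step ltnNge n4. Qed.

Lemma psi_val_odd m : (1 < m)%N ->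
  psi_val m.*2.+1 = psi_val m.+2 * psi_val m ^+ 3 - psi_val m.-1 * psi_val m.+1 ^+ 3.
Proof.
move=> m1; have fe := aff_curve hP.
rewrite /psi_val psi_redS /=; last by lia.
rewrite !uphalf_double !odd_double !negbK /= mulr1.
have -> : odd m.-1 = ~~ odd m by lia.
move: psi2sqE; rewrite -fe; move: (psi2sq W) => q hq.
by case: (odd m); rewrite /= !horner_simp hq; ring.
Qed.

Lemma psi_val_even m : (2 < m)%N -> e * psi_val m.*2 =
  psi_val m * (psi_val m.+2 * psi_val m.-1 ^+ 2 - psi_val m.-2 * psi_val m.+1 ^+ 2).
Proof.
move=> m2; have fe := aff_curve hP.
rewrite /psi_val psi_redS /=; last by lia.
rewrite !odd_double !doubleK !negbK /=.
have -> : odd m.-1 = ~~ odd m by lia.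
have -> : odd m.-2 = odd m by lia.
by case: (odd m); rewrite /= !horner_simp; ring.
Qed.

Lemma psi3E : (psi3 W).[x] = x * f x - dupl W x.
Proof. by rewrite /psi3 !horner_simp /cubic /dupl; ring. Qed.

(** With [dupl x : f x] for x(2P), the factor of the form coming from 2P - P = P is u - x, equal to
    1 at u = x + 1. Subtracting psi_3^2 leaves psi_3^2 (x - x(3P)), which is psi_2 psi_4. *)
Lemma psi4E : (psi4_red W).[x] * f x =
  kummer W (x + 1) (dupl W x) (f x) x - (dupl W x - x * f x) ^+ 2.
Proof.
rewrite /psi4_red !horner_simp /cubic /dupl /kummer /b2 /b4 /b6 /b8.
by ring.
Qed.

Lemma ellseqE n : (n <= N)%N -> ellseq n = psi_val n.
Proof.
elim/ltn_ind: n => n IH nN.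
have e0 : (2 < N)%N -> e != 0 by move=> h; apply: (ellseq_neq0 (k := 2)).
have fe := aff_curve hP.
have f0 : (2 < N)%N -> f x != 0 by move=> /e0 h; rewrite -fe expf_eq0.
case: (ltnP n 5) => n5.
  have E3 : (3 <= N)%N -> ellseq 3 = (x - xk 2) * e ^+ 2.
    move=> h; rewrite -[LHS]mulr1.
    by rewrite -[e]/(ellseq 2) -ellseq_rec //; lia.
  case: n n5 nN {IH} => [|[|[|[|[|//]]]]] _ nN; rewrite /psi_val psi_redE.
  - by rewrite horner0 mul0r.
  - by rewrite hornerC mul1r.
  - by rewrite hornerC mul1r.
  - by rewrite E3 // fe [odd 3]/= mulr1 psi3E xk2 //; ring.
  have E4 : ellseq 4 * e = (x - xk 3) * ellseq 3 ^+ 2.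
    exact: (ellseq_rec (k := 3)).
  have ez : e != 0 by apply: e0; lia.
  apply: (mulIf ez); rewrite E4 E3; last by lia.
  transitivity ((psi4_red W).[x] * f x); last by rewrite -fe /=; ring.
  rewrite psi4E xk2; last by lia.
  have := kummer_mul (x + 1) (m := 2) (n := 1) isT nN.
  rewrite kx1 => K.
  have -> : kummer W (x + 1) (f x * xk 2) (f x) x =
            f x ^+ 2 * kummer W (x + 1) (xk 2) 1 x by rewrite /kummer; ring.
  by rewrite K fe; ring.
case: (boolP (odd n)) => on.
  rewrite -[n]odd_double_half on add1n in nN IH n5 *.
  move: (n./2) nN IH n5 => m nN IH n5.
  rewrite ellseq_odd ?psi_val_odd ?IH //; lia.
rewrite -[n]odd_double_half (negbTE on) add0n in nN IH n5 *.
move: (n./2) nN IH n5 => m nN IH n5.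
have ez : e != 0 by apply: e0; lia.
apply: (mulfI ez); rewrite ellseq_even ?psi_val_even ?IH //; lia.
Qed.

(** For N > 2, the point (N - 1)P = - P has abscissa [x], which cancels the factor x - x((N - 1)P)
    of [ellseq N]. For N = 2, P = - P forces e = 0. *)
Lemma psi_val_N : (1 < N)%N -> P *+ N = 0 -> psi_val N = 0.
Proof.
case: N hN ellseqE ellseq_rec => [|[|n]] // hn eE eR _ PN; rewrite -eE //.
case: n hn {eE} eR PN => [|n] hn eR PN.
  have := PN; rewrite mulr2n => /eqP; rewrite addr_eq0 => /eqP eP.
  have h : aff P x (- e) by rewrite {1}eP; exact: aff_opp hP.
  have [_] := aff_fun hP h; move/eqP; rewrite -subr_eq0 opprK.
  by rewrite -mulr2n -mulr_natl mulf_eq0 (negbTE two0) /= => /eqP.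
suff -> : ellseq n.+3 = (x - xk n.+2) * ellseq n.+2 ^+ 2 / ellseq n.+1.
  have -> : xk n.+2 = x.
    have : P *+ n.+2 = - P by apply/eqP; rewrite -addr_eq0 -mulrSr PN.
    by move=> ->; have [-> _] := aff_k (aff_opp hP).
  by rewrite subrr !mul0r.
by [].
Qed.

End EllipticSequence.

(** * Degrees and leading coefficients of the division polynomials *)

Section LeadingTerm.
Variable R : idomainType.
Implicit Types (p q : {poly R}) (c : R) (d n : nat).

(** [c] may be 0, so that the notion is stable under subtraction whether or not leading terms
    cancel. *)
Definition lead_term p d c := (size p <= d.+1)%N /\ p`_d = c.

Lemma lead_term_eq p d c d' c' :
  lead_term p d c -> d = d' -> c = c' -> lead_term p d' c'.
Proof. by move=> h <- <-. Qed.

Lemma lead_termM p q d c d' c' :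
  lead_term p d c -> lead_term q d' c' -> lead_term (p * q) (d + d') (c * c').
Proof.
move=> [sp pd] [sq qd]; split.
  by apply: leq_trans (size_polyMleq _ _) _; lia.
have dd : (d < (d + d').+1)%N by lia.
rewrite coefM (bigD1 (Ordinal dd)) //= pd addKn qd big1 ?addr0 // => i.
rewrite -val_eqE /= => ne; case: (ltngtP i d) => h; last by rewrite h eqxx in ne.
  by rewrite [q`_ _]nth_default ?mulr0 //; apply: leq_trans sq _; lia.
by rewrite [p`_ _]nth_default ?mul0r //; apply: leq_trans sp _; lia.
Qed.

Lemma lead_termX p d c n : lead_term p d c -> lead_term (p ^+ n) (n * d) (c ^+ n).
Proof.
move=> h; elim: n => [|n IH]; first by split; rewrite ?coefC ?size_poly1.
by rewrite mulSn !exprS; exact: lead_termM.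
Qed.

Lemma lead_termB p q d c c' :
  lead_term p d c -> lead_term q d c' -> lead_term (p - q) d (c - c').
Proof.
move=> [sp pd] [sq qd]; split; last by rewrite coefB pd qd.
by apply: leq_trans (size_polyD _ _) _; rewrite size_polyN geq_max sp sq.
Qed.

Lemma lead_term_size p d c : lead_term p d c -> c != 0 -> size p = d.+1.
Proof.
move=> [sp pd] c0; apply/eqP; rewrite eqn_leq sp ltnNge.
by apply: contra_neqN c0 => h; rewrite -pd nth_default.
Qed.

Lemma lead_termXn n : lead_term 'X^n n 1.
Proof. by split; rewrite ?size_polyXn // coefXn eqxx. Qed.

End LeadingTerm.

Section DivisionDegree.
Variables (F : fieldType) (W : weierstrass F).

Lemma lead_psi2sq : lead_term (psi2sq W) 3 4.
Proof.
split; last first.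
  by rewrite /psi2sq !coefD !coefZ !coefXn coefX coefC /= !mulr0 !addr0 mulr1.
rewrite /psi2sq; apply/leq_sizeP => j j4; rewrite !coefD !coefZ !coefXn coefX coefC.
by case: j j4 => [|[|[|[|j]]]] //= _; rewrite !mulr0 !addr0.
Qed.

(** The degree is (n^2 - 1)/2 with coefficient n for odd n, and (n^2 - 4)/2 with coefficient n/2 for
    even n, psi_2 being removed. The two products in each recursion have the same formal degree, so
    the coefficients are subtracted. *)
Lemma lead_psi_red n :
  (forall k, n = (2 * k).+1 ->
     lead_term (psi_red W n) (2 * (k * k.+1)) ((2 * k).+1)%:R) /\
  (forall k, n = (2 * k).+2 ->
     lead_term (psi_red W n) (2 * (k * k.+2)) k.+1%:R).
Proof.
elim/ltn_ind: n => n IH.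
have IH1 k i : i = (2 * k).+1 -> (i < n)%N ->
    lead_term (psi_red W i) (2 * (k * k.+1)) ((2 * k).+1)%:R.
  by move=> ik h; case: (IH _ h) => + _; apply.
have IH2 k i : i = (2 * k).+2 -> (i < n)%N ->
    lead_term (psi_red W i) (2 * (k * k.+2)) k.+1%:R.
  by move=> ik h; case: (IH _ h) => _; apply.
case: (ltnP n 5) => n5.
  split=> k en.
    have : (k < 2)%N by lia.
    case: k en => [|[|//]] -> _; rewrite psi_redE /psi_red_step /=.
      by split; rewrite ?size_poly1 ?coefC.
    split; last first.
      rewrite /psi3 !coefD !coefZ !coefXn coefC /= !mulr0 !addr0 mulr1.
      by rewrite coefX mulr0 addr0.
    rewrite /psi3; apply/leq_sizeP => j j4; rewrite !coefD !coefZ !coefXn coefC.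
    by case: j j4 => [|[|[|[|[|j]]]]] //= _; rewrite coefX !mulr0 !addr0.
  have : (k < 2)%N by lia.
  case: k en => [|[|//]] -> _; rewrite psi_redE /psi_red_step /=.
    by split; rewrite ?size_poly1 ?coefC.
  split; last first.
    rewrite /psi4_red !coefD !coefZ !coefXn coefC /= !mulr0 !addr0 mulr1.
    by rewrite coefX mulr0 addr0.
  rewrite /psi4_red; apply/leq_sizeP => j j4; rewrite !coefD !coefZ !coefXn coefC.
  by case: j j4 => [|[|[|[|[|[|[|j]]]]]]] //= _; rewrite coefX !mulr0 !addr0.
have P2 := lead_termX 2 lead_psi2sq.
split=> k en.
  rewrite psi_redS //=.
  have -> : odd n by lia.
  have -> : n./2 = k by lia.
  case: (boolP (odd k)) => ok.
    have [j ej] : exists j, k = (2 * j.+1).+1 by exists k./2.-1; lia.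
    subst k; apply: lead_term_eq.
    - apply: lead_termB.
        apply: lead_termM (lead_termX 3 _).
          by apply: (IH1 j.+2); lia.
        by apply: (IH1 j.+1); lia.
      apply: lead_term_eq.
      - apply: lead_termM (lead_termX 3 _).
          apply: lead_termM P2 _.
          by apply: (IH2 j); lia.
        by apply: (IH2 j.+1); lia.
      - lia.
      - reflexivity.
    - lia.
    - ring.
  have [j ej] : exists j, k = (2 * j).+2 by exists k./2.-1; lia.
  subst k; apply: lead_term_eq.
  - apply: lead_termB.
      apply: lead_termM (lead_termX 3 _).
        apply: lead_termM P2 _.
        by apply: (IH2 j.+1); lia.
      by apply: (IH2 j); lia.
    apply: lead_term_eq.
    - apply: lead_termM (lead_termX 3 _).
        by apply: (IH1 j); lia.
      by apply: (IH1 j.+1); lia.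
    - lia.
    - reflexivity.
  - lia.
  - ring.
rewrite psi_redS //=.
have -> : odd n = false by lia.
have -> : n./2 = k.+1 by lia.
case: (boolP (odd k)) => ok.
  have [j ej] : exists j, k = (2 * j).+1 by exists k./2; lia.
  subst k; apply: lead_term_eq.
  - apply: lead_termM; first by apply: (IH2 j); lia.
    apply: lead_termB.
      apply: lead_termM (lead_termX 2 _).
        by apply: (IH2 j.+1); lia.
      by apply: (IH1 j); lia.
    apply: lead_term_eq.
    - apply: lead_termM (lead_termX 2 _).
        by apply: (IH2 j.-1); lia.
      by apply: (IH1 j.+1); lia.
    - nia.
    - reflexivity.
  - lia.
  - have [i ->] : exists i, j = i.+1 by exists j.-1; lia.
    by rewrite /=; ring.
have [j ej] : exists j, k = (2 * j.+1)%N by exists k./2.-1; lia.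
subst k; apply: lead_term_eq.
- apply: lead_termM; first by apply: (IH1 j.+1); lia.
  apply: lead_termB.
    apply: lead_termM (lead_termX 2 _).
      by apply: (IH1 j.+2); lia.
    by apply: (IH2 j); lia.
  apply: lead_term_eq.
  - apply: lead_termM (lead_termX 2 _).
      by apply: (IH1 j); lia.
    by apply: (IH2 j.+1); lia.
  - lia.
  - reflexivity.
- lia.
- ring.
Qed.

End DivisionDegree.

(** * Identities of polynomial functions, checked outside a finite set *)

Section PolynomialFunctions.
Variable L : closedFieldType.
Implicit Types p q : {poly L}.

(** If [p] vanished everywhere, [p + 1] would have no root, hence would be constant, and so would
    [p]. *)
Lemma poly_nonroot p : p != 0 -> exists x, p.[x] != 0.
Proof.
move=> p0; apply: contrapT => h; have {}h x : p.[x] = 0.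
  by apply: contrapT => /eqP hx; apply: h; exists x.
have /eqP : size (p + 1) == 1%N.
  apply: contraT => /closed_rootP[x]; rewrite rootE hornerD h add0r hornerC.
  by rewrite oner_eq0.
move/eqP => /size_poly1P[c _ pc].
have ep : p = (c - 1)%:P by rewrite polyCB -pc addrK.
by case/eqP: p0; have := h 0; rewrite ep hornerC => ->.
Qed.

Lemma eq_poly_nonroot b p q : b != 0 ->
  (forall x, b.[x] != 0 -> p.[x] = q.[x]) -> p = q.
Proof.
move=> b0 h; apply/eqP; rewrite -subr_eq0.
apply: contraT => d0; have [x] := poly_nonroot (mulf_neq0 b0 d0).
rewrite hornerM mulf_eq0 negb_or => /andP[bx].
by rewrite hornerD hornerN h // subrr eqxx.
Qed.

Definition polyfun (g : L -> L) := exists p, forall x, p.[x] = g x.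

Lemma polyfunP g h b : polyfun g -> polyfun h -> b != 0 ->
  (forall x, b.[x] != 0 -> g x = h x) -> g =1 h.
Proof.
move=> [p hp] [q hq] b0 gh x; rewrite -hp -hq; congr (_.[x]).
by apply: (eq_poly_nonroot b0) => y /gh; rewrite hp hq.
Qed.

Lemma polyfunD g h : polyfun g -> polyfun h -> polyfun (fun x => g x + h x).
Proof. by move=> [p hp] [q hq]; exists (p + q) => x; rewrite hornerD hp hq. Qed.

Lemma polyfunN g : polyfun g -> polyfun (fun x => - g x).
Proof. by move=> [p hp]; exists (- p) => x; rewrite hornerN hp. Qed.

Lemma polyfunM g h : polyfun g -> polyfun h -> polyfun (fun x => g x * h x).
Proof. by move=> [p hp] [q hq]; exists (p * q) => x; rewrite hornerM hp hq. Qed.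

Lemma polyfunX g n : polyfun g -> polyfun (fun x => g x ^+ n).
Proof. by move=> [p hp]; exists (p ^+ n) => x; rewrite horner_exp hp. Qed.

Lemma polyfunC c : polyfun (fun=> c).
Proof. by exists c%:P => x; rewrite hornerC. Qed.

Lemma polyfun_id : polyfun id.
Proof. by exists 'X => x; rewrite hornerX. Qed.

Lemma polyfun_horner p : polyfun (fun x => p.[x]).
Proof. by exists p. Qed.

End PolynomialFunctions.

Ltac polyfun := repeat first
  [ apply: polyfunC | apply: polyfun_id | apply: polyfun_horner
  | apply: polyfunD | apply: polyfunN | apply: polyfunM | apply: polyfunX ].

Section DivisionValues.
Variables (F : fieldType) (W : weierstrass F).

(* psi_n ^ 2 and the numerator of x(nP) = phi_n(x) / psi_n(x) ^ 2. *)
Definition psisq n := psi_red W n ^+ 2 * (if odd n then 1 else psi2sq W).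
Definition phi n := 'X * psisq n
  - psi_red W n.+1 * psi_red W n.-1 * (if odd n then psi2sq W else 1).

Lemma psi_red0 : psi_red W 0 = 0. Proof. by []. Qed.
Lemma psi_red1 : psi_red W 1 = 1. Proof. by []. Qed.
Lemma psi_red2 : psi_red W 2 = 1. Proof. by []. Qed.

Lemma lead_psisq n : (0 < n)%N -> lead_term (psisq n) (n ^ 2).-1 (n ^ 2)%:R.
Proof.
move=> n0; have [h1 h2] := lead_psi_red W n; rewrite /psisq.
case: (boolP (odd n)) => on.
  have [k ek] : exists k, n = (2 * k).+1 by exists n./2; lia.
  rewrite mulr1; apply: lead_term_eq (lead_termX 2 (h1 _ ek)) _ _.
    by rewrite ek; lia.
  by rewrite ek; ring.
have [k ek] : exists k, n = (2 * k).+2 by exists n./2.-1; lia.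
apply: lead_term_eq (lead_termM (lead_termX 2 (h2 _ ek)) (lead_psi2sq W)) _ _.
  by rewrite ek; lia.
by rewrite ek; ring.
Qed.

Lemma lead_phi n : (0 < n)%N -> lead_term (phi n) (n ^ 2) 1.
Proof.
move=> n0; have hX := lead_termM (lead_termXn F 1) (lead_psisq n0).
rewrite /phi; case: (eqVneq n 1%N) => [->|n1].
  rewrite /psisq psi_red0 psi_red1 !(mulr0, mul0r) subr0 mulr1 expr1n mulr1.
  exact: (lead_termXn F 1).
case: (boolP (odd n)) => on.
  have [k ek] : exists k, n = (2 * k).+3 by exists n./2.-1; lia.
  have [_ hp] := lead_psi_red W n.+1; have [_ hm] := lead_psi_red W n.-1.
  apply: lead_term_eq (lead_termB _ (lead_term_eq (lead_termM (lead_termM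
    (hp k.+1 _) (hm k _)) (lead_psi2sq W)) _ erefl)) _ _.
  - exact: hX.
  - by lia.
  - by lia.
  - by rewrite ek; lia.
  - by rewrite ek; lia.
  - by rewrite ek; ring.
have [k ek] : exists k, n = (2 * k).+2 by exists n./2.-1; lia.
have [hp _] := lead_psi_red W n.+1; have [hm _] := lead_psi_red W n.-1.
rewrite mulr1; apply: lead_term_eq (lead_termB _ (lead_term_eq (lead_termM
  (hp k.+1 _) (hm k _)) _ erefl)) _ _.
- exact: hX.
- by lia.
- by lia.
- by rewrite ek; lia.
- by rewrite ek; lia.
- by rewrite ek; ring.
Qed.

(** The roots of this polynomial are the abscissas of the points P with x(nP) = c. As [psisq n] has
    degree at most n^2 - 1, the leading term is that of [phi n]. *)
Lemma fiber_poly n c : (0 < n)%N -> lead_term (phi n - c *: psisq n) (n ^ 2) 1.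
Proof.
move=> n0; rewrite -[1]subr0; apply: lead_termB (lead_phi n0) _.
have h := lead_psisq n0; split.
  by apply: leq_trans (size_scale_leq _ _) _; apply: leq_trans h.1 _; lia.
by rewrite coefZ nth_default ?mulr0 //; apply: leq_trans h.1 _; lia.
Qed.

Lemma psi_red_neq0 n : (forall k, k.+1%:R != 0 :> F) -> (0 < n)%N ->
  psi_red W n != 0.
Proof.
move=> char0 n0; have [h1 h2] := lead_psi_red W n.
have nz p d c : lead_term p d c -> c != 0 -> p != 0 :> {poly F}.
  by move=> h c0; rewrite -size_poly_eq0 (lead_term_size h c0).
case: (boolP (odd n)) => on.
  by apply: nz (h1 n./2 _) (char0 _); lia.
by apply: nz (h2 n./2.-1 _) (char0 _); lia.
Qed.

Lemma psi2sq_neq0 : (forall k, k.+1%:R != 0 :> F) -> psi2sq W != 0.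
Proof.
by move=> char0; rewrite -size_poly_eq0 (lead_term_size (lead_psi2sq W) (char0 3)).
Qed.

End DivisionValues.

(** * Multiplication by n in terms of x-coordinates *)

Section Multiplication.
Variables (L : closedFieldType) (W : weierstrass L).
Hypothesis char0 : forall n, n.+1%:R != 0 :> L.
Hypothesis ell : is_elliptic W.
Let two0 : (2 : L) != 0 := char0 1.
Local Notation EG := (ecG two0 ell).
Local Notation f := (cubic (b2 W) (b4 W) (b6 W)).
Local Notation psisq := (psisq W).
Local Notation phi := (phi W).

Lemma sqrt_ex (a : L) : exists e, e ^+ 2 = a.
Proof.
have : size ('X^2 - a%:P) != 1%N by rewrite size_XnsubC.
by move/closed_rootP => [e]; rewrite rootE !horner_simp subr_eq0 => /eqP; exists e.
Qed.

Lemma aff_above x : exists (P : EG) e, aff P x e.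
Proof.
by have [e /(aff_ex two0 ell)[P hP]] := sqrt_ex (f x); exists P, e.
Qed.

Section OnePoint.
Variables (P : EG) (x e : L).
Hypothesis hP : aff P x e.

Lemma psisq_val n : (psisq n).[x] = psi_val W x e n ^+ 2.
Proof.
have fe := aff_curve hP; rewrite /psisq /psi_val.
have := psi2sqE W x; rewrite -fe; move: (psi2sq W) => q hq.
by case: (odd n); rewrite !horner_simp ?hq; ring.
Qed.

Lemma phi_val n : (0 < n)%N -> (phi n).[x] =
  x * psi_val W x e n ^+ 2 - psi_val W x e n.+1 * psi_val W x e n.-1.
Proof.
move=> n0; have fe := aff_curve hP; rewrite /phi hornerD hornerN hornerM hornerX.
rewrite psisq_val; congr (_ - _); rewrite /psi_val /=.
have -> : odd n.-1 = ~~ odd n by lia.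
have := psi2sqE W x; rewrite -fe; move: (psi2sq W) => q hq.
by case: (odd n); rewrite !horner_simp ?hq /=; ring.
Qed.

(** Outside its roots, the points have no vanishing positive multiple below [N]. *)
Definition bad_poly N := psi2sq W * \prod_(1 <= k < N) psi_red W k.

Lemma bad_poly_neq0 N : bad_poly N != 0.
Proof.
rewrite mulf_neq0 ?psi2sq_neq0 // prodf_seq_neq0; apply/allP => k /=.
by rewrite mem_index_iota => /andP[k0 _]; apply: psi_red_neq0.
Qed.

(** Otherwise, for the least M > 0 with MP = 0, [psi_val_N] makes [x] a root of [psi_red M] or gives
    e = 0. *)
Lemma bad_polyP N : (bad_poly N).[x] != 0 ->
  forall j, (0 < j < N)%N -> P *+ j <> 0.
Proof.
rewrite /bad_poly hornerM psi2sqE mulf_eq0 negb_or => /andP[fx bx] j jN Pj.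
have : exists j, (0 < j < N)%N && (P *+ j == 0) by exists j; rewrite jN Pj eqxx.
case/ex_minnP => M /andP[MN /eqP PM] Mmin.
have Mlt i : (0 < i < M)%N -> P *+ i <> 0.
  move=> iM Pi; have := Mmin i; rewrite Pi eqxx andbT.
  by move=> h; have := h ltac:(lia); lia.
have M1 : (1 < M)%N.
  case: M MN PM {Mmin Mlt} => [|[|]] // _; rewrite mulr1n => P0.
  by case: (aff_not0 hP).
have := psi_val_N hP Mlt M1 PM; rewrite /psi_val => /eqP.
rewrite mulf_eq0 => /orP[] /eqP z.
  move: bx; rewrite horner_prod (bigD1_seq M) ?iota_uniq ?mem_index_iota //=.
  by rewrite z mul0r eqxx.
have e0 : e != 0 by move: fx; rewrite -(aff_curve hP) expf_eq0.
by move: z; case: odd => /eqP; rewrite ?oner_eq0 ?(negbTE e0).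
Qed.

End OnePoint.

(* Both sides are polynomial in [x], hence it suffices to compare them at the
   x-coordinates of points of large order. *)
Lemma kummer_phi n u x : (1 < n)%N ->
  kummer W u (phi n).[x] (psisq n).[x] x =
  (u * (psisq n.+1).[x] - (phi n.+1).[x]) * (u * (psisq n.-1).[x] - (phi n.-1).[x]).
Proof.
move=> n1; move: x; apply: (polyfunP _ _ (bad_poly_neq0 n.+2)).
- by rewrite /kummer; polyfun.
- by polyfun.
move=> x bx; have [P [e hP]] := aff_above x.
have hN := bad_polyP hP bx.
have aN k : (k <= n.+2)%N -> psi_val W x e k = ellseq P x e k.
  by move=> h; rewrite (ellseqE hP hN).
have R k : (0 < k < n.+2)%N -> ellseq P x e k.+1 * ellseq P x e k.-1
    = (x - kx (P *+ k)) * ellseq P x e k ^+ 2.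
  by move=> hk; rewrite (ellseq_rec hP hN).
have Phi k : (0 < k < n.+2)%N -> (phi k).[x] = kx (P *+ k) * ellseq P x e k ^+ 2.
  by move=> hk; rewrite (phi_val hP) ?aN ?R; try lia; ring.
have Psi k : (k <= n.+2)%N -> (psisq k).[x] = ellseq P x e k ^+ 2.
  by move=> hk; rewrite (psisq_val hP) aN.
rewrite !Phi ?Psi; try lia.
have K := kummer_mul (m := n) (n := 1) hN u ltac:(lia) ltac:(lia).
rewrite (kx1 hP) addn1 subn1 in K.
transitivity (kummer W u (kx (P *+ n)) 1 x * ellseq P x e n ^+ 4).
  by rewrite /kummer; ring.
rewrite K; transitivity (((x - kx (P *+ n)) * ellseq P x e n ^+ 2) ^+ 2
  * ((u - kx (P *+ n.+1)) * (u - kx (P *+ n.-1)))); first by ring.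
by rewrite -R; [ring | lia].
Qed.

Lemma phi2 : phi 2 = 'X * psi2sq W - psi3 W.
Proof. by rewrite /phi /psisq psi_red1 psi_red2 expr1n mul1r !mulr1. Qed.

(** A ladder on pairs of consecutive multiples. Since [kummer_phi] holds at every x, multiples that
    meet the point at infinity need no separate treatment. *)
Lemma xrep_mul (P : EG) x e n : aff P x e -> (0 < n)%N ->
  xrep (P *+ n) (phi n).[x] (psisq n).[x].
Proof.
move=> hP; have r1 : xrep P x 1.
  by exists 1; rewrite ?oner_eq0 //; have [-> ->] := aff_k hP; rewrite !mul1r.
suff h k : xrep (P *+ k.+1) (phi k.+1).[x] (psisq k.+1).[x] /\
           xrep (P *+ k.+2) (phi k.+2).[x] (psisq k.+2).[x].
  by case: n => // n _; case: (h n).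
elim: k => [|k [IH1 IH2]].
  split.
    rewrite /phi /psisq psi_red0 psi_red1 !(mulr0, mul0r) subr0 !mulr1 expr1n.
    by rewrite mulr1 hornerX hornerC.
  rewrite phi2 /psisq psi_red2 expr1n mul1r hornerD hornerN hornerM hornerX.
  rewrite psi2sqE psi3E.
  have [c c0 h] := kummer_add r1 hP.
  exists c => //; rewrite mulr2n.
  have {}h u : dupl W x - f x * u = - c * kl (P + P) u.
    by rewrite -kummer_tangent h subrr kl0; ring.
  have h0 := h 0; have h1 := h 1; rewrite /kl in h0 h1.
  split; first by apply: (lincomb1 (c := 1) h0); ring.
  by apply: (lincomb2 (c := 1) (d := -1) h0 h1); ring.
split=> //; rewrite mulrSr; apply: (xrep_ladder hP IH2).
  rewrite mulrSr addrK; exact: IH1.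
by move=> u; rewrite kummer_phi.
Qed.

Lemma mul_eq0 (P : EG) x e n : aff P x e -> (0 < n)%N ->
  P *+ n = 0 <-> root (psisq n) x.
Proof.
by move=> hP n0; rewrite (xrep0 (xrep_mul hP n0)) rootE; split=> /eqP.
Qed.

(** A point above [x] has n-th multiple Q or - Q, and passing to its opposite corrects the sign. The
    multiple is not 0, since [phi n] would then vanish at [x] together with [psisq n]. *)
Lemma fiber n (Q : EG) c d x : aff Q c d -> (0 < n)%N ->
  root (phi n - c *: psisq n) x -> exists (P : EG) e, aff P x e /\ P *+ n = Q.
Proof.
move=> hQ n0; rewrite rootE hornerD hornerN hornerZ subr_eq0 => /eqP hx.
have [P [e hP]] := aff_above x; have r := xrep_mul hP n0.
case: (affP (P *+ n)) => [P0|[c' [d' hc]]].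
  have z : (psisq n).[x] = 0 by apply/(xrep0 r).
  by have := xrep_nz r z; rewrite hx z mulr0 eqxx.
have z : (psisq n).[x] != 0.
  by apply/eqP => /(xrep0 r); exact: aff_not0 hc.
have := xrep_aff r hc; rewrite hx => /(mulIf z) cc'; rewrite -cc' in hc.
case: (aff_same_x hc hQ) => [h|h]; first by exists P, e.
exists (- P), (- e); split; first exact: aff_opp.
by rewrite mulNrn h; exact: ecG_oppK.
Qed.

Lemma mul_surj n (Q : EG) : (0 < n)%N -> exists P : EG, P *+ n = Q.
Proof.
move=> n0; case: (affP Q) => [->|[c [d hQ]]]; first by exists 0; rewrite mul0rn.
have : size (phi n - c *: psisq n) != 1%N.
  by rewrite (lead_term_size (fiber_poly W c n0)) ?oner_neq0 //; lia.
move/closed_rootP => [x /(fiber hQ n0)[P [e [_ hP]]]].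
by exists P.
Qed.

End Multiplication.

(** * Counting torsion points; separability of the division polynomials *)

Section Torsion.
Variables (L : closedFieldType) (W : weierstrass L).
Hypothesis char0 : forall n, n.+1%:R != 0 :> L.
Hypothesis ell : is_elliptic W.
Let two0 : (2 : L) != 0 := char0 1.
Local Notation EG := (ecG two0 ell).
Local Notation f := (cubic (b2 W) (b4 W) (b6 W)).
Local Notation psisq := (psisq W).
Local Notation phi := (phi W).

Lemma root_psisq n x :
  root (psisq n) x = root (psi_red W n) x || ~~ odd n && (f x == 0).
Proof.
rewrite rootM; congr (_ || _); first by rewrite !rootE horner_exp expf_eq0.
by case: odd; rewrite rootE ?psi2sqE // hornerC oner_eq0.
Qed.

Lemma lead_term_deriv (p : {poly L}) d c :
  lead_term p d.+1 c -> lead_term p^`() d (c *+ d.+1).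
Proof.
move=> [sp pd]; split; last by rewrite coef_deriv pd.
apply/leq_sizeP => j dj; rewrite coef_deriv nth_default ?mul0rn //.
exact: leq_trans sp _.
Qed.

Lemma xrep_coprime n x : (0 < n)%N -> (phi n).[x] != 0 \/ (psisq n).[x] != 0.
Proof.
move=> n0; have [P [e hP]] := aff_above char0 ell x.
have r := xrep_mul hP n0.
case: (eqVneq (psisq n).[x] 0) => [z|]; [left|by right].
exact: xrep_nz r z.
Qed.

(** A multiple root of p - c q is a root r of the Wronskian [w] with p(r) = c q(r). Each of the
    finitely many roots of [w] excludes at most one [c]; the excluded values are the roots of
    [b]. *)
Lemma separable_pencil (p q : {poly L}) : p^`() * q - p * q^`() != 0 ->
  (forall x, p.[x] != 0 \/ q.[x] != 0) -> exists c, separable_poly (p - c *: q).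
Proof.
set w := _ - _ => w0 cop.
have [rs ers] := closed_field_poly_normal w.
pose b := \prod_(r <- rs) (p.[r]%:P - q.[r] *: 'X).
have [c bc] : exists c, b.[c] != 0.
  apply: poly_nonroot; rewrite prodf_seq_neq0; apply/allP => r _ /=.
  apply/eqP => h; have := congr1 (fun p : {poly L} => p`_0) h.
  have := congr1 (fun p : {poly L} => p`_1) h.
  rewrite !(coefB, coefZ, coefC, coefX, coef0) /= mulr1 mulr0 sub0r subr0.
  move/eqP; rewrite oppr_eq0 => /eqP h1 h0.
  by case: (cop r); rewrite ?h0 ?h1 eqxx.
exists c; rewrite unlock; apply/coprimepP => g gp gp'.
rewrite -size_poly_eq1; apply: contraT => /closed_rootP[r gr].
have pr := root_dvdp gp gr; have pr' := root_dvdp gp' gr.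
move: pr pr'; rewrite !rootE derivB derivZ !hornerD !hornerN !hornerZ.
rewrite !subr_eq0 => /eqP h /eqP h'.
have : root w r.
  by rewrite rootE hornerD hornerN !hornerM h h'; apply/eqP; ring.
rewrite ers rootZ ?lead_coef_eq0 // root_prod_XsubC => rrs.
move: bc; rewrite /b horner_prod (big_rem r) //= hornerD hornerN hornerZ.
by rewrite hornerC hornerX h [q.[r] * c]mulrC subrr mul0r eqxx.
Qed.

Lemma generic_fiber n : (1 < n)%N ->
  exists c, separable_poly (phi n - c *: psisq n).
Proof.
move=> n1; have n0 : (0 < n)%N by lia.
apply: separable_pencil; last by move=> x; exact: xrep_coprime.
have [d ed] : exists d, (n ^ 2 = d.+2)%N by exists (n ^ 2).-2; nia.
have h1 := lead_phi W n0; have h2 := lead_psisq W n0.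
rewrite ed /= in h1 h2.
have h1' := lead_term_deriv h1; have h2' := lead_term_deriv h2.
have e : (d.+2 + d = d.+1 + d.+1)%N by lia.
(* With n^2 = d + 2, the leading coefficient of the Wronskian is (d + 2)^2 - (d + 2)(d + 1) = d +
   2. *)
have hw := lead_termB (lead_termM h1' h2) (lead_term_eq (lead_termM h1 h2') e erefl).
rewrite -size_poly_eq0 (lead_term_size hw) //.
by rewrite (_ : _ - _ = d.+2%:R); [exact: char0 | ring].
Qed.

Lemma separable_roots (p : {poly L}) : separable_poly p ->
  exists2 rs, uniq rs & p = lead_coef p *: \prod_(z <- rs) ('X - z%:P).
Proof.
have [rs e] := closed_field_poly_normal p; move=> sp; exists rs => //.
rewrite -separable_prod_XsubC; have p0 := separable_poly_neq0 sp.
have -> // : separable_poly (\prod_(x <- rs) ('X - x%:P)) = separable_poly p.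
by apply: eqp_separable; rewrite [X in _ %= X]e eqp_sym eqp_scale ?lead_coef_eq0.
Qed.

(** Each of the n^2 roots of a separable fibre polynomial lies below a point P with nP equal to the
    same Q; translating by one such point turns them into n-torsion points. *)
Lemma torsion_count n : (1 < n)%N -> exists s : seq EG,
  [/\ uniq s, size s = (n ^ 2)%N & forall P, P \in s -> P *+ n = 0].
Proof.
move=> n1; have n0 : (0 < n)%N by lia.
have [c sc] := generic_fiber n1.
have [rs urs ers] := separable_roots sc.
have [Q [d hQ]] := aff_above char0 ell c.
have hs := lead_term_size (fiber_poly W c n0) (oner_neq0 _).
have p0 : phi n - c *: psisq n != 0 by rewrite -size_poly_eq0 hs.
have rsr x : x \in rs -> root (phi n - c *: psisq n) x.
  by move=> h; rewrite ers rootZ ?lead_coef_eq0 // root_prod_XsubC.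
have srs : size rs = (n ^ 2)%N.
  by move: hs; rewrite {1}ers size_scale ?lead_coef_eq0 // size_prod_XsubC => -[].
have [s [es hs']] : exists s : seq EG, map (@kx _ _ _ _) s = rs /\
    forall P, P \in s -> P *+ n = Q.
  elim: rs rsr {urs ers srs} => [|x rs IH] h; first by exists [::].
  have [|s [es hs']] := IH; first by move=> y hy; apply: h; rewrite inE hy orbT.
  have [P [e [hP PQ]]] := fiber hQ n0 (h x (mem_head _ _)).
  exists (P :: s); split; first by rewrite /= es; have [-> _] := aff_k hP.
  by move=> R; rewrite inE => /orP[/eqP ->//|/hs'].
have ss : size s = (n ^ 2)%N by rewrite -srs -es size_map.
have us : uniq s by apply: (@map_uniq _ _ (@kx _ _ _ _)); rewrite es.
case: s => [|P0 s0] in es hs' ss us *; first by move: ss; rewrite /=; nia.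
exists (map (fun P => P - P0) (P0 :: s0)); split.
- by rewrite map_inj_uniq //; exact: addIr.
- by rewrite size_map.
move=> R /mapP[P hP ->]; rewrite mulrnBl !hs' ?subrr //; exact: mem_head.
Qed.

Lemma points_above (s : seq L) : exists t : seq EG, size t = (2 * size s)%N /\
  forall (P : EG) x e, aff P x e -> x \in s -> P \in t.
Proof.
elim: s => [|x s [t [st ht]]]; first by exists [::].
have [Q [d hQ]] := aff_above char0 ell x.
exists (Q :: ecG_opp Q :: t); split; first by rewrite /= st; lia.
move=> P y e hP; rewrite !inE => /orP[/eqP yx|ys]; last first.
  by rewrite (ht _ _ _ hP ys) !orbT.
rewrite yx in hP; case: (aff_same_x hP hQ) => ->; first by rewrite eqxx.
by rewrite eqxx orbT.
Qed.

Lemma two_torsionE (P : EG) x e : aff P x e -> (P *+ 2 = 0) <-> f x = 0.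
Proof.
move=> hP; rewrite (mul_eq0 hP) // root_psisq psi_red2 rootE hornerC oner_eq0 /=.
by split=> [/eqP|->].
Qed.

Lemma two_torsion_points : exists t : seq EG, size t = 4%N /\
  forall P : EG, P *+ 2 = 0 -> P \in t.
Proof.
have [rs ers] := closed_field_poly_normal (psi2sq W).
have p0 := psi2sq_neq0 W char0.
have srs : size rs = 3%N.
  have := lead_term_size (lead_psi2sq W) (char0 3).
  by rewrite {1}ers size_scale ?lead_coef_eq0 // size_prod_XsubC => -[].
have [t [st ht]] : exists t : seq EG, size t = size rs /\
    forall (P : EG) x, aff P x 0 -> x \in rs -> P \in t.
  have hrs x : x \in rs -> f x = 0.
    move=> h; apply/eqP; rewrite -psi2sqE -rootE ers rootZ ?lead_coef_eq0 //.
    by rewrite root_prod_XsubC.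
  elim: rs hrs {srs ers} => [|x s IH] h; first by exists [::].
  have [|t [st ht]] := IH; first by move=> y hy; apply: h; rewrite inE hy orbT.
  have [Q hQ] : exists Q : EG, aff Q x 0.
    by apply: aff_ex; rewrite expr0n h ?mem_head.
  exists (Q :: t); split; first by rewrite /= st.
  move=> P y hP; rewrite !inE => /orP[/eqP yx|ys]; last by rewrite (ht _ _ hP ys) orbT.
  by rewrite yx in hP; rewrite (aff_inj hP hQ) eqxx.
exists (0 :: t); split; first by rewrite /= st srs.
move=> P P2; case: (affP P) => [->|[x [e hP]]]; first exact: mem_head.
have fx : f x = 0 by apply/(two_torsionE hP).
have e0 : e = 0.
  by have := aff_curve hP; rewrite fx => /eqP; rewrite expf_eq0 => /andP[_ /eqP].
rewrite e0 in hP; rewrite inE (ht _ _ hP) ?orbT //.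
rewrite -root_prod_XsubC -(rootZ _ _ (_ : lead_coef (psi2sq W) != 0)) ?lead_coef_eq0 //.
by rewrite -ers rootE psi2sqE fx.
Qed.

(* Comparing the number of points of [n]-torsion with the degree of [psi_red n]
   shows that the latter has no multiple root. *)
Lemma psi_red_roots n : (0 < n)%N -> exists rs, [/\ uniq rs,
  psi_red W n = lead_coef (psi_red W n) *: \prod_(z <- rs) ('X - z%:P)
  & forall x, x \in rs -> f x != 0].
Proof.
move=> n0; case: (eqVneq n 1%N) => [->|n1].
  by exists [::]; split=> //; rewrite big_nil psi_red1 lead_coef1 scale1r.
have [rs ers] := closed_field_poly_normal (psi_red W n).
have p0 := psi_red_neq0 W char0 n0.
(* [rs'] keeps each root once and drops those of psi_2^2; if it is as long as [rs], nothing was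
   repeated or dropped. *)
exists rs; pose rs' := filter (fun x => f x != 0) (undup rs).
have [s [us ss hs]] := @torsion_count n ltac:(lia).
have [t [st ht]] := points_above rs'.
have [t2 [st2 ht2]] := two_torsion_points.
have xs (P : EG) : P \in s -> P *+ 2 = 0 \/ P \in t.
  move=> Ps; case: (pselect (P *+ 2 = 0)) => [|P2]; [by left|right].
  case: (affP P) => [P0|[x [e hP]]]; first by rewrite P0 mul0rn in P2.
  have fx : f x != 0 by apply/eqP => /(two_torsionE hP).
  apply: (ht _ _ _ hP); rewrite mem_filter fx mem_undup /=.
  have /(mul_eq0 hP n0) := hs _ Ps.
  rewrite root_psisq (negbTE fx) andbF orbF.
  by rewrite {1}ers rootZ ?lead_coef_eq0 // root_prod_XsubC.
(* Each abscissa carries at most two points, so n^2 is at most 2 [size rs'] plus 1 for odd n (the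
   point 0) or plus 4 for even n (the 2-torsion), whereas [size rs] is (n^2 - 1)/2 or (n^2 -
   4)/2. *)
have srs : (size rs <= size rs')%N.
  have sr p d c : lead_term p d c -> p = psi_red W n -> c != 0 -> size rs = d.
    move=> h e c0; have := lead_term_size h c0; rewrite e {1}ers.
    by rewrite size_scale ?lead_coef_eq0 // size_prod_XsubC => -[].
  have [h1 h2] := lead_psi_red W n; case: (boolP (odd n)) => on.
    have [k ek] : exists k, n = (2 * k).+1 by exists n./2; lia.
    rewrite (sr _ _ _ (h1 _ ek) erefl (char0 _)).
    suff : (size s <= size (0%R :: t))%N by rewrite ss /= st ek; clear; move: (size rs'); lia.
    apply: uniq_leq_size => // P Ps; rewrite inE; case: (xs _ Ps) => [P2|->].
      have := hs _ Ps; rewrite -[n]odd_double_half on mulrnDr -mul2n mulrnA P2.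
      by rewrite mul0rn addr0 mulr1n => ->; rewrite eqxx.
    by rewrite orbT.
  have [k ek] : exists k, n = (2 * k).+2 by exists n./2.-1; lia.
  rewrite (sr _ _ _ (h2 _ ek) erefl (char0 _)).
  suff : (size s <= size (t2 ++ t))%N.
    by rewrite ss size_cat st st2 ek; clear; move: (size rs'); lia.
  apply: uniq_leq_size => // P Ps; rewrite mem_cat; case: (xs _ Ps) => [P2|->].
    by rewrite ht2.
  by rewrite orbT.
have urs' : uniq rs' by rewrite filter_uniq ?undup_uniq.
have sub : {subset rs' <= rs} by move=> x; rewrite mem_filter mem_undup => /andP[].
split=> //; first exact: leq_size_uniq urs' sub srs.
move=> x; have [_ <-] := uniq_min_size urs' sub srs.
by rewrite mem_filter => /andP[].
Qed.

Lemma psi_red_root (P : EG) x e n : aff P x e -> (0 < n)%N ->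
  root (psi_red W n) x <-> P *+ n = 0 /\ P *+ 2 <> 0.
Proof.
move=> hP n0; have [rs [_ ers frs]] := psi_red_roots n0.
have p0 := psi_red_neq0 W char0 n0; split=> [h|[Pn P2]].
  have fx : f x != 0.
    by apply: frs; rewrite -root_prod_XsubC; move: h; rewrite {1}ers rootZ ?lead_coef_eq0.
  split; last by move/(two_torsionE hP) => z; rewrite z eqxx in fx.
  by apply/(mul_eq0 hP n0); rewrite root_psisq h.
have fx : f x != 0 by apply/eqP => /(two_torsionE hP).
by move/(mul_eq0 hP n0): Pn; rewrite root_psisq (negbTE fx) andbF orbF.
Qed.

Definition has_order (P : EG) n := forall m, P *+ m = 0 <-> (n %| m)%N.

Lemma has_order_ex (P : EG) n : (0 < n)%N -> P *+ n = 0 ->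
  exists2 m, (0 < m)%N & has_order P m.
Proof.
move=> n0 Pn; have : exists m, (0 < m)%N && (P *+ m == 0).
  by exists n; rewrite n0 Pn eqxx.
case/ex_minnP => m /andP[m0 /eqP Pm] mmin; exists m => // k; split=> [Pk|].
  have Pr : P *+ (k %% m) = 0.
    move: Pk; rewrite {1}(divn_eq k m) mulrnDr mulnC mulrnA Pm mul0rn.
    by rewrite add0r.
  case: (posnP (k %% m)%N) => [/eqP //|r0].
  have := mmin _ (introT andP (conj r0 (introT eqP Pr))).
  by rewrite leqNgt ltn_mod m0.
by move=> /dvdnP[j ->]; rewrite mulnC mulrnA Pm mul0rn.
Qed.

Lemma has_order_inj (P : EG) m n : has_order P m -> has_order P n -> m = n.
Proof.
move=> hm hn; apply/eqP; rewrite eqn_dvd.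
by apply/andP; split; [apply/hm/hn|apply/hn/hm].
Qed.

End Torsion.

(** * Primitive division polynomials *)

Section PrimitiveDivision.
Variables (L : closedFieldType) (W : weierstrass L).
Hypothesis char0 : forall n, n.+1%:R != 0 :> L.
Hypothesis ell : is_elliptic W.
Let two0 : (2 : L) != 0 := char0 1.
Local Notation EG := (ecG two0 ell).
Local Notation f := (cubic (b2 W) (b4 W) (b6 W)).

Lemma coprimep_roots (p q : {poly L}) :
  (forall x, root p x -> ~ root q x) -> coprimep p q.
Proof.
move=> h; apply/coprimepP => g gp gq; rewrite -size_poly_eq1.
apply: contraT => /closed_rootP[x gx].
by case: (h x); apply: root_dvdp gx.
Qed.

Lemma separable_dvdp (p q : {poly L}) : separable_poly p ->
  (forall x, root p x -> root q x) -> p %| q.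
Proof.
move=> sp h; have [rs urs e] := separable_roots sp.
have p0 := separable_poly_neq0 sp.
rewrite e dvdpZl ?lead_coef_eq0 //; apply: uniq_roots_dvdp.
  apply/allP => x hx; apply: h; rewrite e rootZ ?lead_coef_eq0 //.
  by rewrite root_prod_XsubC.
by rewrite uniq_rootsE.
Qed.

Lemma separable_psi_red n : (0 < n)%N -> separable_poly (psi_red W n).
Proof.
move=> n0; have [rs [urs e _]] := psi_red_roots char0 ell n0.
have p0 := psi_red_neq0 W char0 n0.
by rewrite e (eqp_separable (eqp_scale _ _)) ?lead_coef_eq0 // separable_prod_XsubC.
Qed.

(** The value 2 is set apart because psi_2 is divided out of [psi_red]: [prim_psi W 2] is 1 and has
    no root. *)
Definition prim_psi_spec n := separable_poly (prim_psi W n) /\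
  forall (P : EG) x e, aff P x e ->
    root (prim_psi W n) x <-> has_order P n /\ n != 2%N.

(** The factors are separable, and pairwise coprime since a point has only one exact order; hence it
    is enough that each root of a factor is a root of [q]. *)
Lemma prod_prim_psi (l : seq nat) (q : {poly L}) : uniq l ->
  (forall m, m \in l -> m != 2%N /\ prim_psi_spec m) ->
  (forall m x, m \in l -> root (prim_psi W m) x -> root q x) ->
  (\prod_(m <- l) prim_psi W m) %| q /\
  forall (P : EG) x e, aff P x e ->
    root (\prod_(m <- l) prim_psi W m) x <-> exists2 m, m \in l & has_order P m.
Proof.
elim: l => [|m l IH] /=.
  move=> _ _ _; rewrite big_nil dvd1p; split=> // P x e _.
  by rewrite rootE hornerC oner_eq0; split=> // -[].
move=> /andP[ml ul] hl hq; have [m2 [sm rm]] := hl m (mem_head _ _).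
have [k kl|k x kl|dl rl] := IH ul.
- by apply: hl; rewrite inE kl orbT.
- by apply: hq; rewrite inE kl orbT.
rewrite big_cons; split.
  rewrite Gauss_dvdp ?dl ?andbT.
    by apply: separable_dvdp sm _ => x; apply: hq; exact: mem_head.
  apply: coprimep_roots => x; have [P [e hP]] := aff_above char0 ell x.
  move=> /(rm _ _ _ hP)[hm _] /(rl _ _ _ hP)[k kl hk].
  by rewrite (has_order_inj hm hk) kl in ml.
move=> P x e hP; rewrite rootM; split.
  move=> /orP[/(rm _ _ _ hP)[hm _]|/(rl _ _ _ hP)[k kl hk]].
    by exists m; rewrite ?mem_head.
  by exists k; rewrite // inE kl orbT.
case=> k; rewrite inE => /orP[/eqP ->|kl] hk; apply/orP; [left|right].
  by apply/(rm _ _ _ hP).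
by apply/(rl _ _ _ hP); exists k.
Qed.

(** By induction and [prod_prim_psi], the Euclidean quotient is exact. As [psi_red n] is separable,
    its factor [prim_psi n] shares no root with the product over smaller orders, which leaves exact
    order n. *)
Lemma prim_psiP n : (0 < n)%N -> prim_psi_spec n.
Proof.
elim/ltn_ind: n => n IH n0.
pose l := filter (fun m => (m != n) && (m != 2%N)) (divisors n).
have ml m : (m \in l) = [&& m != n, m != 2%N & (m %| n)%N].
  by rewrite mem_filter -dvdn_divisors // andbA.
have [||m x|] := @prod_prim_psi l (psi_red W n).
- by rewrite filter_uniq ?divisors_uniq.
- move=> m; rewrite ml => /and3P[mn m2 dmn]; split=> //.
  by apply: IH; rewrite ?(dvdn_gt0 n0 dmn) // ltn_neqAle mn dvdn_leq.
- rewrite ml => /and3P[mn m2 dmn]; have m0 := dvdn_gt0 n0 dmn.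
  have [_ rm] : prim_psi_spec m by apply: IH; rewrite // ltn_neqAle mn dvdn_leq.
  have [P [e hP]] := aff_above char0 ell x.
  move=> /(rm _ _ _ hP)[hm _]; apply/(psi_red_root hP n0).
  split; first by apply/hm.
  move/hm; rewrite dvdn_divisors // !inE (negbTE m2) orbF => /eqP m1.
  by apply: (aff_not0 hP); rewrite -[P]mulr1n; apply/hm; rewrite m1.
move=> dl rl.
have e : psi_red W n = prim_psi W n * \prod_(m <- l) prim_psi W m.
  by rewrite prim_psiE // -big_filter divpK.
have sn := separable_psi_red n0.
split; first by apply: dvdp_separable sn; rewrite e dvdp_mulr.
move=> P x y hP; split=> [h|[hn n2]].
  have /(psi_red_root hP n0)[Pn P2] : root (psi_red W n) x by rewrite e rootM h.
  have nl : ~ root (\prod_(m <- l) prim_psi W m) x.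
    have cop : coprimep (prim_psi W n) (\prod_(m <- l) prim_psi W m).
      by apply: (separable_coprime sn); rewrite e.
    by rewrite rootE; apply/negP; exact: coprimep_root cop h.
  have [m m0 hm] := has_order_ex n0 Pn.
  have dmn : (m %| n)%N by apply/hm.
  have m2 : m != 2%N by apply/eqP => z; apply: P2; apply/hm; rewrite z.
  suff -> : n = m by [].
  apply/eqP; rewrite eq_sym; apply: contraT => mn; case: nl; apply/(rl _ _ _ hP).
  by exists m; rewrite // ml mn m2.
have : root (psi_red W n) x.
  apply/(psi_red_root hP n0); split; first by apply/hn.
  move/hn; rewrite dvdn_divisors // !inE (negbTE n2) orbF => /eqP n1.
  by apply: (aff_not0 hP); rewrite -[P]mulr1n; apply/hn; rewrite n1.
rewrite e rootM => /orP[//|/(rl _ _ _ hP)[m]]; rewrite ml => /andP[mn _] hm.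
by rewrite (has_order_inj hm hn) eqxx in mn.
Qed.

Lemma prim_psi_xP n (P : EG) x e : (1 < n)%N -> aff P x e ->
  root (prim_psi_x W n) x <-> has_order P n.
Proof.
move=> n1 hP; rewrite /prim_psi_x; case: (eqVneq n 2%N) => [->|n2].
  have r2 : root (psi2sq W) x <-> P *+ 2 = 0.
    by rewrite rootE psi2sqE (two_torsionE hP); split=> [/eqP|->].
  rewrite r2; split=> [P2|h]; last by apply/h.
  have [m m0 hm] := has_order_ex (n := 2) isT P2.
  have : (m %| 2)%N by apply/hm.
  rewrite dvdn_divisors // !inE => /orP[] /eqP me; subst m => //.
  by case: (aff_not0 hP); rewrite -[P]mulr1n; apply/hm.
have [_ rn] := @prim_psiP n ltac:(lia).
by rewrite (rn _ _ _ hP); split=> [[]|].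
Qed.

Lemma prime_order_point p : prime p -> exists T : EG, has_order T p.
Proof.
move=> pp; have p1 := prime_gt1 pp.
have [s [us ss hs]] := torsion_count char0 ell p1.
have [T [Ts T0]] : exists T, T \in s /\ T <> 0.
  apply: contrapT => h.
  have : (size s <= size [:: (0%R : EG)])%N.
    apply: uniq_leq_size => // T Ts; rewrite inE; apply/eqP.
    by apply: contrapT => T0; apply: h; exists T.
  by rewrite ss /=; nia.
have [m m0 hm] := has_order_ex (prime_gt0 pp) (hs _ Ts).
have : (m %| p)%N by apply/hm/hs.
case/primeP: pp => _ h /h/orP[] /eqP me; subst m; last by exists T.
by case: T0; rewrite -[T]mulr1n; apply/hm.
Qed.

(* Every torsion point is a multiple of a point of exact order [n]; the order is
   raised one prime [p] at a time, dividing the point by [p] if [p] already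
   divides its order, and adding a point of order [p] otherwise. *)
Lemma has_order_lift (Q : EG) d n : (0 < n)%N -> (d %| n)%N -> has_order Q d ->
  exists (P : EG) j, has_order P n /\ Q = P *+ j.
Proof.
move=> n0 /dvdnP[k ek]; rewrite {}ek in n0 *; elim/ltn_ind: k Q d n0 => k IH Q d n0 hQ.
have [k0 d0] : (0 < k)%N /\ (0 < d)%N by apply/andP; rewrite -muln_gt0.
case: (leqP k 1) => k1.
  have -> : k = 1%N by lia.
  by exists Q, 1%N; rewrite mul1n mulr1n.
pose p := pdiv k; have pp : prime p := pdiv_prime k1.
have /dvdnP[k' ek] : (p %| k)%N := pdiv_dvd k.
have p1 := prime_gt1 pp.
suff [P [j [hP ->]]] : exists (P : EG) j, has_order P (d * p) /\ Q = P *+ j.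
  have k'0 : (0 < k')%N by case: k' ek => // z; rewrite z in k0.
  have lk : (k' < k)%N by rewrite ek -[X in (X < _)%N]muln1 ltn_mul2l k'0.
  have := IH k' lk; rewrite (_ : (k * d = k' * (d * p))%N); last by rewrite ek; lia.
  case/(_ P (d * p)%N) => //; first by rewrite !muln_gt0 k'0 d0 /=; lia.
  by move=> R [i [hR ->]]; exists R, (i * j)%N; rewrite mulrnA.
case: (boolP (p %| d)%N) => pd.
  (* Here mP = 0 gives d | m, hence p | m, and then (m/p)Q = 0 gives d | m/p. *)
  have [P PQ] := mul_surj Q (ltnW p1).
  exists P, p; split=> // m; split=> [Pm|/dvdnP[i ->]]; last first.
    by rewrite mulnA mulnC mulrnA PQ mulnC mulrnA (_ : Q *+ d = 0) ?mul0rn //; apply/hQ.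
  have : (d %| m)%N by apply/hQ; rewrite -PQ -mulrnA mulnC mulrnA Pm mul0rn.
  move=> dm; have /dvdnP[i em] := dvdn_trans pd dm.
  rewrite em dvdn_pmul2r ?prime_gt0 //; apply/hQ.
  by rewrite -PQ -mulrnA mulnC -em.
have cdp : coprime d p by rewrite coprime_sym prime_coprime.
have [T hT] := prime_order_point pp.
(* The multiplier is 1 modulo d and 0 modulo p, so it fixes Q and kills T. *)
exists (Q + T), (chinese d p 1 0); split=> [m|].
  rewrite mulrnDl; split=> [h|/dvdnP[i ->]]; last first.
    rewrite (_ : Q *+ _ = 0) ?add0r.
      by apply/hT; rewrite !dvdn_mull.
    by apply/hQ; rewrite dvdn_mull ?dvdn_mulr.
  have dm : (d %| m)%N.
    rewrite -(Gauss_dvdl m cdp); apply/hQ.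
    have := congr1 (fun P : EG => P *+ p) h; rewrite mul0rn mulrnDl -!mulrnA.
    by rewrite [X in _ + X](_ : _ = 0) ?addr0 //; apply/hT; exact: dvdn_mull.
  rewrite Gauss_dvd // dm; apply/hT; move: h.
  by rewrite (_ : Q *+ m = 0) ?add0r //; apply/hQ.
have modE (R : EG) k1' a b : has_order R k1' -> a = b %[mod k1'] -> R *+ a = R *+ b.
  move=> hR ab; have R0 : R *+ k1' = 0 by apply/hR.
  rewrite (divn_eq a k1') (divn_eq b k1') ab !mulrnDr.
  by rewrite ![(_ * k1')%N]mulnC !mulrnA R0 !mul0rn.
rewrite mulrnDl (modE _ _ _ 1%N hQ) ?mulr1n; last exact: chinese_modl.
rewrite (modE _ _ _ 0%N hT) ?mulr0n ?addr0 //; exact: chinese_modr.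
Qed.

End PrimitiveDivision.

(** * Compatibility of the division polynomials with extension of the base field *)

Section BaseChange.
Variables (K L : fieldType) (iota : {rmorphism K -> L}) (E : weierstrass K).
Local Notation EL := (map_weierstrass iota E).
Local Notation "p ^i" := (map_poly iota p) (at level 2, format "p ^i").

Let mapE := (rmorph_nat, rmorphD, rmorphB, rmorphN, rmorphXn, rmorphM).

Lemma map_b2 : b2 EL = iota (b2 E). Proof. by rewrite /b2 /= !mapE. Qed.
Lemma map_b4 : b4 EL = iota (b4 E). Proof. by rewrite /b4 /= !mapE. Qed.
Lemma map_b6 : b6 EL = iota (b6 E). Proof. by rewrite /b6 /= !mapE. Qed.
Lemma map_b8 : b8 EL = iota (b8 E). Proof. by rewrite /b8 /= !mapE. Qed.

Lemma map_elliptic : is_elliptic EL = is_elliptic E.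
Proof.
rewrite /is_elliptic (_ : disc EL = iota (disc E)) ?fmorph_eq0 //.
by rewrite /disc map_b2 map_b4 map_b6 map_b8 !mapE.
Qed.

Lemma map_psi2sq : psi2sq EL = (psi2sq E)^i.
Proof.
rewrite /psi2sq map_b2 map_b4 map_b6.
move: (b2 E) (b4 E) (b6 E) => c2 c4 c6.
by rewrite !rmorphD /= !map_polyZ /= !map_polyXn ?map_polyX !map_polyC /= !mapE.
Qed.

Lemma map_psi3 : psi3 EL = (psi3 E)^i.
Proof.
rewrite /psi3 map_b2 map_b4 map_b6 map_b8.
move: (b2 E) (b4 E) (b6 E) (b8 E) => c2 c4 c6 c8.
by rewrite !rmorphD /= !map_polyZ /= !map_polyXn ?map_polyX !map_polyC /= !mapE.
Qed.

Lemma map_psi4_red : psi4_red EL = (psi4_red E)^i.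
Proof.
rewrite /psi4_red map_b2 map_b4 map_b6 map_b8.
move: (b2 E) (b4 E) (b6 E) (b8 E) => c2 c4 c6 c8.
by rewrite !rmorphD /= !map_polyZ /= !map_polyXn ?map_polyX !map_polyC /= !mapE.
Qed.

Lemma map_psi_red n : psi_red EL n = (psi_red E n)^i.
Proof.
elim/ltn_ind: n => n IH; rewrite psi_redE [X in X^i]psi_redE /psi_red_step.
case: ltnP => n5.
  case: n n5 {IH} => [|[|[|[|[|//]]]]] _ /=; rewrite ?rmorph0 ?rmorph1 //.
    exact: map_psi3.
  exact: map_psi4_red.
case: ifP => on; last by rewrite !(rmorphB, rmorphM, rmorphXn) !IH //; lia.
by case: ifP => om; rewrite !(rmorphB, rmorphM, rmorphXn) /= -map_psi2sq !IH //; lia.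
Qed.

Lemma map_prim_psi n : (0 < n)%N -> prim_psi EL n = (prim_psi E n)^i.
Proof.
elim/ltn_ind: n => n IH n0; rewrite prim_psiE // [X in X^i]prim_psiE //.
rewrite map_divp map_psi_red; congr (_ %/ _).
rewrite rmorph_prod big_seq_cond [RHS]big_seq_cond; apply: eq_bigr => m.
rewrite -dvdn_divisors // => /and3P[dm ne _]; apply: IH.
  by rewrite ltn_neqAle ne dvdn_leq.
exact: dvdn_gt0 n0 dm.
Qed.

Lemma map_prim_psi_x n : (0 < n)%N -> prim_psi_x EL n = (prim_psi_x E n)^i.
Proof.
by rewrite /prim_psi_x; case: eqP => _ n0; [exact: map_psi2sq|exact: map_prim_psi].
Qed.

End BaseChange.

(** * Automorphisms of the algebraic closure *)

Section Extension.
Variables (K : fieldType) (L : closedFieldType) (iota : {rmorphism K -> L}).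
Hypothesis algK : forall z : L, algebraicOver iota z.
Implicit Types (g : set (L * L)) (p q : {poly L}).

(* The graph of a K-embedding into L of a subring of L that contains K. *)
Definition embedding g :=
  [/\ forall a, g (iota a, iota a),
      forall a b c d, g (a, b) -> g (c, d) -> g (a - c, b - d),
      forall a b c d, g (a, b) -> g (c, d) -> g (a * c, b * d)
    & forall b, g (0, b) -> b = 0].

Section Embedding.
Variable g : set (L * L).
Hypothesis gP : embedding g.

Lemma embedding_iota a : g (iota a, iota a).
Proof. by case: gP => + _ _ _; apply. Qed.

Lemma embeddingB a b c d : g (a, b) -> g (c, d) -> g (a - c, b - d).
Proof. by case: gP => _ + _ _; apply. Qed.

Lemma embedding0 : g (0, 0).
Proof. by case: gP => h _ _ _; have := h 0; rewrite rmorph0. Qed.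

Lemma embedding1 : g (1, 1).
Proof. by case: gP => h _ _ _; have := h 1; rewrite rmorph1. Qed.

Lemma embeddingN a b : g (a, b) -> g (- a, - b).
Proof. by case: gP => _ h _ _ /(h _ _ _ _ embedding0); rewrite !sub0r. Qed.

Lemma embeddingD a b c d : g (a, b) -> g (c, d) -> g (a + c, b + d).
Proof.
by case: gP => _ h _ _ gab /embeddingN /(h _ _ _ _ gab); rewrite !opprK.
Qed.

Lemma embeddingM a b c d : g (a, b) -> g (c, d) -> g (a * c, b * d).
Proof. by case: gP => _ _ h _; exact: h. Qed.

Lemma embedding_fun a b c : g (a, b) -> g (a, c) -> b = c.
Proof.
case: gP => _ h _ h0 gb gc; apply/eqP; rewrite -subr_eq0; apply/eqP/h0.
by rewrite -[0](subrr a); exact: h.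
Qed.

Lemma embedding_sum (I : Type) (r : seq I) (F G : I -> L) :
  (forall i, g (F i, G i)) -> g (\sum_(i <- r) F i, \sum_(i <- r) G i).
Proof.
move=> h; elim: r => [|i r IH]; first by rewrite !big_nil; exact: embedding0.
by rewrite !big_cons; exact: embeddingD.
Qed.

Lemma embeddingX a b n : g (a, b) -> g (a ^+ n, b ^+ n).
Proof.
move=> h; elim: n => [|n IH]; first exact: embedding1.
by rewrite !exprS; exact: embeddingM.
Qed.

Definition polyfix p q := forall i, g (p`_i, q`_i).

Lemma polyfix_horner p q a b : polyfix p q -> g (a, b) -> g (p.[a], q.[b]).
Proof.
move=> pq ab; rewrite !(@horner_coef_wide _ (maxn (size p) (size q))) ?leq_maxl ?leq_maxr //.
by apply: embedding_sum => i; apply: embeddingM; [exact: pq|exact: embeddingX].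
Qed.

Lemma polyfix_map (r : {poly K}) : polyfix (map_poly iota r) (map_poly iota r).
Proof. by move=> i; rewrite coef_map; exact: embedding_iota. Qed.

Lemma polyfixC a b : g (a, b) -> polyfix a%:P b%:P.
Proof. by move=> h i; rewrite !coefC; case: eqP => _ //; exact: embedding0. Qed.

Lemma polyfix_X : polyfix 'X 'X.
Proof.
by move=> i; rewrite !coefX; case: eqP => _; [exact: embedding1|exact: embedding0].
Qed.

Lemma polyfixB p q p' q' : polyfix p q -> polyfix p' q' -> polyfix (p - p') (q - q').
Proof. by move=> h h' i; rewrite !coefB; exact: embeddingB. Qed.

Lemma polyfixM p q p' q' : polyfix p q -> polyfix p' q' -> polyfix (p * p') (q * q').
Proof.
by move=> h h' i; rewrite !coefM; apply: embedding_sum => j; exact: embeddingM.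
Qed.

Lemma polyfix0 q : polyfix 0 q -> q = 0.
Proof.
by case: gP => _ _ _ h0 h; apply/polyP => i; have := h i; rewrite !coef0 => /h0.
Qed.

(** Removing the powers of X from a polynomial over K that kills a nonzero [a] leaves s X + c with c
    nonzero, so the inverse of [a] is - s(a)/c. The embedding carries this relation to [b]. *)
Lemma embeddingV a b : g (a, b) -> g (a^-1, b^-1).
Proof.
move=> ab; case: (eqVneq a 0) => [a0|a0].
  case: gP => _ _ _ h0; rewrite a0 in ab *; rewrite (h0 _ ab) invr0.
  exact: embedding0.
have [r r0 ra] := algK a.
have [m [q]] := multiplicity_XsubC r 0; rewrite r0 /= => q0 er.
have [s es] : exists s, q - (q.[0])%:P = s * 'X.
  have /factor_theorem[s] : root (q - (q.[0])%:P) 0.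
    by rewrite rootE !(hornerD, hornerN, hornerC) subrr.
  by rewrite subr0 => ->; exists s.
set c := q.[0] in es q0; have c0 : iota c != 0 by rewrite fmorph_eq0.
have {es} es : q = s * 'X + c%:P by rewrite -es subrK.
pose s' := map_poly iota s.
have hq x : (map_poly iota q).[x] = s'.[x] * x + iota c.
  by rewrite es rmorphD rmorphM /= map_polyX map_polyC !horner_simp.
have qa : s'.[a] * a + iota c = 0.
  rewrite -hq; apply/eqP; move: ra; rewrite er rmorphM rmorphXn /= rootM.
  move=> /orP[//|]; rewrite subr0 map_polyX rootE horner_exp hornerX.
  by rewrite expf_eq0 (negbTE a0) andbF.
have qb : s'.[b] * b + iota c = 0.
  case: gP => _ _ _; apply; rewrite -{1}qa.
  apply: embeddingD; last exact: embedding_iota.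
  by apply: embeddingM => //; apply: polyfix_horner => //; exact: polyfix_map.
have invE x : s'.[x] * x + iota c = 0 -> x^-1 = s'.[x] * iota (- c^-1).
  move=> h; have x0 : x != 0.
    by apply: contra_neq c0 => z; move: h; rewrite z mulr0 add0r.
  apply: (mulfI x0); rewrite divff // rmorphN fmorphV.
  apply: (mulfI c0); rewrite mulr1.
  by apply: (lincomb1 (c := 1) h); field.
rewrite (invE _ qa) (invE _ qb); apply: embeddingM; last exact: embedding_iota.
by apply: polyfix_horner => //; exact: polyfix_map.
Qed.

Lemma embedding_inj0 a : g (a, 0) -> a = 0.
Proof.
move=> h; apply/eqP; apply: contraT => a0.
have := embeddingM h (embeddingV h); rewrite divff // mul0r => h1.
have := embedding_fun h1 embedding1 => /esym/eqP; by rewrite oner_eq0.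
Qed.

(** [q] is the minimal polynomial of [z] over the domain of the embedding, and [q'] is its image. *)
Lemma min_polyfix z : exists q q' n, [/\ polyfix q q', q`_n = 1, q'`_n = 1,
  size q = n.+1 & root q z] /\
  forall p p', polyfix p p' -> root p z -> p != 0 -> (n < size p)%N.
Proof.
pose Q n := `[< exists p p', [/\ polyfix p p', root p z, p != 0 & size p = n.+1] >].
have exQ : exists n, Q n.
  have [r r0 rz] := algK z; exists (size r).-1; apply/asboolP.
  exists (map_poly iota r), (map_poly iota r); split=> //.
  - exact: polyfix_map.
  - by rewrite map_poly_eq0.
  - by rewrite size_map_poly prednK // size_poly_gt0.
case: (ex_minnP exQ) => n /asboolP[p [p' [pp pz p0 sp]]] nmin.
have c0 : p`_n != 0 by move: p0; rewrite -lead_coef_eq0 lead_coefE sp.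
have c0' : p'`_n != 0.
  by apply: contra_neq c0 => z0; have := pp n; rewrite z0; exact: embedding_inj0.
exists ((p`_n)^-1%:P * p), ((p'`_n)^-1%:P * p'), n; split; first split.
- by apply: polyfixM => //; apply: polyfixC; apply: embeddingV.
- by rewrite coefCM mulVf.
- by rewrite coefCM mulVf.
- by rewrite mul_polyC size_scale // invr_eq0.
- by rewrite mul_polyC rootZ // invr_eq0.
move=> q q' qq qz q0; rewrite -[size q]prednK ?size_poly_gt0 // ltnS.
by apply: nmin; apply/asboolP; exists q, q'; rewrite prednK // size_poly_gt0.
Qed.

(** Division by [q], performed in parallel with division by [q']: the leading term of [p] is
    cancelled by a multiple of [q], that of [p'] by the corresponding multiple of [q'], and the size
    of [p] drops. *)
Lemma min_polyfix_root z q q' n z' : polyfix q q' -> q`_n = 1 -> q'`_n = 1 ->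
  size q = n.+1 -> root q z ->
  (forall p p', polyfix p p' -> root p z -> p != 0 -> (n < size p)%N) ->
  root q' z' -> forall p p', polyfix p p' -> root p z -> root p' z'.
Proof.
move=> qq qn qn' sq qz qmin qz' p.
have [k] := ubnP (size p); elim: k p => // k IH p sp p' pp pz.
case: (eqVneq p 0) => [p0|p0].
  by rewrite p0 in pp; rewrite (polyfix0 pp) root0.
have np := qmin _ _ pp pz p0; pose d := (size p).-1.
have sd : size p = d.+1 by rewrite prednK // size_poly_gt0.
pose t (c : L) := c%:P * 'X^(d - n).
have tt : polyfix (t p`_d * q) (t p'`_d * q').
  apply: polyfixM => //; apply: polyfixM; first exact: polyfixC.
  by move=> i; rewrite !coefXn; case: eqP => _; [exact: embedding1|exact: embedding0].
have := IH (p - t p`_d * q) _ (p' - t p'`_d * q') (polyfixB pp tt) _.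
rewrite !rootE !hornerD !hornerN !hornerM !(rootP qz') !(rootP qz) !mulr0 !subr0.
apply; last exact: pz.
apply: (@leq_trans d.+1); last by rewrite -sd.
rewrite ltnS; apply/leq_sizeP => j; rewrite leq_eqVlt coefB -mulrA coefCM coefXnM.
case/orP => [/eqP <-|dj].
  by rewrite ltnNge leq_subr /= subKn ?qn ?mulr1 ?subrr //; lia.
rewrite [p`_j]nth_default; last by rewrite sd.
rewrite ifF; last by lia.
by rewrite [q`_ _]nth_default ?mulr0 ?subr0 // sq; lia.
Qed.

(** The extension that sends [z] to [z'], as a graph; it is single-valued when polynomials killing
    [z] have images killing [z']. *)
Definition adjoin_root z z' : set (L * L) :=
  [set u | exists p p', polyfix p p' /\ u = (p.[z], p'.[z'])].

Lemma adjoin_root_embedding z z' :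
  (forall p p', polyfix p p' -> root p z -> root p' z') ->
  embedding (adjoin_root z z').
Proof.
move=> h; split.
- move=> a; exists (iota a)%:P, (iota a)%:P; rewrite !hornerC; split=> //.
  by apply: polyfixC; exact: embedding_iota.
- move=> _ _ _ _ [p [p' [pp [-> ->]]]] [q [q' [qq [-> ->]]]].
  by exists (p - q), (p' - q'); rewrite !hornerD !hornerN; split=> //; exact: polyfixB.
- move=> _ _ _ _ [p [p' [pp [-> ->]]]] [q [q' [qq [-> ->]]]].
  by exists (p * q), (p' * q'); rewrite !hornerM; split=> //; exact: polyfixM.
move=> _ [p [p' [pp [e ->]]]]; apply/eqP; rewrite -rootE; apply: h pp _.
by rewrite rootE -e.
Qed.

Lemma adjoin_root_sub z z' u : g u -> adjoin_root z z' u.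
Proof.
by case: u => a b h; exists a%:P, b%:P; rewrite !hornerC; split=> //; exact: polyfixC.
Qed.

Lemma adjoin_root_mem z z' : adjoin_root z z' (z, z').
Proof. by exists 'X, 'X; rewrite !hornerX; split=> //; exact: polyfix_X. Qed.

End Embedding.

Lemma embedding_extend g : embedding g ->
  exists2 M, embedding M & (g `<=` M)%classic /\ forall z, exists z', M (z, z').
Proof.
(* The maximal element is sought among the A for which the union of [g] and A is an embedding, so
   that the empty chain, too, has a bound, namely [g] itself. *)
move=> gP; pose P A := embedding (g `|` A)%classic.
have [A [PA Amax]] : exists A, P A /\ forall B, (A `<` B)%classic -> ~ P B.
  apply: Zorn_bigcup => F FP Ftot.
  have cover u v : (g `|` \bigcup_(X in F) X)%classic u ->
      (g `|` \bigcup_(X in F) X)%classic v ->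
      exists h, [/\ embedding h, h u, h v & (h `<=` g `|` \bigcup_(X in F) X)%classic].
    have sub X : F X -> (g `|` X `<=` g `|` \bigcup_(X in F) X)%classic.
      by move=> FX; apply: setUS => w Xw; exists X.
    case=> [gu|[X FX Xu]] [gv|[Y FY Yv]].
    - by exists g; split=> // w; left.
    - by exists (g `|` Y)%classic; split; [exact: FP|left|right|exact: sub].
    - by exists (g `|` X)%classic; split; [exact: FP|right|left|exact: sub].
    - case: (Ftot _ _ FX FY) => XY.
        exists (g `|` Y)%classic; split; [exact: FP| |by right|exact: sub].
        by right; exact: XY.
      exists (g `|` X)%classic; split; [exact: FP|by right| |exact: sub].
      by right; exact: XY.
  split.
  - by move=> a; left; exact: embedding_iota.
  - move=> a b c d h1 h2; have [h [[_ hB _ _] hu hv]] := cover _ _ h1 h2.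
    by apply; exact: hB.
  - move=> a b c d h1 h2; have [h [[_ _ hM _] hu hv]] := cover _ _ h1 h2.
    by apply; exact: hM.
  - move=> b h1; have [h [[_ _ _ h0] hu _ _]] := cover _ _ h1 h1.
    exact: h0.
exists (g `|` A)%classic => //; split; first by move=> u; left.
move=> z; have [q [q' [n [[qq qn qn' sq qz] qmin]]]] := min_polyfix PA z.
have [z' qz'] : exists z', root q' z'.
  apply/closed_rootP; case: n qn' sq qz {qmin qn} => [|n] qn' sq qz.
    have /eqP/size_poly1P[c c0 ec] := sq.
    by move: qz; rewrite ec rootE hornerC (negbTE c0).
  apply/eqP => s1; move: qn'; rewrite nth_default ?s1 // => /esym/eqP.
  by rewrite oner_eq0.
have gP' := adjoin_root_embedding PA (min_polyfix_root PA qq qn qn' sq qz qmin qz').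
set g' := adjoin_root _ z z' in gP'.
have sub : (g `|` A `<=` g')%classic by exact: adjoin_root_sub.
(* If [z] had no image, adjoining (z, z') would contradict maximality. *)
exists z'; apply: contrapT => nz; apply: (Amax g'); last first.
  by rewrite /P (_ : (g `|` g')%classic = g') //; apply/setUidPr => u gu; apply: sub; left.
split; first by move=> u Au; apply: sub; right.
by move=> h; apply: nz; right; apply: h; exact: adjoin_root_mem.
Qed.

Lemma embedding_gal g : embedding g ->
  exists s : Defs.gal (range iota), forall a b, g (a, b) -> s a = b.
Proof.
case/embedding_extend => M MP [gM Mtot].
have [f fP] := choice Mtot.
have fE a b : M (a, b) -> f a = b by exact: (embedding_fun MP (fP a)).
have fB : zmod_morphism f.
  by move=> x y; apply: fE; exact: embeddingB.
have fM : monoid_morphism f.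
  split; first by apply: fE; exact: embedding1.
  by move=> x y; apply: fE; exact: embeddingM.
have fI a : f (iota a) = iota a by apply: fE; exact: embedding_iota.
have f_inj : injective f.
  move=> x y exy; apply/eqP; rewrite -subr_eq0; apply/eqP.
  apply: (embedding_inj0 MP); have := fP (x - y); rewrite fB exy subrr.
  by [].
have f_surj w : exists v, f v = w.
  (* The injective map [f] preserves the finite set of roots of a polynomial over K that kills [w],
     so it permutes them. *)
  have [r r0 rw] := algK w; set p := map_poly iota r in rw.
  have p0 : p != 0 by rewrite map_poly_eq0.
  have [rs ers] := closed_field_poly_normal p.
  have rsP x : (x \in undup rs) = root p x.
    by rewrite mem_undup ers rootZ ?lead_coef_eq0 // root_prod_XsubC.
  have frs : {subset map f (undup rs) <= undup rs}.
    move=> _ /mapP[x + ->]; rewrite !rsP !rootE => /eqP px.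
    apply/eqP; have := polyfix_horner MP (polyfix_map MP r) (fP x).
    by rewrite -/p px => /(embedding_fun MP) /(_ (embedding0 MP)).
  have ufrs : uniq (map f (undup rs)) by rewrite map_inj_uniq ?undup_uniq.
  have [_ h] := uniq_min_size ufrs frs (eq_leq (esym (size_map _ _))).
  have := h w; rewrite rsP rw => /mapP[v _ ->]; by exists v.
have [f' f'P] := choice f_surj.
have fK : cancel f f' by move=> x; apply: f_inj; rewrite f'P.
have ffix a : range iota a -> f a = a by move=> [b _ <-]; exact: fI.
exists (Defs.Gal fB fM fK f'P ffix) => a b /gM; exact: fE.
Qed.

End Extension.

(** * Fixed fields and restriction of automorphisms *)

Section FixedField.
Variables (K : fieldType) (L : closedFieldType) (iota : {rmorphism K -> L}).
Hypothesis algK : forall z : L, algebraicOver iota z.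
Hypothesis char0 : forall n, n.+1%:R != 0 :> L.

(** Every root of the minimal polynomial of [z] over [F] is the image of [z] under an automorphism
    fixing [F], hence is [z]. The polynomial is then (X - z)^n, its second coefficient - n z lies in
    [F], and n is invertible. *)
Lemma fixed_field (F : divringClosed L) (z : L) : (forall a, iota a \in F) ->
  (forall s : Defs.gal (range iota), (forall a, a \in F -> s a = a) -> s z = z) ->
  z \in F.
Proof.
move=> iF fixz; pose g : set (L * L) := [set u | u.1 \in F /\ u.1 = u.2]%classic.
have gP : embedding iota g.
  split.
  - by move=> a; split=> /=.
  - by move=> a b c d [/= aF <-] [/= cF <-]; split; rewrite //= rpredB.
  - by move=> a b c d [/= aF <-] [/= cF <-]; split; rewrite //= rpredM.
  - by move=> b [].
have [q [q' [n [[qq qn qn' sq qz] qmin]]]] := min_polyfix algK gP z.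
have eqq : q' = q by apply/polyP => i; have [_] := qq i.
subst q'; have rootq w : root q w -> w = z.
  move=> qw; have h := min_polyfix_root gP qq qn qn' sq qz qmin qw.
  have gP' := adjoin_root_embedding gP h.
  have [s hs] := embedding_gal algK gP'.
  have <- : s z = w by apply: hs; exact: adjoin_root_mem gP _ _.
  by apply: fixz => a aF; apply/hs/(adjoin_root_sub gP).
have [rs ers] := closed_field_poly_normal q.
have lq : lead_coef q = 1 by rewrite lead_coefE sq.
rewrite lq scale1r in ers.
have rsz w : w \in rs -> w = z.
  by move=> h; apply: rootq; rewrite ers root_prod_XsubC.
have srs : size rs = n by move: sq; rewrite ers size_prod_XsubC => -[].
have n0 : n != 0%N.
  apply/eqP => n0; move: qz; have /eqP/size_poly1P[c c0 ->] : size q = 1%N by rewrite sq n0.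
  by rewrite rootE hornerC (negbTE c0).
have : q`_n.-1 \in F by have [] := qq n.-1.
rewrite ers -srs coefPn_prod_XsubC ?srs // rpredN.
have -> : \sum_(r <- rs) r = z * n%:R.
  rewrite -srs mulr_natr -sum1_size -sumrMnr big_seq [RHS]big_seq.
  by apply: eq_bigr => r /rsz ->.
case: (n) n0 => // m _ h.
by rewrite -(mulfK (char0 m) z) rpred_div // rpred_nat.
Qed.

Lemma gen_field_sub (A : set L) x : A x -> x \in gen_field A.
Proof. by move=> Ax; apply/asboolP => M [_ AM]; exact: AM. Qed.

Lemma gen_field_min (A : set L) (F : divringClosed L) :
  (forall x, A x -> x \in F) -> {subset gen_field A <= F}.
Proof.
move=> AF x /asboolP h; apply: (h [set y | y \in F]%classic); split; last exact: AF.
pose M := [set y | y \in F]%classic.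
have E y : (y \in M) = (y \in F) by apply/idP/idP; rewrite in_setE.
have E' y : (y \in (fun x => x \in M)) = (y \in F) by exact: E.
by split=> [|a b|a b]; rewrite !E'; [exact: rpred1|exact: rpredB|exact: rpred_div].
Qed.

Definition equalizer (s t : Defs.gal (range iota)) : pred L := fun x => s x == t x.

Lemma equalizer_closed s t : GRing.divring_closed (equalizer s t).
Proof.
split=> [|x y /eqP ex /eqP ey|x y /eqP ex /eqP ey]; apply/eqP.
- by rewrite !rmorph1.
- by rewrite !rmorphB /= ex ey.
- by rewrite !fmorph_div /= ex ey.
Qed.

HB.instance Definition _ s t :=
  GRing.isDivringClosed.Build L (equalizer s t) (equalizer_closed s t).

Definition gal_preim (s : Defs.gal (range iota)) (F : divringClosed L) : pred L :=
  fun x => s x \in F.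

Lemma gal_preim_closed s F : GRing.divring_closed (gal_preim s F).
Proof.
split=> [|x y sx sy|x y sx sy].
- by change (s 1 \in F); rewrite rmorph1 rpred1.
- by change (s (x - y) \in F); rewrite rmorphB; exact: rpredB.
- by change (s (x / y) \in F); rewrite fmorph_div; exact: rpred_div.
Qed.

HB.instance Definition _ s F :=
  GRing.isDivringClosed.Build L (gal_preim s F) (gal_preim_closed s F).

Lemma adjoin_iota A a : iota a \in adjoin iota A.
Proof. by apply: gen_field_sub; left; exists a. Qed.

Lemma adjoin_sub (A : set L) x : A x -> x \in adjoin iota A.
Proof. by move=> Ax; apply: gen_field_sub; right. Qed.

Lemma adjoin_min (A : set L) (F : divringClosed L) : (forall a, iota a \in F) ->
  (forall x, A x -> x \in F) -> {subset adjoin iota A <= F}.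
Proof.
move=> iF AF; apply: gen_field_min => x [[a _ <-]|]; [exact: iF|exact: AF].
Qed.

Lemma adjoin_agree (A : set L) (s t : Defs.gal (range iota)) :
  (forall x, A x -> s x = t x) -> forall x, x \in adjoin iota A -> s x = t x.
Proof.
move=> h x xA; apply/eqP; change (x \in equalizer s t).
apply: adjoin_min xA => [a|y /h e]; rewrite unfold_in /equalizer ?e //.
by rewrite !gal_iota.
Qed.

Lemma adjoin_stable (A : set L) (s : Defs.gal (range iota)) :
  (forall x, A x -> s x \in adjoin iota A) ->
  forall x, x \in adjoin iota A -> s x \in adjoin iota A.
Proof.
move=> h x xA; change (x \in gal_preim s (adjoin iota A)).
apply: adjoin_min xA => [a|y /h //]; rewrite unfold_in /gal_preim gal_iota.
exact: adjoin_iota.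
Qed.

Lemma gal_root (s : Defs.gal (range iota)) (p : {poly K}) x :
  root (map_poly iota p) x -> root (map_poly iota p) (s x).
Proof.
rewrite !rootE => /eqP px; apply/eqP; rewrite -[RHS](rmorph0 s) -px.
rewrite -horner_map /= -map_poly_comp; congr (_.[_]).
by apply/polyP => i; rewrite !coef_map /= gal_iota.
Qed.

Definition extends (F : divringClosed L) (s : absolute_Gal iota) (t : Gal_over iota F) :=
  forall a : subfield F, s (val a) = val (t a).

Lemma extends_surj (F : divringClosed L) (t : Gal_over iota F) :
  (forall a, iota a \in F) -> exists s, extends s t.
Proof.
move=> iF; pose g : set (L * L) := 
    [set u | exists a : subfield F, u = (val a, val (t a))]%classic.
have gP : embedding iota g.
  split.
  - move=> a; exists (Subfield (iF a)); rewrite gal_fix //=.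
    by exists a.
  - by move=> _ _ _ _ [a [-> ->]] [b [-> ->]]; exists (a - b); rewrite !rmorphB.
  - by move=> _ _ _ _ [a [-> ->]] [b [-> ->]]; exists (a * b); rewrite !rmorphM.
  - move=> b [a [a0 ->]]; have -> : a = 0 by apply: val_inj; exact: esym a0.
    by rewrite rmorph0.
have [s hs] := embedding_gal algK gP.
by exists s => a; apply: hs; exists a.
Qed.

Lemma extends_ex (F : divringClosed L) (s : absolute_Gal iota) :
  (forall u : absolute_Gal iota, forall x, x \in F -> u x \in F) ->
  exists t : Gal_over iota F, extends s t.
Proof.
move=> st; have stV (a : subfield F) : s (val a) \in F by apply: st; exact: (valP a).
have stV' (a : subfield F) : (s^-1)%g (val a) \in F by apply: st; exact: (valP a).
pose f (a : subfield F) := Subfield (stV a).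
pose f' (a : subfield F) := Subfield (stV' a).
have fB : zmod_morphism f by move=> x y; apply: val_inj; rewrite /= rmorphB.
have fM : monoid_morphism f.
  by split=> [|x y]; apply: val_inj; rewrite /= ?rmorph1 ?rmorphM.
have fK : cancel f f'.
  by move=> x; apply: val_inj; rewrite /= gal_invgE gal_funK.
have f'K : cancel f' f.
  by move=> x; apply: val_inj; rewrite /= gal_invgE gal_invK.
have ff a : [set x : subfield F | range iota (val x)]%classic a -> f a = a.
  by move=> [b _ h]; apply: val_inj; rewrite /= -h gal_iota.
by exists (Defs.Gal fB fM fK f'K ff).
Qed.

(** Each automorphism of [F] is lifted to the closure and sent through [r]. As [r] identifies the
    same automorphisms as restriction to [F], the choice of lift is immaterial and the map is
    injective. *)
Lemma image_isomorphic (F : divringClosed L) (H : groupType)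
    (r : {multiplicative absolute_Gal iota -> H}) :
  (forall a, iota a \in F) ->
  (forall u : absolute_Gal iota, forall x, x \in F -> u x \in F) ->
  (forall s t : absolute_Gal iota, r s = r t <-> (forall x, x \in F -> s x = t x)) ->
  isomorphic (Gal_over iota F) (group_image r).
Proof.
move=> iF stF rE.
have [c cP] := choice (fun t : Gal_over iota F => extends_surj t iF).
have im t : im_pred r (r (c t)) by apply/asboolP; exists (c t).
pose f t : group_image r := GroupImage (im t).
have val_ext s t x (xF : x \in F) : extends s t -> s x = val (t (Subfield xF)).
  by move=> e; rewrite -(e (Subfield xF)).
have fM : {morph f : x y / (x * y)%g}.
  move=> x y; apply: val_inj; rewrite /= -gmulfM; apply/rE => z zF.
  by rewrite (val_ext _ _ _ zF (cP _)) !gal_mulE -!cP.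
have f_inj : injective f.
  move=> x y /(congr1 val) /= /rE h; apply: gal_ext => a; apply: val_inj.
  by rewrite -!cP h ?(valP a).
have f_surj h : exists t, f t = h.
  have /asboolP[s sh] := valP h; have [t st] := extends_ex s stF.
  exists t; apply: val_inj; rewrite -sh /=; apply/rE => x xF.
  by rewrite (val_ext _ _ _ xF st) (val_ext _ _ _ xF (cP t)).
have [f' f'P] := choice f_surj.
pose m := isMultiplicative.Build _ _ f fM.
exists (HB.pack f m : {multiplicative Gal_over iota F -> group_image r}).
by exists f' => [x|//]; apply: f_inj; rewrite f'P.
Qed.

End FixedField.

(** * Torsion fields *)

Section TorsionFields.
Variables (K : fieldType) (L : closedFieldType) (iota : {rmorphism K -> L}).
Variable E : weierstrass K.
Hypothesis char0 : forall n, n.+1%:R != 0 :> L.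
Hypothesis E_elliptic : is_elliptic E.
Variable n : nat.
Hypothesis n1 : (1 < n)%N.

Local Notation EL := (map_weierstrass iota E).
Let ell : is_elliptic EL := etrans (map_elliptic iota E) E_elliptic.
Local Notation EG := (ecG (char0 1) ell).
Local Notation G := (absolute_Gal iota).
Implicit Types (s t : G) (P Q : EG).

Let act s P : EG := gal_ec s P.

Lemma gal1x (x : L) : (1%g : G) x = x.
Proof. exact: gal_oneE. Qed.

Lemma gal_ecM s t (P : ec EL) : gal_ec (s * t)%g P = gal_ec s (gal_ec t P).
Proof.
by apply: val_inj => /=; case: (ec_val P) => [[x y]|] //=; rewrite !gal_mulE.
Qed.

Lemma gal_ec1 (P : ec EL) : gal_ec (1%g : G) P = P.
Proof.
by apply: val_inj => /=; case: (ec_val P) => [[x y]|] //=; rewrite !gal_oneE.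
Qed.

Lemma actD s P Q : act s (P + Q) = act s P + act s Q.
Proof. exact: gal_add. Qed.

Lemma act0 s : act s 0 = 0.
Proof. exact: val_inj. Qed.

Lemma actN s P : act s (- P) = - act s P.
Proof. by apply/eqP; rewrite -addr_eq0 -actD addNr act0. Qed.

Lemma actMn s P m : act s (P *+ m) = act s P *+ m.
Proof. by elim: m => [|m IH]; rewrite ?mulr0n ?act0 // !mulrS actD IH. Qed.

Lemma act_aff s P x e : aff P x e -> aff (act s P) (s x) (s e).
Proof.
move=> [y [h ->]]; exists (s y); rewrite /= h; split=> //.
by rewrite /eta !(rmorph_nat, rmorphD, rmorphM) /= !gal_iota.
Qed.

Definition act_same s t := forall P, P *+ n = 0 -> act s P = act t P.
Definition act_opp s t := forall P, P *+ n = 0 -> act s P = - act t P.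
(** The sign may depend on the point; [act_pm_or] makes it uniform. *)
Definition act_pm s t := forall P, P *+ n = 0 -> act s P = act t P \/ act s P = - act t P.

(* A group is not the union of two proper subgroups. *)
Lemma act_pm_or s t : act_pm s t -> act_same s t \/ act_opp s t.
Proof.
move=> pm; apply: contrapT => h.
have [P Pn Ph] : exists2 P, P *+ n = 0 & act s P <> act t P.
  apply: contrapT => h'; apply: h; left => P Pn; apply: contrapT => ne.
  by apply: h'; exists P.
have [Q Qn Qh] : exists2 Q, Q *+ n = 0 & act s Q <> - act t Q.
  apply: contrapT => h'; apply: h; right => Q Qn; apply: contrapT => ne.
  by apply: h'; exists Q.
have hP : act s P = - act t P by case: (pm _ Pn).
have hQ : act s Q = act t Q by case: (pm _ Qn).
have : (P + Q) *+ n = 0 by rewrite mulrnDl Pn Qn addr0.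
case/pm; rewrite !actD hP hQ => e.
  by apply: Ph; rewrite hP; exact: addIr e.
by apply: Qh; rewrite hQ; move: e; rewrite opprD => /addrI.
Qed.

Lemma torsion_mulr0 (P : torsion EL n) : (P : EG) *+ n = 0.
Proof. by rewrite -ec_mulE; apply/eqP; exact: (valP P). Qed.

Lemma torsion_of P : P *+ n = 0 -> exists T : torsion EL n, torsion_val T = P.
Proof. by rewrite -ec_mulE => /eqP h; exists (Torsion h). Qed.

Lemma rho_same s t : torsion_rep iota E n s = torsion_rep iota E n t <-> act_same s t.
Proof.
split=> [h P /torsion_of[T <-]|h].
  by have /(congr1 (fun f : torsion_aut EL n => torsion_val (f T))) := h.
by apply: taut_ext => T; apply: val_inj; apply: h; exact: torsion_mulr0.
Qed.

Lemma rho_opp s t : torsion_rep iota E n s =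
  (taut_opp EL n * torsion_rep iota E n t)%g <-> act_opp s t.
Proof.
split=> [h P /torsion_of[T <-]|h].
  by have /(congr1 (fun f : torsion_aut EL n => torsion_val (f T))) := h.
by apply: taut_ext => T; apply: val_inj; apply: h; exact: torsion_mulr0.
Qed.

(** Equality in the quotient asks for one sign valid on all of E[n], whereas x-coordinates detect a
    sign at each point; [act_pm_or] bridges the two. *)
Lemma prep_pm s t : torsion_prep iota E n s = torsion_prep iota E n t <-> act_pm s t.
Proof.
have -> : (torsion_prep iota E n s = torsion_prep iota E n t) <->
    (torsion_rep iota E n t = torsion_rep iota E n s \/
     torsion_rep iota E n t = (taut_opp EL n * torsion_rep iota E n s)%g).
  exact: quot_piP.
rewrite rho_same rho_opp; split=> [[] h P Pn|/act_pm_or[] h].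
- by left; rewrite h.
- by right; rewrite h // opprK.
- by left=> P Pn; rewrite h.
- by right=> P Pn; rewrite h // opprK.
Qed.

Lemma act_pm_x s t P x e : P *+ n = 0 -> aff P x e -> act_pm s t -> s x = t x.
Proof.
move=> Pn hP /(_ _ Pn)[] h; have hs := act_aff s hP; have ht := act_aff t hP.
  by rewrite h in hs; have [] := aff_fun hs ht.
by rewrite h in hs; have [] := aff_fun hs (aff_opp ht).
Qed.

Lemma act_pm_aff s t P x e : aff P x e -> s x = t x ->
  act s P = act t P \/ act s P = - act t P.
Proof.
by move=> hP h; have hs := act_aff s hP; rewrite h in hs; exact: aff_same_x hs (act_aff t hP).
Qed.

Let rootx := [set x | root (map_poly iota (prim_psi_x E n)) x]%classic.

Lemma root_prim_psi_x P x e : aff P x e -> rootx x <-> has_order P n.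
Proof.
by move=> hP; rewrite /rootx /= -map_prim_psi_x ?(ltnW n1) //; apply: (prim_psi_xP n1 hP).
Qed.

Lemma root_agree_pm s t : (forall x, rootx x -> s x = t x) <-> act_pm s t.
Proof.
split=> [h Q Qn|pm x rx]; last first.
  have [P [e hP]] := aff_above char0 ell x.
  have /(root_prim_psi_x hP) hn := rx.
  by apply: act_pm_x hP pm; apply/hn.
have n0 : (0 < n)%N by lia.
have [d d0 hd] := has_order_ex n0 Qn.
have dn : (d %| n)%N by apply/hd.
have [P [j [hn ->]]] := has_order_lift n0 dn hd.
rewrite !actMn; case: (affP P) => [P0|[x [e hP]]].
  by left; rewrite P0 !act0.
have /h xst : rootx x by apply/(root_prim_psi_x hP).
by case: (act_pm_aff hP xst) => ->; [left|right]; rewrite // mulNrn.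
Qed.

Local Notation Kpsi := (splitting_field iota (prim_psi_x E n)).
Local Notation KEn := (torsion_field iota E n).
Local Notation KxEn := (torsion_x_field iota E n).

Lemma Kpsi_agree s t : (forall x, x \in Kpsi -> s x = t x) <-> act_pm s t.
Proof.
rewrite -root_agree_pm; split=> h x hx; first by apply/h/adjoin_sub.
exact: adjoin_agree h _ hx.
Qed.

Lemma Kpsi_stable s x : x \in Kpsi -> s x \in Kpsi.
Proof.
by apply: adjoin_stable => {}x rx; apply: adjoin_sub; exact: gal_root.
Qed.

(** This is the condition of [Kpsi_agree]: the abscissas of all n-torsion points carry the same
    information as those of exact order n. *)
Lemma KxEn_agree s t : (forall x, x \in KxEn -> s x = t x) <-> act_pm s t.
Proof.
split=> [h P Pn|pm].
  case: (affP P) => [->|[x [e hP]]]; first by left; rewrite !act0.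
  apply: (act_pm_aff hP); apply: h; apply: adjoin_sub.
  by have [T eT] := torsion_of Pn; have [y [hy _]] := hP; exists T, y; rewrite eT.
move=> z hz; apply: (adjoin_agree _ hz) => {z hz} x [T [y hT]].
apply: act_pm_x (torsion_mulr0 T) _ pm; exists y; split; first exact: hT.
reflexivity.
Qed.

Lemma KEn_agree s t : (forall x, x \in KEn -> s x = t x) <-> act_same s t.
Proof.
split=> [h P Pn|same].
  case: (affP P) => [->|[x [e hP]]]; first by rewrite !act0.
  have [T eT] := torsion_of Pn; have [y [hy _]] := hP.
  have hx : x \in KEn by apply: adjoin_sub; exists T, x, y; rewrite eT; split; [|left].
  have hy' : y \in KEn by apply: adjoin_sub; exists T, x, y; rewrite eT; split; [|right].
  by apply: val_inj; rewrite /= hy /= !h.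
move=> z0 hz0; apply: (adjoin_agree _ hz0) => {z0 hz0} z [T [x [y [hT hz]]]].
have := congr1 val (same _ (torsion_mulr0 T)); rewrite /= hT /= => -[ex ey].
by case: hz => ->.
Qed.

Lemma KxEn_sub : {subset KxEn <= KEn}.
Proof.
apply: adjoin_min => [a|x [T [y hT]]]; first exact: adjoin_iota.
by apply: adjoin_sub; exists T, x, y; split=> //; left.
Qed.

Lemma KEn_stable s x : x \in KEn -> s x \in KEn.
Proof.
apply: adjoin_stable => {}x [T [y [z [hT hx]]]]; apply: adjoin_sub.
have hn : act s T *+ n = 0 by rewrite -actMn torsion_mulr0 act0.
have [T' eT'] := torsion_of hn.
exists T', (s y), (s z); rewrite eT' /= hT; split=> //.
by case: hx => ->; [left|right].
Qed.

Hypothesis algK : forall z : L, algebraicOver iota z.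

Lemma Gal_Kpsi_prep :
  isomorphic (Gal_over iota Kpsi) (group_image (torsion_prep iota E n)).
Proof.
apply: (image_isomorphic algK (r := torsion_prep iota E n)) => [a|u x|s t].
- exact: adjoin_iota.
- exact: Kpsi_stable.
- by rewrite prep_pm Kpsi_agree.
Qed.

Local Notation minus_id_in_image :=
  ((exists s, torsion_rep iota E n s = taut_opp EL n) /\ taut_opp EL n <> 1%g).

(** If [s] acts as the opposite of [t], then s t^-1 acts as -id, which therefore lies in the image
    and must equal id. *)
Lemma act_pm_same : ~ minus_id_in_image -> forall s t, act_pm s t -> act_same s t.
Proof.
move=> h s t /act_pm_or[//|/rho_opp e]; apply/rho_same.
suff z1 : taut_opp EL n = 1%g by rewrite e z1 mul1g.
apply: contrapT => z1; apply: h; split=> //; exists (s * t^-1)%g.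
apply: (mulIg (torsion_rep iota E n t)).
by rewrite -gmulfM mulgVK; exact: e.
Qed.

Lemma Gal_Kpsi_rep : ~ minus_id_in_image ->
  isomorphic (Gal_over iota Kpsi) (group_image (torsion_rep iota E n)).
Proof.
move=> h; apply: (image_isomorphic algK (r := torsion_rep iota E n)) => [a|u x|s t].
- exact: adjoin_iota.
- exact: Kpsi_stable.
- rewrite rho_same Kpsi_agree; split=> [same P Pn|]; last exact: act_pm_same.
  by left; exact: same.
Qed.

Lemma torsion_field_eq : ~ minus_id_in_image -> KEn =i KxEn.
Proof.
move=> h z; apply/idP/idP => hz; last exact: KxEn_sub.
apply: (fixed_field algK char0) => [a|s fs]; first exact: adjoin_iota.
suff /KEn_agree h1 : act_same s 1%g by rewrite h1 ?gal1x.
apply: (act_pm_same h); apply/KxEn_agree => x hx; rewrite gal1x; exact: fs.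
Qed.

(** An automorphism [u] acting as -id fixes [KxEn] and is an involution of [KEn]. The basis is 1 and
    an element [e] with u(e) = - e; the coordinates come from the even and odd parts under [u]. *)
Lemma torsion_field_degree : minus_id_in_image -> extension_degree KxEn KEn 2.
Proof.
move=> [[u hu] zn1]; split; first exact: KxEn_sub.
have u1 : act_opp u 1%g.
  apply/rho_opp; rewrite hu (_ : torsion_rep iota E n 1%g = 1%g) ?mulg1 //.
  by apply: taut_ext => T; apply: val_inj; exact: gal_ec1.
have uP P : P *+ n = 0 -> act u P = - P.
  by move=> Pn; rewrite (u1 _ Pn) /act gal_ec1.
have uu z : z \in KEn -> u (u z) = z.
  move=> hz; have -> : u (u z) = (u * u)%g z by rewrite gal_mulE.
  suff /KEn_agree h : act_same (u * u)%g 1%g by rewrite h ?gal1x.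
  move=> P Pn; transitivity (act u (act u P)); first exact: gal_ecM.
  by rewrite (uP _ Pn) actN (uP _ Pn) opprK [RHS]gal_ec1.
have ux x : x \in KxEn -> u x = x.
  have /KxEn_agree h : act_pm u 1%g by move=> P Pn; right; exact: u1.
  by move=> /h ->; rewrite gal1x.
(* If all ordinates vanished, each n-torsion point would be its own opposite, against -id being
   different from id. *)
have [P [x [e [Pn hP e0]]]] : exists P x e, [/\ P *+ n = 0, aff P x e & e != 0].
  apply: contrapT => h; apply: zn1; apply: taut_ext => T; apply: val_inj.
  have Tn := torsion_mulr0 T.
  case: (affP (T : EG)) => [T0|[x [e hT]]].
    by apply: val_inj; rewrite /= T0.
  case: (eqVneq e 0) => [z|e0]; first by rewrite z in hT; exact: aff_opp0 hT.
  by case: h; exists (T : EG), x, e.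
have ue : u e = - e.
  have h := act_aff u hP; rewrite uP // in h.
  by have [_] := aff_fun h (aff_opp hP).
have eE : e \in KEn.
  have [T eT] := torsion_of Pn; have [y [hy ->]] := hP.
  have hx : x \in KEn by apply: adjoin_sub; exists T, x, y; rewrite eT; split; [|left].
  have hy' : y \in KEn by apply: adjoin_sub; exists T, x, y; rewrite eT; split; [|right].
  rewrite /eta /=; apply: rpredD; last exact: adjoin_iota.
  by apply: rpredD; apply: rpredM => //; [exact: rpred_nat|exact: adjoin_iota].
have two0 : (2 : L) != 0 := char0 1.
pose c0 z := (z + u z) / 2; pose c1 z := (z - u z) / (2 * e).
have cE z : z = c0 z + c1 z * e by rewrite /c0 /c1; field; rewrite e0 two0.
have cx z : z \in KEn -> c0 z \in KxEn /\ c1 z \in KxEn.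
  move=> hz; have huz := KEn_stable u hz.
  (* An automorphism fixing [KxEn] acts on [KEn] as the identity or as [u], so invariance under [u]
     puts [c0 z] and [c1 z] in [KxEn]. *)
  have key (s : G) : (forall a, a \in KxEn -> s a = a) ->
      (forall a, a \in KEn -> s a = a) \/ (forall a, a \in KEn -> s a = u a).
    move=> fs; have /KxEn_agree : forall a, a \in KxEn -> s a = (1%g : G) a.
      by move=> a /fs ->; rewrite gal1x.
    move/act_pm_or => [] h.
    - by left=> a ha; move/KEn_agree: h => ->; rewrite ?gal1x.
    - by right; apply/KEn_agree => Q Qn; rewrite h // u1.
  split; apply: (fixed_field algK char0) => [a|s /key[] h]; try exact: adjoin_iota.
  - by rewrite /c0 fmorph_div rmorphD rmorph_nat /= !h.
  - by rewrite /c0 fmorph_div rmorphD rmorph_nat /= !h // uu // addrC.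
  - by rewrite /c1 fmorph_div rmorphB rmorphM rmorph_nat /= !h.
  - rewrite /c1 fmorph_div rmorphB rmorphM rmorph_nat /= !h // uu // ue.
    by field; rewrite oppr_eq0 e0 two0.
pose b (i : 'I_2) : subfield KEn := if i == ord0 then 1 else Subfield eE.
exists b => z; have [z0 z1] := cx _ (valP z).
have uniq_c a d : a \in KxEn -> d \in KxEn -> val z = a + d * e ->
    a = c0 (val z) /\ d = c1 (val z).
  move=> ha hd ->; rewrite /c0 /c1 rmorphD rmorphM /= (ux _ ha) (ux _ hd) ue.
  by split; field; rewrite ?e0 two0.
exists [ffun i => if i == ord0 then Subfield z0 else Subfield z1]; split.
  by rewrite !big_ord_recl big_ord0 !ffunE /= mulr1 addr0 -cE.
move=> c; rewrite !big_ord_recl big_ord0 /= mulr1 addr0.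
move=> /(uniq_c _ _ (valP _) (valP _))[h0 h1]; apply/ffunP => i; rewrite ffunE.
apply: val_inj; case: i => [[|[|//]] hi] /=.
  by rewrite -h0; congr (val (c _)); exact: val_inj.
by rewrite -h1; congr (val (c _)); exact: val_inj.
Qed.

End TorsionFields.

Theorem theorem1p9
  (K : fieldExtType rat)
  (Kbar : closedFieldType) (iota : {rmorphism K -> Kbar})
  (Kbar_algebraic : forall z : Kbar, algebraicOver iota z)
  (E : weierstrass K) (E_elliptic : is_elliptic E)
  (n : nat) (n_ge2 : (2 <= n)%N) :
  let rho : {multiplicative absolute_Gal iota ->
               torsion_aut (map_weierstrass iota E) n} :=
    torsion_rep iota E n in
  let rho_bar := torsion_prep iota E n in
  let minus_id := taut_opp (map_weierstrass iota E) n in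
  let Kpsi := splitting_field iota (prim_psi_x E n) in
  let KEn := torsion_field iota E n in
  let KxEn := torsion_x_field iota E n in
  let minus_id_in_image := (exists s, rho s = minus_id) /\ minus_id <> 1%g in
  isomorphic (Gal_over iota Kpsi) (group_image rho_bar) /\
  (minus_id_in_image -> extension_degree KxEn KEn 2) /\
  (~ minus_id_in_image ->
     KEn =i KxEn /\ isomorphic (Gal_over iota Kpsi) (group_image rho)).
Proof.
have char0 m : m.+1%:R != 0 :> Kbar.
  rewrite -(rmorph_nat iota) fmorph_eq0 -(rmorph_nat (in_alg K)) fmorph_eq0.
  by rewrite Num.Theory.pnatr_eq0.
split; first exact: Gal_Kpsi_prep.
split; first exact: torsion_field_degree.
by move=> h; split; [exact: torsion_field_eq | exact: Gal_Kpsi_rep].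
Qed.
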